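(* Let $P_{XY_1Y_2Z_1Z_2}$ be a pmf on a finite product alphabet such that there is no side information, i.e., $Z_1$ and $Z_2$ are constants. Then for all nonnegative rates $(R_0,R_1,R_2)$, $$\mathcal{E}_{\mathrm{GW}}^{\mathrm{SI}}(R_0,R_1,R_2)=\mathcal{E}_{\mathrm{GW}}^{\mathrm{SI,in}}(R_0,R_1,R_2)=\mathcal{E}_{\mathrm{GW}}(R_0,R_1,R_2),$$ where $\mathcal{E}_{\mathrm{GW}}^{\mathrm{SI}}$ is the (operational) exponents region of the hypothesis testing problem over the Gray-Wyner network with side information, $\mathcal{E}_{\mathrm{GW}}^{\mathrm{SI,in}}$ is the single-letter region defined in the context, and $\mathcal{E}_{\mathrm{GW}}(R_0,R_1,R_2)$ is the set of all pairs $(\theta_1,\theta_2)$ with $\theta_1\ge0$, $\theta_2\ge 0$ for which there exist auxiliary random variables $(U_0,U_1,U_2)$ over finite alphabets, forming the Markov chain $(U_0,U_1,U_2)\to X\to(Y_1,Y_2)$, such that $$R_0\ge I(U_0;X),\qquad R_1\ge I(U_1;X|U_0),\qquad R_2\ge I(U_2;X|U_0),$$ $$\theta_1\le I(U_1;Y_1),\qquad \theta_2\le I(U_2;Y_2).$$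
   Context: Logarithms are to base 2. All entropies and mutual informations are computed under hypothesis $\mathcal{H}=0$, i.e. with $(X,Y_1,Y_2,Z_1,Z_2)\sim P_{XY_1Y_2Z_1Z_2}$. Hypothesis testing over the Gray-Wyner network with side information. A transmitter observes $X^n$; Receiver $i\in\{1,2\}$ observes $(Y_i^n,Z_i^n)$. Under $\mathcal{H}=0$, $(X^n,Y_1^n,Y_2^n,Z_1^n,Z_2^n)$ is i.i.d. according to $P_{XY_1Y_2Z_1Z_2}$. Under $\mathcal{H}=1$, it is i.i.d. according to $P_{XZ_1Z_2}P_{Y_1|Z_1}P_{Y_2|Z_2}$, where $P_{XZ_1Z_2}$, $P_{Y_1|Z_1}$, $P_{Y_2|Z_2}$ are the marginal and conditional marginals of $P_{XY_1Y_2Z_1Z_2}$. The transmitter computes $(M_0,M_1,M_2)=\phi^{(n)}(X^n)$ with a possibly stochastic encoding function $\phi^{(n)}:\mathcal{X}^n\to\{0,\dots,2^{nR_0}\}\times\{0,\dots,2^{nR_1}\}\times\{0,\dots,2^{nR_2}\}$ (where $\{0,\dots,2^{nR}\}$ means the integers between $0$ and $2^{nR}$; the encoder's randomness is independent of everything else). Receiver $i$ observes $M_0$ and $M_i$ noiselessly and outputs the decision $\hat{\mathcal{H}}_i=g_i^{(n)}(Y_i^n,Z_i^n,M_0,M_i)\in\{0,1\}$. The error probabilities are $\alpha_{i,n}=\Pr[\hat{\mathcal{H}}_i=1|\mathcal{H}=0]$ (type I) and $\beta_{i,n}=\Pr[\hat{\mathcal{H}}_i=0|\mathcal{H}=1]$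 (type II). For $\epsilon\in(0,1)$, the tuple $(\theta_1,\theta_2,R_0,R_1,R_2)$ is $\epsilon$-achievable if there is a sequence $\{(\phi^{(n)},g_1^{(n)},g_2^{(n)})\}_{n\ge1}$ such that for $i\in\{1,2\}$: $\alpha_{i,n}\le\epsilon$ for all positive integers $n$, and $-\limsup_{n\to\infty}\frac1n\log\beta_{i,n}\ge\theta_i$. The exponents region $\mathcal{E}_{\mathrm{GW}}^{\mathrm{SI}}(R_0,R_1,R_2)$ is the closure of the set of all nonnegative pairs $(\theta_1,\theta_2)$ such that $(\theta_1,\theta_2,R_0,R_1,R_2)$ is $\epsilon$-achievable for every $\epsilon\in(0,1)$. The region $\mathcal{E}_{\mathrm{GW}}^{\mathrm{SI,in}}(R_0,R_1,R_2)$ is the set of all pairs $(\theta_1,\theta_2)$ with $\theta_1,\theta_2\ge0$ for which there exist $(U_0,U_1,U_2)$ over finite alphabets with $(U_0,U_1,U_2)\to X\to(Y_1,Y_2,Z_1,Z_2)$ such that $R_0+R_1\ge I(U_0,U_1;X|Z_1)$, $R_0+R_2\ge I(U_0,U_2;X|Z_2)$, $R_0+R_1+R_2\ge\max_{i\in\{1,2\}}I(U_0;X|Z_i)+I(U_1;X|U_0,Z_1)+I(U_2;X|U_0,Z_2)$, $\theta_1\le I(U_1;Y_1|Z_1)$ and $\theta_2\le I(U_2;Y_2|Z_2)$. *)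

(* Defs.v *)
From mathcomp Require Import all_boot all_order all_algebra.
From mathcomp Require Import all_classical all_reals all_analysis.

Set Implicit Arguments.
Unset Strict Implicit.
Unset Printing Implicit Defensive.

Import Order.TTheory GRing.Theory Num.Theory.
Import numFieldNormedType.Exports.

Local Open Scope classical_set_scope.
Local Open Scope ring_scope.

(* Discrete random variables are functions on a finite sample space S whose
   law is given by a mass function Q : S -> R. *)

Definition is_pmf (R : realType) (S : finType) (Q : S -> R) : Prop :=
  (forall s, 0 <= Q s) /\ \sum_s Q s = 1.

Definition law (R : realType) (S A : finType) (Q : S -> R) (f : S -> A) :
    A -> R :=
  fun a => \sum_(s | f s == a) Q s.

Definition pairRV (S A B : Type) (f : S -> A) (g : S -> B) : S -> A * B :=
  fun s => (f s, g s).

Notation "[% f , g , .. , h ]" := (pairRV .. (pairRV f g) .. h).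

Definition log2 (R : realType) (x : R) : R := ln x / ln 2.

(* log2e 0 = -oo *)
Definition log2e (R : realType) (x : \bar R) : \bar R :=
  (lne x * ((ln 2)^-1)%:E)%E.

Section Information.
Context (R : realType) (S A B : finType) (Q : S -> R).

(* P(f = a | g = b); it is 0 when P(g = b) = 0, since x / 0 = 0. *)
Definition cond (f : S -> A) (g : S -> B) (a : A) (b : B) : R :=
  law Q [% f, g] (a, b) / law Q g b.

(* Terms of zero probability vanish, whatever the value of the logarithm. *)
Definition mutual_info (f : S -> A) (g : S -> B) : R :=
  \sum_a \sum_b law Q [% f, g] (a, b) *
    log2 (law Q [% f, g] (a, b) / (law Q f a * law Q g b)).

End Information.

Section ConditionalInformation.
Context (R : realType) (S A B C : finType) (Q : S -> R).

(* I(f; g | h) *)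
Definition cond_mutual_info (f : S -> A) (g : S -> B) (h : S -> C) : R :=
  \sum_a \sum_b \sum_c law Q [% f, g, h] (a, b, c) *
    log2 (cond Q [% f, g] h (a, b) c / (cond Q f h a c * cond Q g h b c)).

(* f -> g -> h: f and h are conditionally independent given g.  Both sides
   are 0 at the values b with P(g = b) = 0. *)
Definition markov_chain (f : S -> A) (g : S -> B) (h : S -> C) : Prop :=
  forall a b c,
    cond Q [% f, h] g (a, c) b = cond Q f g a b * cond Q h g c b.

End ConditionalInformation.

(* The integers between 0 and 2^(n r), both included. *)
Definition msg (R : realType) (r : R) (n : nat) : finType :=
  'I_(Num.truncn (2 `^ (n%:R * r))).+1.

Definition block (n : nat) (S A : finType) (f : S -> A)
    (w : {ffun 'I_n -> S}) : {ffun 'I_n -> A} := [ffun i => f (w i)].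

Definition iid (R : realType) (S : finType) (Q : S -> R) (n : nat)
    (w : {ffun 'I_n -> S}) : R := \prod_i Q (w i).

Section GrayWyner.
Context (R : realType) (X Y1 Y2 Z1 Z2 : finType).

Let source := (X * Y1 * Y2 * Z1 * Z2)%type.

Definition srcX (s : source) : X := s.1.1.1.1.
Definition srcY1 (s : source) : Y1 := s.1.1.1.2.
Definition srcY2 (s : source) : Y2 := s.1.1.2.
Definition srcZ1 (s : source) : Z1 := s.1.2.
Definition srcZ2 (s : source) : Z2 := s.2.

(* P_{X Z1 Z2} P_{Y1|Z1} P_{Y2|Z2}, the single-letter law under H = 1 *)
Definition alt_law (P : source -> R) : source -> R := fun s =>
  law P [% srcX, srcZ1, srcZ2] (srcX s, srcZ1 s, srcZ2 s)
  * cond P srcY1 srcZ1 (srcY1 s) (srcZ1 s)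
  * cond P srcY2 srcZ2 (srcY2 s) (srcZ2 s).

(* The stochastic encoder is a transition kernel from X^n to message triples.
   A decision is a boolean, true standing for 1 and false for 0. *)
Record code (R0 R1 R2 : R) (n : nat) := Code {
  enc : {ffun 'I_n -> X} -> msg R0 n * msg R1 n * msg R2 n -> R;
  enc_pmf : forall x, is_pmf (enc x);
  dec1 : {ffun 'I_n -> Y1} -> {ffun 'I_n -> Z1} -> msg R0 n -> msg R1 n -> bool;
  dec2 : {ffun 'I_n -> Y2} -> {ffun 'I_n -> Z2} -> msg R0 n -> msg R2 n -> bool
}.

(* Probability that receiver i decides d when the source is i.i.d. ~ Q. *)
Definition decide_prob1 (R0 R1 R2 : R) (n : nat) (Q : source -> R)
    (c : code R0 R1 R2 n) (d : bool) : R :=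
  \sum_(w : {ffun 'I_n -> source}) \sum_m
    iid Q w * enc c (block srcX w) m *
    (dec1 c (block srcY1 w) (block srcZ1 w) m.1.1 m.1.2 == d)%:R.

Definition decide_prob2 (R0 R1 R2 : R) (n : nat) (Q : source -> R)
    (c : code R0 R1 R2 n) (d : bool) : R :=
  \sum_(w : {ffun 'I_n -> source}) \sum_m
    iid Q w * enc c (block srcX w) m *
    (dec2 c (block srcY2 w) (block srcZ2 w) m.1.1 m.2 == d)%:R.

(* - limsup_n (1/n) log b_n; the term n = 0 plays no role. *)
Definition decay_exponent (b : nat -> R) : \bar R :=
  (- limn_esup (fun n => (n%:R^-1)%:E * log2e (b n)%:E))%E.

Definition achievable (P : source -> R) (eps theta1 theta2 R0 R1 R2 : R) :
    Prop :=
  exists c : forall n, code R0 R1 R2 n,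
    [/\ forall n, (0 < n)%N -> decide_prob1 P (c n) true <= eps,
        forall n, (0 < n)%N -> decide_prob2 P (c n) true <= eps,
        (theta1%:E <=
          decay_exponent (fun n => decide_prob1 (alt_law P) (c n) false))%E &
        (theta2%:E <=
          decay_exponent (fun n => decide_prob2 (alt_law P) (c n) false))%E].

Definition exponents_region_SI (P : source -> R) (R0 R1 R2 : R) :
    set (R * R) :=
  closure [set theta | [/\ 0 <= theta.1, 0 <= theta.2 &
    forall eps, 0 < eps < 1 -> achievable P eps theta.1 theta.2 R0 R1 R2]].

Definition inner_region_SI (P : source -> R) (R0 R1 R2 : R) : set (R * R) :=
  [set theta | [/\ 0 <= theta.1, 0 <= theta.2 &
    exists (A0 A1 A2 : finType) (Q : A0 * A1 * A2 * source -> R),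
      let U0 := fun s : A0 * A1 * A2 * source => s.1.1.1 in
      let U1 := fun s : A0 * A1 * A2 * source => s.1.1.2 in
      let U2 := fun s : A0 * A1 * A2 * source => s.1.2 in
      let rX := fun s : A0 * A1 * A2 * source => srcX s.2 in
      let rY1 := fun s : A0 * A1 * A2 * source => srcY1 s.2 in
      let rY2 := fun s : A0 * A1 * A2 * source => srcY2 s.2 in
      let rZ1 := fun s : A0 * A1 * A2 * source => srcZ1 s.2 in
      let rZ2 := fun s : A0 * A1 * A2 * source => srcZ2 s.2 in
      [/\ is_pmf Q,
          law Q [% rX, rY1, rY2, rZ1, rZ2] =1 P &
          markov_chain Q [% U0, U1, U2] rX [% rY1, rY2, rZ1, rZ2]] /\
      [/\ cond_mutual_info Q [% U0, U1] rX rZ1 <= R0 + R1,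
          cond_mutual_info Q [% U0, U2] rX rZ2 <= R0 + R2,
          Num.max (cond_mutual_info Q U0 rX rZ1) (cond_mutual_info Q U0 rX rZ2)
            + cond_mutual_info Q U1 rX [% U0, rZ1]
            + cond_mutual_info Q U2 rX [% U0, rZ2] <= R0 + R1 + R2,
          theta.1 <= cond_mutual_info Q U1 rY1 rZ1 &
          theta.2 <= cond_mutual_info Q U2 rY2 rZ2]]].

End GrayWyner.

Definition region_GW (R : realType) (X Y1 Y2 : finType)
    (P : X * Y1 * Y2 -> R) (R0 R1 R2 : R) : set (R * R) :=
  [set theta | [/\ 0 <= theta.1, 0 <= theta.2 &
    exists (A0 A1 A2 : finType) (Q : A0 * A1 * A2 * (X * Y1 * Y2) -> R),
      let U0 := fun s : A0 * A1 * A2 * (X * Y1 * Y2) => s.1.1.1 in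
      let U1 := fun s : A0 * A1 * A2 * (X * Y1 * Y2) => s.1.1.2 in
      let U2 := fun s : A0 * A1 * A2 * (X * Y1 * Y2) => s.1.2 in
      let rX := fun s : A0 * A1 * A2 * (X * Y1 * Y2) => s.2.1.1 in
      let rY1 := fun s : A0 * A1 * A2 * (X * Y1 * Y2) => s.2.1.2 in
      let rY2 := fun s : A0 * A1 * A2 * (X * Y1 * Y2) => s.2.2 in
      [/\ is_pmf Q,
          law Q [% rX, rY1, rY2] =1 P &
          markov_chain Q [% U0, U1, U2] rX [% rY1, rY2]] /\
      [/\ mutual_info Q U0 rX <= R0,
          cond_mutual_info Q U1 rX U0 <= R1,
          cond_mutual_info Q U2 rX U0 <= R2,
          theta.1 <= mutual_info Q U1 rY1 &
          theta.2 <= mutual_info Q U2 rY2]]].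

(* Main.v *)
Require Import Defs.
From mathcomp Require Import all_boot all_order all_algebra.
From mathcomp Require Import all_classical all_reals all_analysis.
From mathcomp Require Import ring lra.

(* All three regions are compared with one set, [Region], the set of rates and
   exponents for which the source law splits into mass functions of (U0, X),
   (U0, U1, X), (U0, U2, X); it is stated with unnormalised entropies, which are
   homogeneous and superadditive, so that time sharing is a disjoint union.

   Single letter: the inner region relaxes the rate constraints to a
   polyhedron whose corner points are reached by moving U1 or U2 into the
   common description U0, or U0 into both private ones; time sharing between
   these points brings the rates back to the Gray-Wyner constraints.

   Converse: a weak converse. By the Donsker-Varadhan bound, a decision with
   type-I error a and type-II error at most 2^-k forces I(M0 M1; Y1^n) >=
   (1 - a) k - 1, and peeling off the source letters one at a time, with
   U0 = (M0, past source letters), single-letterises the n-letter region. The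
   rates and exponents obtained are off by arbitrarily small amounts, so the
   region has to be closed: by Caratheodory the alphabets are bounded, and a
   continuous measure of constraint violation attains its minimum on a compact
   box.

   Achievability: superposition covering followed by a likelihood-ratio test.
   Under H = 1 the messages are independent of Y_i^n, so the type-II error is
   at most 2^-(n t) by Markov's inequality, whatever the code. The codebooks
   are obtained by the method of conditional expectations, with the
   probability that the test fails as cost. *)

Set Implicit Arguments.
Unset Strict Implicit.
Unset Printing Implicit Defensive.

Import Order.TTheory GRing.Theory Num.Theory.
Import numFieldNormedType.Exports.

Local Open Scope ring_scope.

(** * Entropy of unnormalised mass functions *)

(** The constraints see the auxiliary variables only through three mass functions. When a joint law
    is demanded, U1 and U2 are coupled conditionally independently given (U0, X); the same coupling
    lets one of them be promoted without raising the rate of the other. Measuring exponents by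
    I(U0,U_i;Y_i) rather than I(U_i;Y_i) is harmless, because replacing U_i by (U0,U_i) leaves
    I(U_i;X|U0) unchanged.

    The converse loses a factor 1 - eps in the exponents, which is tolerable because they must be
    achievable for every eps. Covering needs rates strictly above the informations: mixing with the
    trivial splitting scales every information by some l < 1, which leaves slack in each positive
    rate. At rate 0 the information is exactly 0, the description is independent of the source given
    the layer below, and a random codeword always fits.

    Z1 and Z2 are constant only on the support of the law; restricted to it, the alternative is the
    product of P_X, P_Y1 and P_Y2. *)

Section Entropy.
Context {R : realType}.
Implicit Types (x y c : R).

Lemma ln2_gt0 : 0 < ln 2 :> R.
Proof. by apply: ln_gt0; lra. Qed.

Lemma log2M x y : 0 < x -> 0 < y -> log2 (x * y) = log2 x + log2 y.
Proof. by move=> x0 y0; rewrite /log2 lnM ?posrE// mulrDl. Qed.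

Lemma log2V x : 0 < x -> log2 x^-1 = - log2 x.
Proof. by move=> x0; rewrite /log2 lnV ?posrE// mulNr. Qed.

Lemma log2_div x y : 0 < x -> 0 < y -> log2 (x / y) = log2 x - log2 y.
Proof. by move=> x0 y0; rewrite log2M ?invr_gt0// log2V. Qed.

Lemma log2_1 : log2 1 = 0 :> R.
Proof. by rewrite /log2 ln1 mul0r. Qed.

Lemma ler_log2 x y : 0 < x -> x <= y -> log2 x <= log2 y.
Proof.
move=> x0 xy; rewrite /log2 ler_pM2r ?invr_gt0 ?ln2_gt0// ler_ln ?posrE//.
exact: lt_le_trans xy.
Qed.

Lemma powR2_log2 x : 0 < x -> 2 `^ log2 x = x.
Proof.
move=> x0; rewrite /powR ifF; last by apply/eqP; lra.
by rewrite /log2 divfK ?lnK ?posrE// gt_eqF// ln2_gt0.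
Qed.

Lemma log2_powR x : log2 (2 `^ x) = x.
Proof. by rewrite /log2 ln_powR mulfK// gt_eqF// ln2_gt0. Qed.

Lemma powR2D x y : 2 `^ (x + y) = 2 `^ x * 2 `^ y :> R.
Proof. by rewrite powRD//; apply/implyP => _; rewrite pnatr_eq0. Qed.

Definition eta x : R := x * log2 x.

Lemma eta0 : eta 0 = 0.
Proof. by rewrite /eta mul0r. Qed.

Lemma eta1 : eta 1 = 0.
Proof. by rewrite /eta log2_1 mulr0. Qed.

Lemma etaM c x : 0 <= c -> 0 <= x -> eta (c * x) = c * eta x + x * eta c.
Proof.
rewrite /eta => c0 x0.
have [->|cN0] := eqVneq c 0; first by rewrite !mul0r mulr0 addr0.
have [->|xN0] := eqVneq x 0; first by rewrite !mul0r !mulr0 mul0r addr0.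
rewrite log2M ?lt_neqAle 1?eq_sym ?cN0 ?xN0//; ring.
Qed.

Lemma sum_pair (T T' : finType) (F : T * T' -> R) :
  \sum_p F p = \sum_t \sum_t' F (t, t').
Proof. by rewrite pair_bigA; apply: eq_bigr => -[]. Qed.

Lemma sum_unit (F : unit -> R) : \sum_a F a = F tt.
Proof. by rewrite (bigD1 tt)//= big1 ?addr0// => -[]. Qed.

Lemma sum_gt0 (T : finType) (m : T -> R) t :
  (forall t, 0 <= m t) -> 0 < m t -> 0 < \sum_t m t.
Proof.
move=> m0 mt; rewrite (bigD1 t)//=; apply: ltr_pwDl => //.
exact: sumr_ge0.
Qed.

Lemma le_sum1 (T : finType) (m : T -> R) t :
  (forall t, 0 <= m t) -> m t <= \sum_t m t.
Proof. by move=> m0; rewrite (bigD1 t)//= lerDl; exact: sumr_ge0. Qed.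

(* [ln z <= z - 1] at [z = a b / (m s)] *)
Lemma log_sum_term (m a b s : R) : 0 <= m -> 0 <= a -> 0 <= b -> 0 <= s ->
  (0 < m -> [/\ 0 < a, 0 < b & 0 < s]) ->
  (m - a * b / s) / ln 2 <= m * (log2 m + log2 s - log2 a - log2 b).
Proof.
move=> m0 a0 b0 s0 mabs; rewrite le_eqVlt in m0; case/predU1P: m0 => [<-|m0].
  rewrite mul0r sub0r mulNr oppr_le0 divr_ge0//; last exact: ltW ln2_gt0.
  by rewrite divr_ge0// mulr_ge0.
have [a1 b1 s1] := mabs m0.
rewrite /log2 -mulrDl -!mulrBl mulrA ler_pM2r ?invr_gt0 ?ln2_gt0//.
have z0 : 0 < a * b / s / m by rewrite !divr_gt0 ?mulr_gt0.
have := @le_ln1Dx _ (a * b / s / m - 1).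
rewrite addrCA subrr addr0 => /(_ ltac:(lra)).
rewrite !ln_div ?lnM ?posrE ?divr_gt0 ?mulr_gt0// => H.
have : m * (ln a + ln b - ln s - ln m) <= m * (a * b / s / m - 1).
  by rewrite ler_pM2l.
have -> : m * (a * b / s / m - 1) = a * b / s - m by field; lra.
lra.
Qed.

(** [ln z < z - 1] is strict away from z = 1. This isolates the equality case, which later turns a
    vanishing information into independence. *)
Lemma log_sum_term_eq (m a b s : R) : 0 < m -> 0 < a -> 0 < b -> 0 < s ->
  (m - a * b / s) / ln 2 = m * (log2 m + log2 s - log2 a - log2 b) ->
  m * s = a * b.
Proof.
move=> m0 a0 b0 s0.
rewrite /log2 -mulrDl -!mulrBl mulrA.
move=> /(mulIf (invr_neq0 (lt0r_neq0 ln2_gt0))) H.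
have z0 : 0 < a * b / s / m by rewrite !divr_gt0// mulr_gt0.
have lnz : ln (a * b / s / m) = ln a + ln b - ln s - ln m.
  by rewrite !ln_div ?lnM ?posrE ?divr_gt0 ?mulr_gt0.
apply/eqP; apply: contraT => ne.
have /expR_gt1Dx : ln (a * b / s / m) != 0.
  rewrite ln_eq0//; apply: contra ne => /eqP E.
  apply/eqP; rewrite -[LHS]mul1r -E; field; lra.
rewrite lnK ?posrE// lnz => H'.
have : m * (1 + (ln a + ln b - ln s - ln m)) < m * (a * b / s / m).
  by rewrite ltr_pM2l.
have -> : m * (a * b / s / m) = a * b / s by field; lra.
lra.
Qed.

(* The entropy of an unnormalised mass function: it is the total mass times
   the entropy of the normalised law. *)
Definition entropy (T : finType) (m : T -> R) : R :=
  eta (\sum_t m t) - \sum_t eta (m t).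

Lemma eq_entropy (T : finType) (m m' : T -> R) :
  m =1 m' -> entropy m = entropy m'.
Proof. by move=> /funext ->. Qed.

Lemma entropyZ (T : finType) c (m : T -> R) :
  0 <= c -> (forall t, 0 <= m t) ->
  entropy (fun t => c * m t) = c * entropy m.
Proof.
move=> c0 m0; rewrite /entropy -mulr_sumr etaM//; last exact: sumr_ge0.
rewrite (eq_bigr _ (fun t _ => etaM c0 (m0 t))).
by rewrite big_split/= -mulr_sumr -mulr_suml; ring.
Qed.

Lemma entropy0 (T : finType) : entropy (fun _ : T => 0) = 0.
Proof. by rewrite /entropy !big1 ?eta0 ?subrr. Qed.

Lemma entropy_reindex (T T' : finType) (f : T' -> T) (m : T -> R) :
  bijective f -> entropy (m \o f) = entropy m.
Proof.
move=> bf; rewrite /entropy (reindex f)/=; last exact: onW_bij.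
by rewrite [in RHS](reindex f)//; exact: onW_bij.
Qed.

(** Chain rule. The entropy of a slice [m t] is already weighted by the mass of t, so the sum over t
    is the conditional entropy. *)
Lemma entropy_chain (T T' : finType) (m : T -> T' -> R) :
  entropy (fun p => m p.1 p.2) =
  entropy (fun t => \sum_t' m t t') + \sum_t entropy (m t).
Proof.
rewrite /entropy sumrB -!(pair_bigA _ (fun t t' => m t t'))/=.
by rewrite -!(pair_bigA _ (fun t t' => eta (m t t')))/=; ring.
Qed.

Lemma entropy_swap (T T' : finType) (m : T -> T' -> R) :
  entropy (fun p => m p.1 p.2) = entropy (fun p => m p.2 p.1).
Proof.
rewrite /entropy -!(pair_bigA _ (fun t t' => m t t'))/=.
rewrite -!(pair_bigA _ (fun t t' => eta (m t t')))/=.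
rewrite -!(pair_bigA _ (fun t' t => m t t'))/=.
rewrite -!(pair_bigA _ (fun t' t => eta (m t t')))/=.
by congr (eta _ - _); rewrite exchange_big.
Qed.

Lemma entropy_chain_swap (T T' : finType) (m : T -> T' -> R) :
  entropy (fun t => \sum_t' m t t') + \sum_t entropy (m t) =
  entropy (fun t' => \sum_t m t t') + \sum_t' entropy (m^~ t').
Proof.
by rewrite -entropy_chain entropy_swap (entropy_chain (fun t' t => m t t')).
Qed.

Lemma entropy_ge0 (T : finType) (m : T -> R) :
  (forall t, 0 <= m t) -> 0 <= entropy m.
Proof.
move=> m0; rewrite /entropy /eta mulr_suml -sumrB sumr_ge0// => t _.
have [->|mt0] := eqVneq (m t) 0; first by rewrite !mul0r subrr.
have mt : 0 < m t by rewrite lt_neqAle eq_sym mt0 m0.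
by rewrite -mulrBr mulr_ge0// subr_ge0 ler_log2// le_sum1.
Qed.

(** Comparison with the uniform mass function of total [s]: [log_sum_term] at a = s, b = 1 and
    denominator [#|T|]. *)
Lemma entropy_le_log_card (T : finType) (m : T -> R) :
  (forall t, 0 <= m t) -> entropy m <= (\sum_t m t) * log2 #|T|%:R.
Proof.
move=> m0; set s := \sum_t m t.
suff : 0 <= \sum_t m t * (log2 (m t) + log2 #|T|%:R - log2 s - log2 1).
  rewrite /entropy /eta -/s log2_1.
  under eq_bigr => t _ do rewrite !mulrDr.
  rewrite !big_split/= -!mulr_suml -/s; lra.
have [T0|T0] := posnP #|T|.
  by rewrite big_pred0// => t; have := max_card (pred1 t); rewrite card1 T0.
have s0 : 0 <= s by exact: sumr_ge0.
apply: (@le_trans _ _ (\sum_t (m t - s * 1 / #|T|%:R) / ln 2)).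
  rewrite -mulr_suml sumrB -/s sumr_const mulr1 -[X in s - X]mulr_natr cardT.
  by rewrite -cardT divfK ?subrr ?mul0r// pnatr_eq0 -lt0n.
apply: ler_sum => t _; apply: log_sum_term => // mt.
by split => //; [exact: sum_gt0 mt|rewrite ltr0n].
Qed.

Section Superadditivity.
Variables (I T : finType) (m : I -> T -> R).
Hypothesis m0 : forall i t, 0 <= m i t.

Local Notation row i := (\sum_t m i t).
Local Notation col := (fun t => \sum_i m i t).
Local Notation tot := (\sum_i \sum_t m i t).

Let totE : \sum_t col t = tot.
Proof. by rewrite exchange_big. Qed.

(** The gap is the mutual information between index and letter, scaled by the total mass, in its
    divergence form. *)
Lemma entropy_gapE : entropy col - \sum_i entropy (m i) =
  \sum_i \sum_t m i t * (log2 (m i t) + log2 tot - log2 (row i) - log2 (col t)).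
Proof.
rewrite /entropy totE sumrB.
under [RHS]eq_bigr => i _.
  under eq_bigr => t _ do rewrite !mulrDr.
  rewrite !big_split/= -!mulr_suml mulrN -/(eta (row i)); over.
rewrite !big_split/= -!mulr_suml -/(eta tot).
rewrite [X in _ = _ + X]exchange_big/=.
under [X in _ = _ + X]eq_bigr => t _ do
  rewrite -mulr_suml mulrN -/(eta (col t)).
by rewrite !sumrN; ring.
Qed.

(** [m] and the product of its marginals divided by the total have the same mass, so the linearised
    lower bounds cancel. *)
Let gap_lb : \sum_i \sum_t (m i t - row i * col t / tot) / ln 2 = 0.
Proof.
under eq_bigr => i _.
  rewrite -mulr_suml sumrB -mulr_suml -mulr_sumr totE -/(row i); over.
rewrite -mulr_suml sumrB -!mulr_suml -/tot.
have [->|t0] := eqVneq tot 0; first by rewrite mul0r mul0r subrr mul0r.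
by rewrite mulfK// subrr mul0r.
Qed.

Let row0 i : 0 <= row i. Proof. exact: sumr_ge0. Qed.
Let col0 t : 0 <= col t. Proof. exact: sumr_ge0. Qed.
Let tot0 : 0 <= tot. Proof. exact: sumr_ge0. Qed.

Let pos i t : 0 < m i t -> [/\ 0 < row i, 0 < col t & 0 < tot].
Proof.
move=> mit; have ri : 0 < row i by exact: sum_gt0 mit.
by split => //; [exact: (@sum_gt0 _ (m^~ t) i)|exact: sum_gt0 ri].
Qed.

(** Each term of the gap dominates its linearisation, and the linearisations sum to 0. In other
    words, conditioning on the index does not increase entropy. *)
Lemma entropy_superadd : \sum_i entropy (m i) <= entropy col.
Proof.
rewrite -subr_ge0 entropy_gapE -[X in X <= _]gap_lb.
apply: ler_sum => i _; apply: ler_sum => t _.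
by apply: log_sum_term => //; exact: pos.
Qed.

(** Equality forces every nonnegative excess [F i t] to vanish, and the equality case of the log-sum
    bound then makes index and letter independent. *)
Lemma entropy_superadd_eq : \sum_i entropy (m i) = entropy col ->
  forall i t, 0 < m i t -> m i t * tot = row i * col t.
Proof.
move=> /esym/eqP; rewrite -subr_eq0 entropy_gapE => /eqP E i t mit.
have [ri ct tt] := pos mit.
apply: log_sum_term_eq => //; apply/eqP; rewrite eq_sym -subr_eq0.
set F := fun i t => m i t * (log2 (m i t) + log2 tot - log2 (row i) -
  log2 (col t)) - (m i t - row i * col t / tot) / ln 2.
have F0 j k : 0 <= F j k.
  by rewrite subr_ge0; apply: log_sum_term => //; exact: pos.
have : \sum_i \sum_t F i t = 0.
  under eq_bigr do rewrite sumrB.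
  by rewrite sumrB E gap_lb subrr.
move=> /eqP; rewrite psumr_eq0 => [/allP/(_ i)|j _]; last exact: sumr_ge0.
rewrite mem_index_enum => /(_ isT)/implyP/(_ isT).
rewrite psumr_eq0 => [/allP/(_ t)|k _]; last exact: F0.
by rewrite mem_index_enum => /(_ isT)/implyP/(_ isT).
Qed.

End Superadditivity.

(** The information between index and letter is at most the log of the number of indices: chain rule
    in both orders, dropping the conditional entropy of the index. This is how message counts become
    rate constraints. *)
Lemma entropy_add_le (I T : finType) (m : I -> T -> R) :
  (forall i t, 0 <= m i t) ->
  entropy (fun t => \sum_i m i t) <=
  \sum_i entropy (m i) + (\sum_i \sum_t m i t) * log2 #|I|%:R.
Proof.
move=> m0; have E := entropy_chain_swap m.
have H1 : 0 <= \sum_t entropy (m^~ t).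
  by apply: sumr_ge0 => t _; exact: entropy_ge0.
have H2 := @entropy_le_log_card _ (fun i => \sum_t m i t)
  (fun i => sumr_ge0 _ (fun t _ => m0 i t)).
lra.
Qed.

End Entropy.

(** * The homogeneous Gray-Wyner region *)

Section Region.
Context {R : realType}.

Definition push (X Y : finType) (V : X -> Y -> R) (m : X -> R) : Y -> R :=
  fun y => \sum_x m x * V x y.

Lemma push_sum (I X Y : finType) (V : X -> Y -> R) (m : I -> X -> R) y :
  \sum_i push V (m i) y = push V (fun x => \sum_i m i x) y.
Proof.
by rewrite exchange_big; apply: eq_bigr => x _; rewrite mulr_suml.
Qed.

Lemma pushZ (X Y : finType) (V : X -> Y -> R) c (m : X -> R) y :
  push V (fun x => c * m x) y = c * push V m y.
Proof. by rewrite /push mulr_sumr; apply: eq_bigr => x _; rewrite mulrA. Qed.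

Lemma push0 (X Y : finType) (V : X -> Y -> R) y : push V (fun=> 0) y = 0.
Proof. by rewrite /push big1// => x _; rewrite mul0r. Qed.

Lemma push_ge0 (X Y : finType) (V : X -> Y -> R) (m : X -> R) y :
  (forall x y, 0 <= V x y) -> (forall x, 0 <= m x) -> 0 <= push V m y.
Proof. by move=> V0 m0; apply: sumr_ge0 => x _; rewrite mulr_ge0. Qed.

(* [w0], [w1], [w2] are the joint mass functions of (U0, X), (U0, U1, X) and
   (U0, U2, X), scaled by [c]; in the region below U_i stands for the pair
   (U0, U_i) of the paper. *)
Definition splitting (X A0 A1 A2 : finType) (PX : X -> R) (c : R)
    (w0 : A0 -> X -> R) (w1 : A0 -> A1 -> X -> R) (w2 : A0 -> A2 -> X -> R) :=
  [/\ forall a0 a1 x, 0 <= w1 a0 a1 x,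
      forall a0 a2 x, 0 <= w2 a0 a2 x,
      forall a0 x, \sum_a1 w1 a0 a1 x = w0 a0 x,
      forall a0 x, \sum_a2 w2 a0 a2 x = w0 a0 x &
      forall x, \sum_a0 w0 a0 x = c * PX x].

(** At c = 1 and with U_i read as (U0, U_i), these say in order I(U0;X) <= r0, I(U1;X|U0) <= r1,
    I(U2;X|U0) <= r2, t1 <= I(U1;Y1), t2 <= I(U2;Y2), each information being a difference of sums of
    slice entropies. *)
Definition entropy_bounds (X Y1 Y2 A0 A1 A2 : finType) (PX : X -> R)
    (V1 : X -> Y1 -> R) (V2 : X -> Y2 -> R) (c r0 r1 r2 t1 t2 : R)
    (w0 : A0 -> X -> R) (w1 : A0 -> A1 -> X -> R) (w2 : A0 -> A2 -> X -> R) :=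
  [/\ c * entropy PX <= r0 + \sum_a0 entropy (w0 a0),
      \sum_a0 entropy (w0 a0) <= r1 + \sum_a0 \sum_a1 entropy (w1 a0 a1),
      \sum_a0 entropy (w0 a0) <= r2 + \sum_a0 \sum_a2 entropy (w2 a0 a2),
      t1 + \sum_a0 \sum_a1 entropy (push V1 (w1 a0 a1))
        <= c * entropy (push V1 PX) &
      t2 + \sum_a0 \sum_a2 entropy (push V2 (w2 a0 a2))
        <= c * entropy (push V2 PX)].

Definition Region (X Y1 Y2 : finType) (PX : X -> R) (V1 : X -> Y1 -> R)
    (V2 : X -> Y2 -> R) (c r0 r1 r2 t1 t2 : R) : Prop :=
  exists (A0 A1 A2 : finType) (w0 : A0 -> X -> R) (w1 : A0 -> A1 -> X -> R)
    (w2 : A0 -> A2 -> X -> R),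
    splitting PX c w0 w1 w2 /\
    entropy_bounds PX V1 V2 c r0 r1 r2 t1 t2 w0 w1 w2.

Section Operations.
Context (X Y1 Y2 : finType) (PX : X -> R) (V1 : X -> Y1 -> R)
  (V2 : X -> Y2 -> R).
Hypothesis PX0 : forall x, 0 <= PX x.
Hypothesis V1_ge0 : forall x y, 0 <= V1 x y.
Hypothesis V2_ge0 : forall x y, 0 <= V2 x y.

Local Notation Reg := (Region PX V1 V2).

Lemma Region_mono c r0 r1 r2 t1 t2 r0' r1' r2' t1' t2' :
  r0 <= r0' -> r1 <= r1' -> r2 <= r2' -> t1' <= t1 -> t2' <= t2 ->
  Reg c r0 r1 r2 t1 t2 -> Reg c r0' r1' r2' t1' t2'.
Proof.
move=> h0 h1 h2 h3 h4 [A0 [A1 [A2 [w0 [w1 [w2 [S [E0 E1 E2 E3 E4]]]]]]]].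
by exists A0, A1, A2, w0, w1, w2; split => //; split; lra.
Qed.

Lemma Region_swap c r0 r1 r2 t1 t2 :
  Reg c r0 r1 r2 t1 t2 -> Region PX V2 V1 c r0 r2 r1 t2 t1.
Proof.
move=> [A0 [A1 [A2 [w0 [w1 [w2 [[? ? ? ? ?] [E0 E1 E2 E3 E4]]]]]]]].
by exists A0, A2, A1, w0, w2, w1; split; split.
Qed.

Lemma Region_trivial : Reg 1 0 0 0 0 0.
Proof.
exists unit, unit, unit, (fun _ => PX), (fun _ _ => PX), (fun _ _ => PX).
by split; split => // *; rewrite ?sum_unit ?add0r ?mul1r.
Qed.

Lemma Region_scale d c r0 r1 r2 t1 t2 : 0 <= d ->
  Reg c r0 r1 r2 t1 t2 -> Reg (d * c) (d * r0) (d * r1) (d * r2) (d * t1) (d * t2).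
Proof.
move=> d0 [A0 [A1 [A2 [w0 [w1 [w2 [[w1p w2p s1 s2 s0] [E0 E1 E2 E3 E4]]]]]]]].
have w0p a0 x : 0 <= w0 a0 x by rewrite -s1 sumr_ge0.
have sumZ0 (T A : finType) (w : A -> T -> R) : (forall a t, 0 <= w a t) ->
    \sum_a entropy (fun t => d * w a t) = d * \sum_a entropy (w a).
  by move=> wp; rewrite mulr_sumr; apply: eq_bigr => a _; exact: entropyZ.
have sumZ (T A B : finType) (w : A -> B -> T -> R) :
    (forall a b t, 0 <= w a b t) ->
    \sum_a \sum_b entropy (fun t => d * w a b t) =
    d * \sum_a \sum_b entropy (w a b).
  by move=> wp; rewrite mulr_sumr; apply: eq_bigr => a _; exact: sumZ0.
exists A0, A1, A2, (fun a x => d * w0 a x), (fun a b x => d * w1 a b x),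
  (fun a b x => d * w2 a b x); split; split.
- by move=> *; rewrite mulr_ge0.
- by move=> *; rewrite mulr_ge0.
- by move=> *; rewrite -mulr_sumr s1.
- by move=> *; rewrite -mulr_sumr s2.
- by move=> *; rewrite -mulr_sumr s0 mulrA.
- by rewrite sumZ0// -mulrA -mulrDr ler_wpM2l.
- by rewrite sumZ0// sumZ// -mulrDr ler_wpM2l.
- by rewrite sumZ0// sumZ// -mulrDr ler_wpM2l.
- rewrite -mulrA; under eq_bigr do under eq_bigr do
    rewrite (eq_entropy (pushZ _ _ _)).
  by rewrite sumZ -?mulrDr ?ler_wpM2l// => *; exact: push_ge0.
- rewrite -mulrA; under eq_bigr do under eq_bigr do
    rewrite (eq_entropy (pushZ _ _ _)).
  by rewrite sumZ -?mulrDr ?ler_wpM2l// => *; exact: push_ge0.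
Qed.

(** Mixed pairs get mass 0, so the common description alone tells which of the two schemes is in
    use. *)
Definition case_sum (A0 A0' A1 A1' : Type) (w : A0 -> A1 -> X -> R)
    (w' : A0' -> A1' -> X -> R) (a : A0 + A0') (b : A1 + A1') : X -> R :=
  match a, b with
  | inl a, inl b => w a b
  | inr a, inr b => w' a b
  | _, _ => fun=> 0
  end.

Lemma sum_case_sum (A0 A0' A1 A1' : finType) (w : A0 -> A1 -> X -> R)
    (w' : A0' -> A1' -> X -> R) (F : (X -> R) -> R) : F (fun=> 0) = 0 ->
  \sum_a \sum_b F (case_sum w w' a b) =
  \sum_a \sum_b F (w a b) + \sum_a \sum_b F (w' a b).
Proof.
move=> F0; rewrite big_sumType/=; congr (_ + _); apply: eq_bigr => a _;
  rewrite big_sumType/=.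
  by rewrite [X in _ + X]big1 ?addr0.
by rewrite [X in X + _]big1 ?add0r.
Qed.

Lemma Region_add c r0 r1 r2 t1 t2 c' r0' r1' r2' t1' t2' :
  Reg c r0 r1 r2 t1 t2 -> Reg c' r0' r1' r2' t1' t2' ->
  Reg (c + c') (r0 + r0') (r1 + r1') (r2 + r2') (t1 + t1') (t2 + t2').
Proof.
move=> [A0 [A1 [A2 [w0 [w1 [w2 [[w1p w2p s1 s2 s0] [E0 E1 E2 E3 E4]]]]]]]].
move=> [B0 [B1 [B2 [v0 [v1 [v2 [[v1p v2p p1 p2 p0] [F0 F1 F2 F3 F4]]]]]]]].
exists (A0 + B0)%type, (A1 + B1)%type, (A2 + B2)%type,
 (fun a => match a with inl a => w0 a | inr a => v0 a end),
 (case_sum w1 v1), (case_sum w2 v2); split; split.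
- by move=> [a|a] [b|b] x /=.
- by move=> [a|a] [b|b] x /=.
- move=> [a|a] x; rewrite big_sumType/=.
    by rewrite [X in _ + X]big1 ?addr0.
  by rewrite [X in X + _]big1 ?add0r.
- move=> [a|a] x; rewrite big_sumType/=.
    by rewrite [X in _ + X]big1 ?addr0.
  by rewrite [X in X + _]big1 ?add0r.
- by move=> x; rewrite big_sumType/= s0 p0 mulrDl.
- by rewrite big_sumType/=; lra.
- by rewrite sum_case_sum ?entropy0// big_sumType/=; lra.
- by rewrite sum_case_sum ?entropy0// big_sumType/=; lra.
- rewrite (sum_case_sum _ _ (F := fun m => entropy (push V1 m))); first lra.
  by rewrite (eq_entropy (push0 _)) entropy0.
- rewrite (sum_case_sum _ _ (F := fun m => entropy (push V2 m))); first lra.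
  by rewrite (eq_entropy (push0 _)) entropy0.
Qed.

(* move the common description into the individual ones *)
Lemma Region_demote c r0 r1 r2 t1 t2 : 0 <= c ->
  Reg c r0 r1 r2 t1 t2 -> Reg c 0 (r0 + r1) (r0 + r2) t1 t2.
Proof.
move=> c0 [A0 [A1 [A2 [w0 [w1 [w2 [[w1p w2p s1 s2 s0] [E0 E1 E2 E3 E4]]]]]]]].
exists unit, (A0 * A1)%type, (A0 * A2)%type, (fun _ x => c * PX x),
  (fun _ p => w1 p.1 p.2), (fun _ p => w2 p.1 p.2).
split; split => //.
- move=> _ x; rewrite -(pair_bigA _ (fun a b => w1 a b x))/= -s0.
  by apply: eq_bigr.
- move=> _ x; rewrite -(pair_bigA _ (fun a b => w2 a b x))/= -s0.
  by apply: eq_bigr.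
- by move=> x; rewrite sum_unit.
- by rewrite sum_unit entropyZ// add0r.
- rewrite !sum_unit entropyZ//.
  rewrite -(pair_bigA _ (fun a b => entropy (w1 a b)))/=; lra.
- rewrite !sum_unit entropyZ//.
  rewrite -(pair_bigA _ (fun a b => entropy (w2 a b)))/=; lra.
- by rewrite sum_unit -(pair_bigA _ (fun a b => entropy (push V1 (w1 a b))))/=.
- by rewrite sum_unit -(pair_bigA _ (fun a b => entropy (push V2 (w2 a b))))/=.
Qed.

(* Given U0, make U1 and U2 conditionally independent given X. *)
Lemma entropy_cond_indep (A1 A2 : finType) (w0 : X -> R)
    (w1 : A1 -> X -> R) (w2 : A2 -> X -> R) :
  (forall a x, 0 <= w1 a x) -> (forall a x, 0 <= w2 a x) ->
  (forall x, \sum_a w1 a x = w0 x) -> (forall x, \sum_a w2 a x = w0 x) ->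
  \sum_a entropy (w1 a) + \sum_b entropy (w2 b) <=
  entropy w0 + \sum_a \sum_b entropy (fun x => w1 a x * w2 b x / w0 x).
Proof.
move=> w1p w2p s1 s2.
have w0p x : 0 <= w0 x by rewrite -s1 sumr_ge0.
pose w a b x := w1 a x * w2 b x / w0 x.
have wp a b x : 0 <= w a b x by rewrite divr_ge0// mulr_ge0.
have w2_0 x b : w0 x = 0 -> w2 b x = 0.
  move=> h; apply/eqP; rewrite eq_le w2p andbT -h -s2.
  exact: (@le_sum1 _ _ (w2^~ x)).
have w1_0 x a : w0 x = 0 -> w1 a x = 0.
  move=> h; apply/eqP; rewrite eq_le w1p andbT -h -s1.
  exact: (@le_sum1 _ _ (w1^~ x)).
have sw2 b x : \sum_a w a b x = w2 b x.
  rewrite -mulr_suml -mulr_suml s1.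
  have [h|h] := eqVneq (w0 x) 0; first by rewrite w2_0// mulr0 mul0r.
  by rewrite mulrAC divff// mul1r.
have sw1 a x : \sum_b w a b x = w1 a x.
  rewrite -mulr_suml -mulr_sumr s2.
  have [h|h] := eqVneq (w0 x) 0; first by rewrite w1_0// !mul0r.
  by rewrite mulfK.
have C1 a : entropy (w1 a) + \sum_x entropy (fun b => w a b x) =
    entropy (fun b => \sum_x w a b x) + \sum_b entropy (w a b).
  rewrite -(entropy_chain_swap (fun x b => w a b x)); congr (_ + _).
  by apply: eq_entropy => x; rewrite sw1.
have C0 : entropy w0 + \sum_x entropy (fun b => w2 b x) =
    entropy (fun b => \sum_x w2 b x) + \sum_b entropy (w2 b).
  rewrite -(entropy_chain_swap (fun x b => w2 b x)); congr (_ + _).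
  by apply: eq_entropy => x; rewrite s2.
have E a x : entropy (fun b => w a b x) = w1 a x / w0 x * entropy (w2^~ x).
  rewrite -entropyZ ?divr_ge0//; apply: eq_entropy => b.
  by rewrite /w mulrAC.
(* H(U2 | U1, X) = H(U2 | X): this is where the conditional independence enters. *)
have S : \sum_a \sum_x entropy (fun b => w a b x) =
    \sum_x entropy (fun b => w2 b x).
  rewrite exchange_big; apply: eq_bigr => x _.
  under eq_bigr do rewrite E.
  rewrite -mulr_suml -mulr_suml s1.
  have [h|h] := eqVneq (w0 x) 0; last by rewrite divff// mul1r.
  rewrite h mul0r mul0r; rewrite -[RHS](_ : entropy (fun _ : A2 => 0) = _).
    by rewrite entropy0.
  by apply: eq_entropy => b; rewrite w2_0.
(* H(U2 | U1) <= H(U2). *)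
have T : \sum_a entropy (fun b => \sum_x w a b x) <=
    entropy (fun b => \sum_x w2 b x).
  rewrite (_ : (fun b => \sum_x w2 b x) =
    fun b => \sum_a \sum_x w a b x); last first.
    by apply/funext => b; rewrite exchange_big; apply: eq_bigr => x _; rewrite sw2.
  by apply: entropy_superadd => a b; exact: sumr_ge0.
have : \sum_a entropy (w1 a) + \sum_a \sum_x entropy (fun b => w a b x) =
    \sum_a entropy (fun b => \sum_x w a b x) + \sum_a \sum_b entropy (w a b).
  by rewrite -!big_split; apply: eq_bigr => a _; exact: C1.
rewrite S -[X in _ -> _ <= _ + X]/(\sum_a \sum_b entropy (w a b)); lra.
Qed.

(** The pair (U0, U1) becomes the common description. The rate of U2 does not grow because U1 and U2
    are coupled conditionally independently given (U0, X), and receiver 2, who now also knows U1,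
    can only gain in exponent. *)
Lemma Region_promote c r0 r1 r2 t1 t2 :
  Reg c r0 r1 r2 t1 t2 -> Reg c (r0 + r1) 0 r2 t1 t2.
Proof.
move=> [A0 [A1 [A2 [w0 [w1 [w2 [[w1p w2p s1 s2 s0] [E0 E1 E2 E3 E4]]]]]]]].
have w0p a0 x : 0 <= w0 a0 x by rewrite -s1 sumr_ge0.
pose w a0 a1 a2 x := w1 a0 a1 x * w2 a0 a2 x / w0 a0 x.
have wp a0 a b x : 0 <= w a0 a b x by rewrite divr_ge0// mulr_ge0.
exists (A0 * A1)%type, unit, A2, (fun p => w1 p.1 p.2), (fun p _ => w1 p.1 p.2),
  (fun p a2 => w p.1 p.2 a2).
have pairE (F : A0 -> A1 -> R) : \sum_p F p.1 p.2 = \sum_a \sum_b F a b.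
  by rewrite (pair_bigA _ (fun a b => F a b)).
split; split => //.
- by move=> *; rewrite sum_unit.
- move=> [a0 a1] x; rewrite -mulr_suml -mulr_sumr s2/=.
  have [h|h] := eqVneq (w0 a0 x) 0; last by rewrite mulfK.
  rewrite h mulr0 mul0r; apply/eqP; rewrite eq_le w1p/= -h -s1.
  exact: (@le_sum1 _ _ (fun a => w1 a0 a x)).
- move=> x; rewrite (pairE (fun a b => w1 a b x)) -s0.
  by apply: eq_bigr.
- rewrite (pairE (fun a b => entropy (w1 a b))); lra.
- rewrite (pairE (fun a b => \sum_(_ : unit) entropy (w1 a b))).
  rewrite (pairE (fun a b => entropy (w1 a b))) add0r.
  by apply: ler_sum => a _; apply: ler_sum => b _; rewrite sum_unit.
- rewrite (pairE (fun a b => \sum_c entropy (w a b c))).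
  rewrite (pairE (fun a b => entropy (w1 a b))).
  have : \sum_a0 \sum_a entropy (w1 a0 a) + \sum_a0 \sum_b entropy (w2 a0 b) <=
    \sum_a0 entropy (w0 a0) + \sum_a0 \sum_a \sum_b entropy (w a0 a b).
    by rewrite -!big_split; apply: ler_sum => a0 _; exact: entropy_cond_indep.
  lra.
- rewrite (pairE (fun a b => \sum_(_ : unit) entropy (push V1 (w1 a b)))).
  by under eq_bigr do under eq_bigr do rewrite sum_unit.
- rewrite (pairE (fun a b => \sum_c entropy (push V2 (w a b c)))).
  apply: le_trans E4; rewrite lerD2l; apply: ler_sum => a0 _.
  rewrite exchange_big/=; apply: ler_sum => a2 _.
  rewrite (_ : push V2 (w2 a0 a2) =
    fun y => \sum_a1 push V2 (w a0 a1 a2) y); last first.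
    apply/funext => y; rewrite push_sum; apply: eq_bigr => x _.
    congr (_ * _); rewrite -mulr_suml -mulr_suml s1.
    have [h|h] := eqVneq (w0 a0 x) 0; last by rewrite mulrAC divff// mul1r.
    rewrite h mul0r mul0r; apply/eqP; rewrite eq_le w2p andbT -h -s2.
    exact: (@le_sum1 _ _ (fun a => w2 a0 a x)).
  by apply: entropy_superadd => a1 y; exact: push_ge0.
Qed.

Lemma Region_convex l r0 r1 r2 t1 t2 r0' r1' r2' t1' t2' : 0 <= l <= 1 ->
  Reg 1 r0 r1 r2 t1 t2 -> Reg 1 r0' r1' r2' t1' t2' ->
  Reg 1 (l * r0 + (1 - l) * r0') (l * r1 + (1 - l) * r1')
    (l * r2 + (1 - l) * r2') (l * t1 + (1 - l) * t1') (l * t2 + (1 - l) * t2').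
Proof.
move=> /andP[l0 l1] /(Region_scale l0) H /(Region_scale (d := 1 - l)) H'.
have := Region_add H (H' ltac:(lra)).
by rewrite !mulr1 addrC subrK.
Qed.

End Operations.

Lemma Region_promote2 (X Y1 Y2 : finType) (PX : X -> R) (V1 : X -> Y1 -> R)
    (V2 : X -> Y2 -> R) c r0 r1 r2 t1 t2 :
  (forall x y, 0 <= V1 x y) ->
  Region PX V1 V2 c r0 r1 r2 t1 t2 -> Region PX V1 V2 c (r0 + r2) r1 0 t1 t2.
Proof.
move=> V0 /Region_swap H; apply: Region_swap.
exact: (Region_promote V0 H).
Qed.

(** [l] is the fraction of a private description of rate [b] that has to be promoted for the rest to
    fit into rate [r]: 1 - r / b, truncated at 0. *)
Lemma exists_ratio (b r : R) : 0 <= b -> 0 <= r ->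
  exists2 l : R, 0 <= l <= 1 & (1 - l) * b <= r /\ (l * b <= 0 \/ l * b <= b - r).
Proof.
move=> b0 r0; have [br|rb] := leP b r.
  by exists 0; [lra|split; [lra|left; rewrite mul0r]].
have bp : 0 < b by exact: le_lt_trans rb.
have : 0 <= r / b <= 1 by rewrite divr_ge0//= ler_pdivrMr// mul1r ltW.
exists (1 - r / b); first by lra.
have bn : b != 0 by apply/eqP; lra.
split; first by rewrite opprB addrCA subrr addr0 divfK.
by right; rewrite mulrBl mul1r divfK.
Qed.

(* The polyhedron of the inner region is the convex hull of the five corner
   points reached by moving the descriptions around, plus the orthant. *)
Lemma Region_time_sharing (X Y1 Y2 : finType) (PX : X -> R) (V1 : X -> Y1 -> R)
    (V2 : X -> Y2 -> R) a b1 b2 r0 r1 r2 t1 t2 :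
  (forall x, 0 <= PX x) ->
  (forall x y, 0 <= V1 x y) -> (forall x y, 0 <= V2 x y) ->
  0 <= r0 -> 0 <= r1 -> 0 <= r2 -> 0 <= a -> 0 <= b1 -> 0 <= b2 ->
  a + b1 <= r0 + r1 -> a + b2 <= r0 + r2 -> a + b1 + b2 <= r0 + r1 + r2 ->
  Region PX V1 V2 1 a b1 b2 t1 t2 -> Region PX V1 V2 1 r0 r1 r2 t1 t2.
Proof.
move=> P0 V10 V20 r0p r1p r2p ap b1p b2p H1 H2 H12 H.
(* When the common description exceeds [r0], it is kept for a fraction r0 / a of the time and
   demoted into both private ones otherwise. *)
have [ar|ra] := leP a r0; last first.
  have H' := Region_demote P0 ler01 H.
  have l01 : 0 <= r0 / a <= 1.
    rewrite divr_ge0 ?(ltW (le_lt_trans r0p ra))//=.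
    by rewrite ler_pdivrMr ?mul1r ?(ltW ra)//; lra.
  apply: Region_mono (Region_convex V10 V20 l01 H H'); last 2 first.
  - lra.
  - lra.
  - by rewrite divfK ?mulr0 ?addr0//; apply/eqP; lra.
  - rewrite mulrBl mul1r mulrDr divfK; last by apply/eqP; lra.
    lra.
  - rewrite mulrBl mul1r mulrDr divfK; last by apply/eqP; lra.
    lra.
have [l1 l1p [l1r l1b]] := exists_ratio b1p r1p.
have [l2 l2p [l2r l2b]] := exists_ratio b2p r2p.
have K1 := Region_convex V10 V20 l1p (Region_promote V20 H) H.
have K2 := Region_promote2 V10 K1.
have K := Region_convex V10 V20 l2p K2 K1.
apply: Region_mono K; last 2 first.
- lra.
- lra.
(* The common rate after promoting the fractions [l1] and [l2]. Each of the four cases uses one of a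
   <= r0 and the three constraints on sums of rates. *)
- apply: (@le_trans _ _ (a + l1 * b1 + l2 * b2)).
    by rewrite le_eqVlt; apply/orP; left; apply/eqP; ring.
  by case: l1b l2b => l1b [] l2b; lra.
- by apply: le_trans l1r; rewrite le_eqVlt; apply/orP; left; apply/eqP; ring.
- by apply: le_trans l2r; rewrite le_eqVlt; apply/orP; left; apply/eqP; ring.
Qed.

End Region.

(** * Bounded alphabets *)

Section Caratheodory.
Context {R : realType} (I J : finType) (v : I -> J -> R).

Let supp (q : I -> R) := [set i | q i != 0].

(** The matrix of the vectors indexed by [B] has more rows than columns, hence a nonzero left kernel
    vector, extended by 0 outside [B]. *)
Lemma affine_dependence (B : {set I}) : (#|J| < #|B|)%N ->
  exists mu : I -> R, [/\ exists i, mu i != 0, forall i, i \notin B -> mu i = 0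
    & forall j, \sum_i mu i * v i j = 0].
Proof.
move=> JB; pose M : 'M[R]_(#|B|, #|J|) :=
  \matrix_(k, l) v (enum_val k) (enum_val l).
pose f (k : 'I_#|B|) : I := enum_val k.
have : kermx M != 0.
  rewrite -mxrank_eq0 mxrank_ker -lt0n subn_gt0.
  exact: leq_ltn_trans (rank_leq_col M) JB.
move=> /rowV0Pn[u /sub_kermxP uM u0].
pose mu i := \sum_(k < #|B| | f k == i) u 0 k.
have muE k : mu (f k) = u 0 k.
  by rewrite /mu (big_pred1 k)// => l; rewrite (inj_eq enum_val_inj).
exists mu; split.
- have [k uk] : exists k, u 0 k != 0.
    apply/existsP; apply: contraNT u0 => /existsPn u0.
    by apply/eqP/rowP => k; rewrite mxE; apply/eqP/negPn/u0.
  by exists (f k); rewrite muE.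
- move=> i iB; rewrite /mu big_pred0// => k.
  by apply/negbTE; apply: contra iB => /eqP <-; exact: enum_valP.
- move=> j; transitivity (\sum_k u 0 k * v (f k) j).
    rewrite (partition_big f predT)//=.
    apply: eq_bigr => i _; rewrite mulr_suml.
    by apply: eq_bigr => k /eqP ->.
  move/matrixP/(_ 0 (enum_rank j)): uM; rewrite !mxE => uM0; rewrite -[RHS]uM0.
  by apply: eq_bigr => k _; rewrite mxE enum_rankK.
Qed.

(** A linear dependence on the support is a direction along which all the sums are constant; moving
    along it until a coordinate vanishes shrinks the support. *)
Lemma reduce_support (q : I -> R) : (forall i, 0 <= q i) ->
  exists q', [/\ forall i, 0 <= q' i, (#|supp q'| <= #|J|)%N &
    forall j, \sum_i q' i * v i j = \sum_i q i * v i j].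
Proof.
move: {2}#|supp q| (leqnn #|supp q|) => n; elim: n q => [|n IH] q.
  by move=> supp0 q0; exists q; split => //; exact: leq_trans supp0 _.
move=> suppq q0; have [|/affine_dependence] := leqP #|supp q| #|J|.
  by exists q.
move=> [mu0 [mu0N0 mu0_supp mu0v]].
have [mu [[i mui] mu_supp muv]] : exists mu : I -> R,
    [/\ exists i, 0 < mu i, forall i, q i = 0 -> mu i = 0 &
      forall j, \sum_i mu i * v i j = 0].
  have mu0_0 i : q i = 0 -> mu0 i = 0.
    by move=> qi; apply: mu0_supp; rewrite inE qi eqxx.
  have [i] := mu0N0; rewrite neq_lt => /orP[|] mui; last first.
    by exists mu0; split => //; exists i.
  exists (fun i => - mu0 i); split.
  - by exists i; rewrite oppr_gt0.
  - by move=> k /mu0_0 ->; rewrite oppr0.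
  - by move=> j; under eq_bigr do rewrite mulNr; rewrite sumrN mu0v oppr0.
(* The minimal ratio is the largest step that keeps all coordinates nonnegative, and it annihilates
   coordinate [k]. *)
case: (@arg_minP _ _ _ i (fun i => 0 < mu i) (fun i => q i / mu i) mui).
move=> k muk kmin; pose t := q k / mu k.
have t0 : 0 <= t by rewrite divr_ge0// ltW.
pose q1 i := q i - t * mu i.
have q1k : q1 k = 0 by rewrite /q1 divfK ?subrr// gt_eqF.
have [||q' [q'0 q'J q'v]] := IH q1.
- rewrite -ltnS (leq_trans _ suppq)//; apply: proper_card; apply/properP; split.
    apply/fintype.subsetP => l; rewrite !inE; apply: contra => /eqP ql.
    by rewrite /q1 ql mu_supp// mulr0 subr0.
  exists k; rewrite !inE ?q1k ?eqxx//.
  by apply/eqP => /mu_supp muk0; rewrite muk0 ltxx in muk.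
- move=> l; rewrite subr_ge0; have [mul|mul] := ltP 0 (mu l).
    by rewrite -ler_pdivlMr//; exact: kmin.
  by apply: le_trans (q0 l); rewrite mulr_ge0_le0.
exists q'; split => // j; rewrite q'v /q1.
under eq_bigr do rewrite mulrBl -mulrA.
by rewrite sumrB -mulr_sumr muv mulr0 subr0.
Qed.

(** The reduced support is enumerated inside an index type that depends on [J] only; slots beyond it
    point to [i0] or another letter with weight 0. *)
Lemma conic_caratheodory (q : I -> R) (i0 : I) : (forall i, 0 <= q i) ->
  exists (e : 'I_#|J| -> I) (q' : 'I_#|J| -> R), (forall k, 0 <= q' k) /\
    forall j, \sum_k q' k * v (e k) j = \sum_i q i * v i j.
Proof.
move=> /reduce_support[q' [q'0 q'J q'v]].
pose s := enum (supp q').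
pose e (k : 'I_#|J|) := nth i0 s k.
exists e, (fun k : 'I_#|J| => if (k < size s)%N then q' (e k) else 0); split.
  by move=> k; case: ifP.
move=> j; rewrite -q'v.
transitivity (\sum_(i in supp q') q' i * v i j); last first.
  rewrite [RHS](bigID (mem (supp q')))/= [X in _ = _ + X]big1 ?addr0// => i.
  by rewrite inE negbK => /eqP ->; rewrite mul0r.
rewrite -[RHS]big_enum/= -/s [RHS](big_nth i0) big_mkord.
have sJ : (size s <= #|J|)%N by rewrite -cardE.
apply: etrans (esym (big_ord_widen #|J|
  (fun k => q' (nth i0 s k) * v (nth i0 s k) j) sJ)).
rewrite [RHS]big_mkcond/=; apply: eq_bigr => k _.
by case: ifP => //; rewrite mul0r.
Qed.

End Caratheodory.

Section CardinalityBound.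
Context {R : realType} (X Y1 Y2 : finType) (PX : X -> R)
  (V1 : X -> Y1 -> R) (V2 : X -> Y2 -> R).
Hypothesis PX_pmf : is_pmf PX.
Hypothesis V1_ge0 : forall x y, 0 <= V1 x y.
Hypothesis V2_ge0 : forall x y, 0 <= V2 x y.

(** Homogeneity makes everything to be preserved linear in the weights of the letters: the mass at
    each x and, coded by the two booleans, the source and output entropies. *)
Lemma reduce_description (Y A : finType) (V : X -> Y -> R) (w : A -> X -> R) (a : A) :
  (forall x y, 0 <= V x y) -> (forall a x, 0 <= w a x) ->
  exists w' : 'I_#|{: X + bool}| -> X -> R,
  [/\ forall k x, 0 <= w' k x, forall x, \sum_k w' k x = \sum_a w a x,
      \sum_k entropy (w' k) = \sum_a entropy (w a) &
      \sum_k entropy (push V (w' k)) = \sum_a entropy (push V (w a))].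
Proof.
move=> V0 w0.
pose v a (j : X + bool) := match j with
  | inl x => w a x
  | inr true => entropy (w a)
  | inr false => entropy (push V (w a))
  end.
have [e [q [q0 qv]]] := @conic_caratheodory R A _ v (fun _ => 1) a (fun _ => ler01).
have {}qv j : \sum_k q k * v (e k) j = \sum_i v i j.
  by rewrite qv; apply: eq_bigr => i _; rewrite mul1r.
exists (fun k x => q k * w (e k) x); split.
- by move=> k x; rewrite mulr_ge0.
- by move=> x; rewrite (qv (inl x)).
- rewrite -(qv (inr true)); apply: eq_bigr => k _.
  by rewrite entropyZ.
- rewrite -(qv (inr false)); apply: eq_bigr => k _.
  rewrite (eq_entropy (pushZ _ _ _)) entropyZ// => y.
  exact: push_ge0.
Qed.

Lemma splitting_inh (A0 A1 A2 : finType) (w0 : A0 -> X -> R)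
    (w1 : A0 -> A1 -> X -> R) (w2 : A0 -> A2 -> X -> R) :
  splitting PX 1 w0 w1 w2 -> [/\ inhabited A0, inhabited A1 & inhabited A2].
Proof.
move=> [w1p w2p s1 s2 s0]; have [PX0 PX1] := PX_pmf.
have sumN0 (T : finType) (F : T -> R) : \sum_t F t != 0 -> exists t, F t != 0.
  move=> F0; apply/existsP; apply: contraNT F0 => /existsPn F0.
  by rewrite big1// => t _; apply/eqP; have := F0 t; rewrite negbK.
have [x] : exists x, PX x != 0 by apply: sumN0; rewrite PX1 oner_neq0.
rewrite -[PX x]mul1r -s0 => /sumN0[a0 w0N0].
split; first by exists.
- by move: w0N0; rewrite -s1 => /sumN0[a1 _]; exists.
- by move: w0N0; rewrite -s2 => /sumN0[a2 _]; exists.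
Qed.

(** The private descriptions are reduced inside each cell of U0, then U0 itself is reduced while
    keeping the law of X and the five entropy sums occurring in the constraints; hence the type
    [X + 'I_5]. *)
Lemma Region_bounded r0 r1 r2 t1 t2 : Region PX V1 V2 1 r0 r1 r2 t1 t2 ->
  exists (w0 : 'I_#|{: X + 'I_5}| -> X -> R)
    (w1 w2 : 'I_#|{: X + 'I_5}| -> 'I_#|{: X + bool}| -> X -> R),
    splitting PX 1 w0 w1 w2 /\
    entropy_bounds PX V1 V2 1 r0 r1 r2 t1 t2 w0 w1 w2.
Proof.
move=> [A0 [A1 [A2 [w0 [w1 [w2 [S [E0 E1 E2 E3 E4]]]]]]]].
have [[b0] [b1] [b2]] := splitting_inh S.
case: S => w1p w2p s1 s2 s0.
have w0p a0 x : 0 <= w0 a0 x by rewrite -s1 sumr_ge0.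
have /choice[w1' H1] a0 := reduce_description b1 V1_ge0 (w1p a0).
have /choice[w2' H2] a0 := reduce_description b2 V2_ge0 (w2p a0).
pose v a (j : X + 'I_5) := match j with
  | inl x => w0 a x
  | inr i => nth 0 [:: entropy (w0 a); \sum_b entropy (w1 a b);
      \sum_b entropy (w2 a b); \sum_b entropy (push V1 (w1 a b));
      \sum_b entropy (push V2 (w2 a b))] i
  end.
have [e [q [q0 qv]]] := @conic_caratheodory R A0 _ v (fun _ => 1) b0 (fun _ => ler01).
have {}qv j : \sum_k q k * v (e k) j = \sum_i v i j.
  by rewrite qv; apply: eq_bigr => i _; rewrite mul1r.
exists (fun k x => q k * w0 (e k) x), (fun k l x => q k * w1' (e k) l x),
  (fun k l x => q k * w2' (e k) l x).
have Q0 : \sum_k entropy (fun x => q k * w0 (e k) x) = \sum_a entropy (w0 a).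
  have := qv (inr (@Ordinal 5 0 isT)); rewrite /= => <-.
  by apply: eq_bigr => k _; rewrite entropyZ.
have Q1 : \sum_k \sum_l entropy (fun x => q k * w1' (e k) l x) =
    \sum_a \sum_b entropy (w1 a b).
  have := qv (inr (@Ordinal 5 1 isT)); rewrite /= => <-.
  apply: eq_bigr => k _; have [w1'p _ <- _] := H1 (e k).
  by rewrite mulr_sumr; apply: eq_bigr => l _; rewrite entropyZ.
have Q2 : \sum_k \sum_l entropy (fun x => q k * w2' (e k) l x) =
    \sum_a \sum_b entropy (w2 a b).
  have := qv (inr (@Ordinal 5 2 isT)); rewrite /= => <-.
  apply: eq_bigr => k _; have [w2'p _ <- _] := H2 (e k).
  by rewrite mulr_sumr; apply: eq_bigr => l _; rewrite entropyZ.
have Q3 : \sum_k \sum_l entropy (push V1 (fun x => q k * w1' (e k) l x)) =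
    \sum_a \sum_b entropy (push V1 (w1 a b)).
  have := qv (inr (@Ordinal 5 3 isT)); rewrite /= => <-.
  apply: eq_bigr => k _; have [w1'p _ _ <-] := H1 (e k).
  rewrite mulr_sumr; apply: eq_bigr => l _.
  by rewrite (eq_entropy (pushZ _ _ _)) entropyZ// => y; exact: push_ge0.
have Q4 : \sum_k \sum_l entropy (push V2 (fun x => q k * w2' (e k) l x)) =
    \sum_a \sum_b entropy (push V2 (w2 a b)).
  have := qv (inr (@Ordinal 5 4 isT)); rewrite /= => <-.
  apply: eq_bigr => k _; have [w2'p _ _ <-] := H2 (e k).
  rewrite mulr_sumr; apply: eq_bigr => l _.
  by rewrite (eq_entropy (pushZ _ _ _)) entropyZ// => y; exact: push_ge0.
split; split; rewrite ?Q0 ?Q1 ?Q2 ?Q3 ?Q4//.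
- by move=> k l x; have [w1'p _ _ _] := H1 (e k); rewrite mulr_ge0.
- by move=> k l x; have [w2'p _ _ _] := H2 (e k); rewrite mulr_ge0.
- by move=> k x; have [_ h _ _] := H1 (e k); rewrite -mulr_sumr h s1.
- by move=> k x; have [_ h _ _] := H2 (e k); rewrite -mulr_sumr h s2.
- by move=> x; rewrite (qv (inl x)) s0.
Qed.

End CardinalityBound.

(** * Closedness *)

Section Continuity.
Context {R : realType}.
Local Open Scope classical_set_scope.

Lemma ln_le_sqrt (x : R) : 0 < x -> ln x <= 2 * Num.sqrt x.
Proof.
move=> x0; have s0 : 0 < Num.sqrt x by rewrite sqrtr_gt0.
rewrite -[X in ln X](sqr_sqrtr (ltW x0)) lnXn// mulr2n.
have := ln_sublinear s0; lra.
Qed.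

Lemma eta_le0 (x : R) : x <= 0 -> eta x = 0.
Proof. by move=> x0; rewrite /eta /log2 ln0// mul0r mulr0. Qed.

Lemma eta_near0 (x : R) : x < 1 -> - (2 / ln 2 * Num.sqrt x) <= eta x <= 0.
Proof.
move=> x1; have [x0|x0] := leP x 0.
  by rewrite eta_le0// ler0_sqrtr// mulr0 oppr0 lexx.
have s0 : 0 < Num.sqrt x by rewrite sqrtr_gt0.
apply/andP; split; last first.
  rewrite mulr_ge0_le0 ?(ltW x0)// mulr_le0_ge0// ?invr_ge0 ?(ltW ln2_gt0)//.
  by rewrite ln_le0// ltW.
have := @ln_le_sqrt x^-1; rewrite invr_gt0 => /(_ x0).
rewrite lnV ?posrE// => H.
have : x * (- ln x) <= 2 * Num.sqrt x.
  apply: le_trans (_ : x * (2 * Num.sqrt x^-1) <= _).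
    by rewrite ler_pM2l.
  rewrite sqrtrV ?(ltW x0)// mulrCA ler_pM2l ?ltr0n//.
  by rewrite -[X in X / _](sqr_sqrtr (ltW x0)) expr2 mulfK// gt_eqF.
have -> : eta x = - (x * - ln x / ln 2) by rewrite /eta /log2; ring.
by rewrite mulrAC lerN2 ler_pM2r ?invr_gt0 ?ln2_gt0.
Qed.

(** Only 0 is delicate: there [eta] is squeezed by a multiple of the square root. On negative
    arguments [ln] takes its default value 0, so [eta] vanishes. *)
Lemma eta_continuous : continuous (@eta R).
Proof.
move=> x; have [x0|] := ltP 0 x.
  by apply: cvgM; [exact: cvg_id|apply: cvgMl; exact: continuous_ln].
rewrite le_eqVlt => /predU1P[->|x0].
  rewrite /continuous_at eta0; apply: (@squeeze_cvgr _ _ _ _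
    (fun x => - (2 / ln 2 * Num.sqrt x)) (fun=> 0)).
  - by near=> z; apply: eta_near0; near: z; exact: lt_nbhsl.
  - have : - (2 / ln 2 * Num.sqrt z) @[z --> (0 : R)] -->
        - (2 / ln 2 * Num.sqrt (0 : R)).
      by apply: cvgN; apply: cvgMr; exact: sqrt_continuous.
    by rewrite sqrtr0 mulr0 oppr0.
  - exact: cvg_cst.
rewrite /continuous_at eta_le0 ?(ltW x0)//.
apply: cvg_near_cst; near=> z.
  rewrite eta_le0//; apply/ltW; near: z.
exact: lt_nbhsl.
Unshelve. all: by end_near.
Qed.

Section Combinators.
Context (T : topologicalType).

Lemma continuous_add (f g : T -> R) :
  continuous f -> continuous g -> continuous (fun x => f x + g x).
Proof. by move=> cf cg x; apply: cvgD; [exact: cf|exact: cg]. Qed.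

Lemma continuous_opp (f : T -> R) :
  continuous f -> continuous (fun x => - f x).
Proof. by move=> cf x; apply: cvgN; exact: cf. Qed.

Lemma continuous_norm (f : T -> R) :
  continuous f -> continuous (fun x => `|f x|).
Proof. by move=> cf x; apply: cvg_norm; exact: cf. Qed.

Lemma continuous_mulr (f : T -> R) c :
  continuous f -> continuous (fun x => f x * c).
Proof. by move=> cf x; apply: cvgMl; exact: cf. Qed.

Lemma continuous_const (c : R) : continuous (fun _ : T => c).
Proof. by move=> x; exact: cvg_cst. Qed.

Lemma continuous_sum (I : finType) (f : I -> T -> R) :
  (forall i, continuous (f i)) -> continuous (fun x => \sum_i f i x).
Proof.
move=> cf; apply: continuous_big => //.
by move=> [a b]; apply: cvgD; [exact: cvg_fst|exact: cvg_snd].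
Qed.

Lemma continuous_entropy (I : finType) (f : T -> I -> R) :
  (forall i, continuous (f^~ i)) -> continuous (fun x => entropy (f x)).
Proof.
move=> cf; apply: continuous_add.
  move=> x; apply: continuous_comp; last exact: eta_continuous.
  exact: (continuous_sum cf).
apply: continuous_opp; apply: continuous_sum => i x.
by apply: continuous_comp; [exact: cf|exact: eta_continuous].
Qed.

Lemma continuous_push (X Y : finType) (V : X -> Y -> R) (f : T -> X -> R) y :
  (forall i, continuous (f^~ i)) -> continuous (fun u => push V (f u) y).
Proof.
by move=> cf; apply: continuous_sum => x; exact: continuous_mulr.
Qed.

End Combinators.

End Continuity.

(* Minimise over a compact box the total violation of the constraints. *)
Section ClosedRegion.
Context {R : realType} (X Y1 Y2 : finType) (PX : X -> R)
  (V1 : X -> Y1 -> R) (V2 : X -> Y2 -> R).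
Hypothesis PX_pmf : is_pmf PX.
Hypothesis V1_ge0 : forall x y, 0 <= V1 x y.
Hypothesis V2_ge0 : forall x y, 0 <= V2 x y.
Local Open Scope classical_set_scope.
Variables (r0 r1 r2 t1 t2 : R).

Let I0 := 'I_#|{: X + 'I_5}|.
Let I1 := 'I_#|{: X + bool}|.
Let K : finType := (I0 * I1 * X + I0 * I1 * X)%type.
Let V := 'rV[R]_#|K|.

Let coord (u : V) (k : K) := u ord0 (enum_rank k).
Let w1 (u : V) (a : I0) (b : I1) x := coord u (inl (a, b, x)).
Let w2 (u : V) (a : I0) (b : I1) x := coord u (inr (a, b, x)).
(** Taking [w0] as the marginal of [w1] builds one consistency constraint into the parametrisation;
    [gap2] and [gap0] measure the two that remain. *)
Let w0 (u : V) (a : I0) x := \sum_b w1 u a b x.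

Let coord_cont k : continuous (coord^~ k).
Proof. exact: coord_continuous. Qed.

Let w0_cont a x : continuous (fun u => w0 u a x).
Proof. by apply: continuous_sum => b; exact: coord_cont. Qed.

Let gap2 u := \sum_a \sum_x `|\sum_b w2 u a b x - w0 u a x|.
Let gap0 u := \sum_x `|\sum_a w0 u a x - PX x|.
Let excess u (i : 'I_5) : R := nth 0
  [:: entropy PX - (r0 + \sum_a entropy (w0 u a));
      \sum_a entropy (w0 u a) - (r1 + \sum_a \sum_b entropy (w1 u a b));
      \sum_a entropy (w0 u a) - (r2 + \sum_a \sum_b entropy (w2 u a b));
      t1 + \sum_a \sum_b entropy (push V1 (w1 u a b)) - entropy (push V1 PX);
      t2 + \sum_a \sum_b entropy (push V2 (w2 u a b)) - entropy (push V2 PX)] i.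
(** [|e| + e] is twice the positive part of e, so this continuous function is nonnegative and
    vanishes exactly when all the constraints, apart from nonnegativity, hold. *)
Let violation u := gap2 u + gap0 u + \sum_i (`|excess u i| + excess u i).

Let excess_cont i : continuous (excess^~ i).
Proof.
have c0 : continuous (fun u => \sum_a entropy (w0 u a)).
  by apply: continuous_sum => a; apply: continuous_entropy => x; exact: w0_cont.
have cw1 : continuous (fun u => \sum_a \sum_b entropy (w1 u a b)).
  apply: continuous_sum => a; apply: continuous_sum => b.
  by apply: continuous_entropy => x; exact: coord_cont.
have cw2 : continuous (fun u => \sum_a \sum_b entropy (w2 u a b)).
  apply: continuous_sum => a; apply: continuous_sum => b.
  by apply: continuous_entropy => x; exact: coord_cont.
have cV1 : continuous (fun u => \sum_a \sum_b entropy (push V1 (w1 u a b))).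
  apply: continuous_sum => a; apply: continuous_sum => b.
  apply: continuous_entropy => y; apply: continuous_push => x.
  exact: coord_cont.
have cV2 : continuous (fun u => \sum_a \sum_b entropy (push V2 (w2 u a b))).
  apply: continuous_sum => a; apply: continuous_sum => b.
  apply: continuous_entropy => y; apply: continuous_push => x.
  exact: coord_cont.
case: i => -[|[|[|[|[|//]]]]] h; rewrite /excess/=.
- apply: continuous_add; first exact: continuous_const.
  apply: continuous_opp; apply: continuous_add => //; exact: continuous_const.
- apply: continuous_add; first by [].
  apply: continuous_opp; apply: continuous_add => //; exact: continuous_const.
- apply: continuous_add; first by [].
  apply: continuous_opp; apply: continuous_add => //; exact: continuous_const.
- apply: continuous_add; last exact: continuous_const.
  by apply: continuous_add => //; exact: continuous_const.
- apply: continuous_add; last exact: continuous_const.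
  by apply: continuous_add => //; exact: continuous_const.
Qed.

Let violation_cont : continuous violation.
Proof.
apply: continuous_add; first apply: continuous_add.
- apply: continuous_sum => a; apply: continuous_sum => x.
  apply: continuous_norm; apply: continuous_add.
    by apply: continuous_sum => b; exact: coord_cont.
  by apply: continuous_opp; exact: w0_cont.
- apply: continuous_sum => x; apply: continuous_norm; apply: continuous_add.
    by apply: continuous_sum => a; exact: w0_cont.
  exact: continuous_const.
- apply: continuous_sum => i.
  by apply: continuous_add; [apply: continuous_norm|]; exact: excess_cont.
Qed.

Let box : set V := [set u | forall i, `[0%R, 1%R]%classic (u ord0 i)].

Let box_compact : compact box.
Proof. by apply: (@rV_compact R _ (fun=> `[0, 1])) => i; exact: segment_compact. Qed.

(** The equality constraints hold exactly, and each of the five inequalities is off by at most d,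
    which contributes at most 2 d. *)
Let approx d : 0 < d ->
  Region PX V1 V2 1 (r0 + d) (r1 + d) (r2 + d) (t1 - d) (t2 - d) ->
  exists2 u, box u & violation u <= 10 * d.
Proof.
move=> d0 /(Region_bounded PX_pmf V1_ge0 V2_ge0)[v0 [v1 [v2 [S [E0 E1 E2 E3 E4]]]]].
have [v1p v2p s1 s2 s0] := S.
pose u : V := \row_k match enum_val k with
  | inl (a, b, x) => v1 a b x
  | inr (a, b, x) => v2 a b x
  end.
have uw1 a b : w1 u a b = v1 a b.
  by apply/funext => x; rewrite /w1 /coord mxE enum_rankK.
have uw2 a b : w2 u a b = v2 a b.
  by apply/funext => x; rewrite /w2 /coord mxE enum_rankK.
have uw0 a : w0 u a = v0 a.
  by apply/funext => x; rewrite -s1; apply: eq_bigr => b _; rewrite uw1.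
have v0p a x : 0 <= v0 a x by rewrite -s1; exact: sumr_ge0.
have v0_1 a x : v0 a x <= 1.
  apply: le_trans (_ : PX x <= 1).
    by rewrite -[PX x]mul1r -s0; exact: (@le_sum1 _ _ (v0^~ x)).
  by have [PX0 <-] := PX_pmf; exact: le_sum1.
exists u.
  move=> k; rewrite /= in_itv/= mxE; case: (enum_val k) => -[[a b] x].
    rewrite v1p (le_trans _ (v0_1 a x))// -s1.
    exact: (@le_sum1 _ _ (fun b => v1 a b x)).
  rewrite v2p (le_trans _ (v0_1 a x))// -s2.
  exact: (@le_sum1 _ _ (fun b => v2 a b x)).
have -> : violation u = \sum_i (`|excess u i| + excess u i).
  rewrite /violation /gap2 /gap0 big1 ?add0r => [|a _].
    rewrite big1 ?add0r// => x _.
    by under eq_bigr do rewrite uw0; rewrite s0 mul1r subrr normr0.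
  rewrite big1// => x _.
  by under eq_bigr do rewrite uw2; rewrite s2 uw0 subrr normr0.
have U0 : \sum_a entropy (w0 u a) = \sum_a entropy (v0 a).
  by apply: eq_bigr => a _; rewrite uw0.
have U1 : \sum_a \sum_b entropy (w1 u a b) = \sum_a \sum_b entropy (v1 a b).
  by apply: eq_bigr => a _; apply: eq_bigr => b _; rewrite uw1.
have U2 : \sum_a \sum_b entropy (w2 u a b) = \sum_a \sum_b entropy (v2 a b).
  by apply: eq_bigr => a _; apply: eq_bigr => b _; rewrite uw2.
have U3 : \sum_a \sum_b entropy (push V1 (w1 u a b)) =
    \sum_a \sum_b entropy (push V1 (v1 a b)).
  by apply: eq_bigr => a _; apply: eq_bigr => b _; rewrite uw1.
have U4 : \sum_a \sum_b entropy (push V2 (w2 u a b)) =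
    \sum_a \sum_b entropy (push V2 (v2 a b)).
  by apply: eq_bigr => a _; apply: eq_bigr => b _; rewrite uw2.
have H i : `|excess u i| + excess u i <= 2 * d.
  have : excess u i <= d.
    case: i => -[|[|[|[|[|//]]]]] h; rewrite /excess/= ?U0 ?U1 ?U2 ?U3 ?U4.
    - lra.
    - lra.
    - lra.
    - lra.
    - lra.
  by have [|] := ler0P (excess u i); lra.
by apply: (le_trans (ler_sum _ (fun i _ => H i))); rewrite sumr_const card_ord; lra.
Qed.

Lemma Region_closed :
  (forall d, 0 < d ->
     Region PX V1 V2 1 (r0 + d) (r1 + d) (r2 + d) (t1 - d) (t2 - d)) ->
  Region PX V1 V2 1 r0 r1 r2 t1 t2.
Proof.
move=> H.
have box0 : box !=set0 by have [u bu _] := approx ltr01 (H _ ltr01); exists u.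
have [u /set_mem bu umin] := EVT_min_rV box0 box_compact
  (continuous_subspaceT violation_cont).
have v0 : violation u <= 0.
  apply/ler_addgt0Pl => e e0; rewrite addr0.
  have e10 : 0 < e / 10 by rewrite divr_gt0.
  have [u' /mem_set bu' h] := approx e10 (H _ e10).
  apply: le_trans (umin _ bu') _; apply: le_trans h _.
  by rewrite mulrC divfK.
have g2 : 0 <= gap2 u by apply: sumr_ge0 => a _; exact: sumr_ge0.
have g0 : 0 <= gap0 u by exact: sumr_ge0.
have ex i : 0 <= `|excess u i| + excess u i.
  by have := ler_norm (- excess u i); rewrite normrN; lra.
have exs : 0 <= \sum_i (`|excess u i| + excess u i) by exact: sumr_ge0.
move: v0; rewrite /violation => v0.
have /eqP g2_0 : gap2 u == 0 by rewrite eq_le g2; lra.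
have /eqP g0_0 : gap0 u == 0 by rewrite eq_le g0; lra.
have ex_le i : excess u i <= 0.
  have := @le_sum1 _ _ (fun i => `|excess u i| + excess u i) i ex.
  have := normr_ge0 (excess u i); lra.
have w1p a b x : 0 <= w1 u a b x.
  by have := bu (enum_rank (inl (a, b, x))); rewrite /= in_itv/= => /andP[].
have w2p a b x : 0 <= w2 u a b x.
  by have := bu (enum_rank (inr (a, b, x))); rewrite /= in_itv/= => /andP[].
exists I0, I1, I1, (w0 u), (w1 u), (w2 u); split; split => //.
- move=> a x; apply/eqP; rewrite -subr_eq0 -normr_le0.
  rewrite -[X in _ <= X]g2_0; apply: le_trans (_ : \sum_x `|\sum_b w2 u a b x - w0 u a x| <= _).
    exact: (@le_sum1 _ _ (fun x => `|\sum_b w2 u a b x - w0 u a x|)).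
  apply: (@le_sum1 _ _ (fun a => \sum_x `|\sum_b w2 u a b x - w0 u a x|)) => b.
  exact: sumr_ge0.
- move=> x; apply/eqP; rewrite mul1r -subr_eq0 -normr_le0.
  by rewrite -[X in _ <= X]g0_0; exact: (@le_sum1 _ _ (fun x => `|\sum_a w0 u a x - PX x|)).
- by have := ex_le (@Ordinal 5 0 isT); rewrite /excess/=; lra.
- by have := ex_le (@Ordinal 5 1 isT); rewrite /excess/=; lra.
- by have := ex_le (@Ordinal 5 2 isT); rewrite /excess/=; lra.
- by have := ex_le (@Ordinal 5 3 isT); rewrite /excess/=; lra.
- by have := ex_le (@Ordinal 5 4 isT); rewrite /excess/=; lra.
Qed.

End ClosedRegion.

(** * Random variables *)

Section Laws.
Context {R : realType}.

Lemma lawE (S : finType) (Q : S -> R) (A : finType) (f : S -> A) a :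
  law Q f a = \sum_s Q s * (f s == a)%:R.
Proof.
by rewrite /law big_mkcond; apply: eq_bigr => s _; case: eqP; rewrite ?mulr1 ?mulr0.
Qed.

Section OneSpace.
Context (S : finType) (Q : S -> R).

Lemma sum_law (A : finType) (f : S -> A) (F : A -> R) :
  \sum_a law Q f a * F a = \sum_s Q s * F (f s).
Proof.
under eq_bigr do rewrite lawE mulr_suml.
rewrite exchange_big; apply: eq_bigr => s _ /=.
rewrite (bigD1 (f s))//= eqxx mulr1 big1 ?addr0// => a /negbTE af.
by rewrite eq_sym af mulr0 mul0r.
Qed.

Lemma sum_law1 (A : finType) (f : S -> A) : \sum_a law Q f a = \sum_s Q s.
Proof.
have := sum_law f (fun=> 1).
by under eq_bigr do rewrite mulr1; under [RHS]eq_bigr do rewrite mulr1.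
Qed.

Lemma law_comp (A B : finType) (f : S -> A) (h : A -> B) b :
  law (law Q f) h b = law Q (fun s => h (f s)) b.
Proof. by rewrite [LHS]lawE sum_law -lawE. Qed.

Lemma law_id s : law Q id s = Q s.
Proof. by rewrite /law (big_pred1 s). Qed.

Lemma sum_law_l (A B : finType) (f : S -> A) (g : S -> B) b :
  \sum_a law Q [% f, g] (a, b) = law Q g b.
Proof.
rewrite lawE -(sum_law [% f, g] (fun p => (p.2 == b)%:R)).
rewrite -(pair_bigA _ (fun a b' => law Q [% f, g] (a, b') * (b' == b)%:R))/=.
apply: eq_bigr => a _; rewrite (bigD1 b)//= eqxx mulr1 big1 ?addr0//.
by move=> c /negbTE ->; rewrite mulr0.
Qed.

Lemma law_swap (A B : finType) (f : S -> A) (g : S -> B) a b :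
  law Q [% f, g] (a, b) = law Q [% g, f] (b, a).
Proof. by rewrite !lawE; apply: eq_bigr => s _; rewrite !xpair_eqE andbC. Qed.

Lemma sum_law_r (A B : finType) (f : S -> A) (g : S -> B) a :
  \sum_b law Q [% f, g] (a, b) = law Q f a.
Proof. by under eq_bigr do rewrite law_swap; exact: sum_law_l. Qed.

Lemma law_perm132 (A B C : finType) (f : S -> A) (g : S -> B) (h : S -> C) a b c :
  law Q [% f, g, h] (a, b, c) = law Q [% f, h, g] (a, c, b).
Proof.
by rewrite !lawE; apply: eq_bigr => s _; rewrite !xpair_eqE andbAC.
Qed.

Lemma law_assoc (A B C : finType) (f : S -> A) (g : S -> B) (h : S -> C) a b c :
  law Q [% f, g, h] (a, b, c) = law Q [% f, [% g, h]] (a, (b, c)).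
Proof.
by rewrite !lawE; apply: eq_bigr => s _; rewrite !xpair_eqE andbA.
Qed.

Lemma sum_law_mid (A B C : finType) (f : S -> A) (g : S -> B) (h : S -> C) a c :
  \sum_b law Q [% f, g, h] (a, b, c) = law Q [% f, h] (a, c).
Proof. by under eq_bigr do rewrite law_perm132; exact: sum_law_r. Qed.

Lemma sum_law_fst (A B C : finType) (f : S -> A) (g : S -> B) (h : S -> C) b c :
  \sum_a law Q [% f, g, h] (a, b, c) = law Q [% g, h] (b, c).
Proof. by under eq_bigr do rewrite law_assoc; exact: sum_law_l. Qed.

Hypothesis Q_pmf : is_pmf Q.

Lemma law_ge0 (A : finType) (f : S -> A) a : 0 <= law Q f a.
Proof. by apply: sumr_ge0 => s _; case: Q_pmf. Qed.

Lemma law_pmf (A : finType) (f : S -> A) : is_pmf (law Q f).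
Proof. by split; [exact: law_ge0|rewrite sum_law1; case: Q_pmf]. Qed.

Lemma law_const (A : finType) (f : S -> A) a : law Q f a = 1 ->
  forall s, Q s != 0 -> f s = a.
Proof.
have [Q0 Q1] := Q_pmf.
move=> fa s; apply: contraNeq => fs.
have : \sum_s Q s * (f s != a)%:R = 0.
  transitivity (\sum_s Q s - \sum_s Q s * (f s == a)%:R).
    rewrite -sumrB; apply: eq_bigr => t _.
    by case: eqP => _; rewrite ?mulr1 ?mulr0 ?subrr ?subr0.
  by rewrite -lawE fa Q1 subrr.
move=> /eqP; rewrite psumr_eq0 => [/allP/(_ s)|t _]; last by rewrite mulr_ge0.
by rewrite mem_index_enum fs mulr1; apply.
Qed.

Lemma mutual_infoE (A B : finType) (f : S -> A) (g : S -> B) :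
  mutual_info Q f g =
  entropy (law Q g) - \sum_a entropy (fun b => law Q [% f, g] (a, b)).
Proof.
have [_ Q1] := Q_pmf.
have termE a b : law Q [% f, g] (a, b) *
    log2 (law Q [% f, g] (a, b) / (law Q f a * law Q g b)) =
    eta (law Q [% f, g] (a, b)) - law Q [% f, g] (a, b) * log2 (law Q f a)
     - law Q [% f, g] (a, b) * log2 (law Q g b).
  have := law_ge0 [% f, g] (a, b); rewrite le_eqVlt => /predU1P[<-|l0].
    by rewrite eta0 !mul0r !subr0.
  have fa : 0 < law Q f a.
    rewrite -(sum_law_r f g); apply: (@sum_gt0 _ _ _ b) => // *; exact: law_ge0.
  have gb : 0 < law Q g b.
    rewrite -(sum_law_l f g); apply: (@sum_gt0 _ _ _ a) => // *; exact: law_ge0.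
  by rewrite log2_div ?mulr_gt0// log2M// /eta; ring.
rewrite /mutual_info; under eq_bigr => a _ do under eq_bigr do rewrite termE.
rewrite /entropy sum_law1 Q1 eta1 sub0r.
under eq_bigr => a _ do rewrite 2!sumrB -mulr_suml sum_law_r -/(eta _).
rewrite 2!sumrB [X in _ - _ - X]exchange_big/=.
under [X in _ - _ - X]eq_bigr => b _ do rewrite -mulr_suml sum_law_l -/(eta _).
rewrite [in RHS]sumrB; under [X in _ = _ - (X - _)]eq_bigr do rewrite sum_law_r.
by ring.
Qed.

Lemma cond_mutual_infoE (A B C : finType) (f : S -> A) (g : S -> B) (h : S -> C) :
  cond_mutual_info Q f g h =
  \sum_c entropy (fun b => law Q [% g, h] (b, c)) -
  \sum_c \sum_a entropy (fun b => law Q [% f, g, h] (a, b, c)).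
Proof.
have termE a b c : law Q [% f, g, h] (a, b, c) *
    log2 (cond Q [% f, g] h (a, b) c / (cond Q f h a c * cond Q g h b c)) =
    eta (law Q [% f, g, h] (a, b, c))
     - law Q [% f, g, h] (a, b, c) * log2 (law Q [% f, h] (a, c))
     - law Q [% f, g, h] (a, b, c) * log2 (law Q [% g, h] (b, c))
     + law Q [% f, g, h] (a, b, c) * log2 (law Q h c).
  have := law_ge0 [% f, g, h] (a, b, c); rewrite le_eqVlt => /predU1P[<-|l0].
    by rewrite eta0 !mul0r !subr0 addr0.
  have fa : 0 < law Q [% f, h] (a, c).
    rewrite -(sum_law_mid f g h); apply: (@sum_gt0 _ _ _ b) => // *; exact: law_ge0.
  have gb : 0 < law Q [% g, h] (b, c).
    rewrite -(sum_law_fst f g h); apply: (@sum_gt0 _ _ _ a) => // *; exact: law_ge0.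
  have hc : 0 < law Q h c.
    rewrite -(sum_law_l f h); apply: (@sum_gt0 _ _ _ a) => // *; exact: law_ge0.
  have p1 := divr_gt0 l0 hc; have p2 := divr_gt0 fa hc; have p3 := divr_gt0 gb hc.
  by rewrite /cond (log2_div p1 (mulr_gt0 p2 p3)) (log2M p2 p3) !log2_div// /eta; ring.
rewrite /cond_mutual_info.
have E1 : \sum_a \sum_b \sum_c law Q [% f, g, h] (a, b, c) *
    log2 (law Q [% f, h] (a, c)) = \sum_c \sum_a eta (law Q [% f, h] (a, c)).
  rewrite [RHS]exchange_big; apply: eq_bigr => a _; rewrite exchange_big.
  by apply: eq_bigr => c _; rewrite -mulr_suml sum_law_mid.
have E2 : \sum_a \sum_b \sum_c law Q [% f, g, h] (a, b, c) *
    log2 (law Q [% g, h] (b, c)) = \sum_c \sum_b eta (law Q [% g, h] (b, c)).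
  rewrite exchange_big [RHS]exchange_big; apply: eq_bigr => b _.
  rewrite exchange_big; apply: eq_bigr => c _.
  by rewrite -mulr_suml sum_law_fst.
have E3 : \sum_a \sum_b \sum_c law Q [% f, g, h] (a, b, c) *
    log2 (law Q h c) = \sum_c eta (law Q h c).
  under eq_bigr do rewrite exchange_big.
  rewrite exchange_big; apply: eq_bigr => c _.
  under eq_bigr do rewrite -mulr_suml sum_law_mid.
  by rewrite -mulr_suml sum_law_l.
have E0 : \sum_a \sum_b \sum_c eta (law Q [% f, g, h] (a, b, c)) =
    \sum_c \sum_a \sum_b eta (law Q [% f, g, h] (a, b, c)).
  rewrite [RHS]exchange_big; apply: eq_bigr => a _.
  by rewrite [RHS]exchange_big.
transitivity (\sum_a \sum_b \sum_c eta (law Q [% f, g, h] (a, b, c)) -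
  \sum_a \sum_b \sum_c law Q [% f, g, h] (a, b, c) *
    log2 (law Q [% f, h] (a, c)) -
  \sum_a \sum_b \sum_c law Q [% f, g, h] (a, b, c) *
    log2 (law Q [% g, h] (b, c)) +
  \sum_a \sum_b \sum_c law Q [% f, g, h] (a, b, c) * log2 (law Q h c)).
  rewrite -!sumrB -big_split; apply: eq_bigr => a _.
  rewrite -!sumrB -big_split; apply: eq_bigr => b _.
  rewrite -!sumrB -big_split; apply: eq_bigr => c _; exact: termE.
rewrite E0 E1 E2 E3 /entropy.
under [in RHS]eq_bigr do rewrite sum_law_l.
under [X in _ = _ - X]eq_bigr do under eq_bigr do rewrite sum_law_mid.
under [X in _ = _ - X]eq_bigr do rewrite sumrB.
by rewrite !sumrB; ring.
Qed.

Lemma law_pair_const (A C : finType) (f : S -> A) (z : S -> C) z0 a c :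
  (forall s, Q s != 0 -> z s = z0) ->
  law Q [% f, z] (a, c) = if c == z0 then law Q f a else 0.
Proof.
move=> zc; rewrite !lawE; have [->|cz] := eqVneq c z0.
  apply: eq_bigr => s _; have [->|/zc zs] := eqVneq (Q s) 0; first by rewrite !mul0r.
  by rewrite xpair_eqE zs eqxx andbT.
rewrite big1// => s _; have [->|/zc zs] := eqVneq (Q s) 0; first by rewrite !mul0r.
by rewrite xpair_eqE zs [z0 == c]eq_sym (negbTE cz) andbF mulr0.
Qed.

Lemma cond_mutual_info_const (A B C : finType) (f : S -> A) (g : S -> B)
    (z : S -> C) z0 : (forall s, Q s != 0 -> z s = z0) ->
  cond_mutual_info Q f g z = mutual_info Q f g.
Proof.
move=> zc; rewrite cond_mutual_infoE mutual_infoE.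
rewrite (bigD1 z0)//= [X in _ + X - _]big1 ?addr0; last first.
  move=> c cz; rewrite -[RHS](@entropy0 _ B); apply: eq_entropy => b.
  by rewrite (law_pair_const _ _ _ zc) (negbTE cz).
rewrite (bigD1 z0)//= [X in _ - (_ + X)]big1 ?addr0; last first.
  move=> c cz; rewrite big1// => a _; rewrite -[RHS](@entropy0 _ B).
  by apply: eq_entropy => b; rewrite (law_pair_const _ _ _ zc) (negbTE cz).
congr (_ - _).
  by apply: eq_entropy => b; rewrite (law_pair_const _ _ _ zc) eqxx.
apply: eq_bigr => a _; apply: eq_entropy => b.
by rewrite (law_pair_const _ _ _ zc) eqxx.
Qed.

Lemma cond_mutual_info_pair_const (A B C D : finType) (f : S -> A) (g : S -> B)
    (h : S -> D) (z : S -> C) z0 : (forall s, Q s != 0 -> z s = z0) ->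
  cond_mutual_info Q f g [% h, z] = cond_mutual_info Q f g h.
Proof.
move=> zc; rewrite !cond_mutual_infoE.
have E1 d : \sum_c entropy (fun b => law Q [% g, [% h, z]] (b, (d, c))) =
    entropy (fun b => law Q [% g, h] (b, d)).
  rewrite (bigD1 z0)//= big1 ?addr0; last first.
    move=> c cz; rewrite -[RHS](@entropy0 _ B); apply: eq_entropy => b.
    by rewrite -law_assoc (law_pair_const _ _ _ zc) (negbTE cz).
  by apply: eq_entropy => b; rewrite -law_assoc (law_pair_const _ _ _ zc) eqxx.
have E2 d : \sum_c \sum_a entropy (fun b => law Q [% f, g, [% h, z]] (a, b, (d, c))) =
    \sum_a entropy (fun b => law Q [% f, g, h] (a, b, d)).
  rewrite (bigD1 z0)//= [X in _ + X]big1 ?addr0; last first.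
    move=> c cz; rewrite big1// => a _; rewrite -[RHS](@entropy0 _ B).
    by apply: eq_entropy => b; rewrite -law_assoc (law_pair_const _ _ _ zc) (negbTE cz).
  apply: eq_bigr => a _; apply: eq_entropy => b.
  by rewrite -law_assoc (law_pair_const _ _ _ zc) eqxx.
rewrite -(pair_bigA _ (fun d c => entropy (fun b => law Q [% g, [% h, z]] (b, (d, c))))).
rewrite -(pair_bigA _ (fun d c => \sum_a
  entropy (fun b => law Q [% f, g, [% h, z]] (a, b, (d, c))))).
by congr (_ - _); apply: eq_bigr => d _; [exact: E1|exact: E2].
Qed.

End OneSpace.

Lemma mutual_info_law (S S' A B : finType) (Q : S -> R) (F : S -> S')
    (f : S' -> A) (g : S' -> B) :
  mutual_info (law Q F) f g =
  mutual_info Q (fun s => f (F s)) (fun s => g (F s)).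
Proof.
rewrite /mutual_info; apply: eq_bigr => a _; apply: eq_bigr => b _.
by rewrite !law_comp.
Qed.

Lemma cond_law (S S' A B : finType) (Q : S -> R) (F : S -> S')
    (f : S' -> A) (g : S' -> B) a b :
  cond (law Q F) f g a b = cond Q (fun s => f (F s)) (fun s => g (F s)) a b.
Proof. by rewrite /cond !law_comp. Qed.

Lemma cond_mutual_info_law (S S' A B C : finType) (Q : S -> R) (F : S -> S')
    (f : S' -> A) (g : S' -> B) (h : S' -> C) :
  cond_mutual_info (law Q F) f g h =
  cond_mutual_info Q (fun s => f (F s)) (fun s => g (F s)) (fun s => h (F s)).
Proof.
rewrite /cond_mutual_info; apply: eq_bigr => a _; apply: eq_bigr => b _.
by apply: eq_bigr => c _; rewrite !cond_law law_comp.
Qed.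

(* the transition probabilities P(g = y | f = x), completed into a stochastic
   kernel at the x of probability 0 *)
Definition kernel (S A B : finType) (P : S -> R) (f : S -> A) (g : S -> B)
    (x : A) (y : B) : R :=
  if law P f x == 0 then law P g y else law P [% f, g] (x, y) / law P f x.

Section Kernel.
Context (S A B : finType) (P : S -> R) (f : S -> A) (g : S -> B).
Hypothesis P_pmf : is_pmf P.

Lemma kernel_ge0 x y : 0 <= kernel P f g x y.
Proof. by rewrite /kernel; case: ifP => _; rewrite ?divr_ge0// law_ge0. Qed.

Lemma sum_kernel x : \sum_y kernel P f g x y = 1.
Proof.
rewrite /kernel; case: eqVneq => [_|h]; first by rewrite sum_law1; case: P_pmf.
by rewrite -mulr_suml sum_law_r divff.
Qed.

Lemma law_kernel x y : law P f x * kernel P f g x y = law P [% f, g] (x, y).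
Proof.
rewrite /kernel; case: eqVneq => [h|h]; last by rewrite mulrC divfK.
rewrite h mul0r; apply/eqP; rewrite eq_le law_ge0// -[X in _ <= X]h.
rewrite -(sum_law_r P f g); apply: (@le_sum1 _ _ (fun y => law P [% f, g] (x, y))).
by move=> z; exact: law_ge0.
Qed.

Lemma push_kernel y : push (kernel P f g) (law P f) y = law P g y.
Proof. by rewrite /push; under eq_bigr do rewrite law_kernel; exact: sum_law_l. Qed.

End Kernel.

End Laws.

(** * Informations, Markov chains, and their passage to the region *)

Section RandomVariables.
Context {R : realType} (T : finType) (Q : T -> R).
Hypothesis Q_pmf : is_pmf Q.

Let Q_ge0 s : 0 <= Q s. Proof. by case: Q_pmf. Qed.

Lemma mutual_info_ge0 (A B : finType) (f : T -> A) (g : T -> B) :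
  0 <= mutual_info Q f g.
Proof.
rewrite mutual_infoE// subr_ge0 (_ : law Q g = fun b => \sum_a law Q [% f, g] (a, b)).
  by apply: entropy_superadd => *; exact: law_ge0.
by apply/funext => b; rewrite sum_law_l.
Qed.

Lemma cond_mutual_info_ge0 (A B C : finType) (f : T -> A) (g : T -> B) (h : T -> C) :
  0 <= cond_mutual_info Q f g h.
Proof.
rewrite cond_mutual_infoE// subr_ge0; apply: ler_sum => c _.
rewrite (_ : (fun b => law Q [% g, h] (b, c)) =
  fun b => \sum_a law Q [% f, g, h] (a, b, c)).
  by apply: entropy_superadd => *; exact: law_ge0.
by apply/funext => b; rewrite sum_law_fst.
Qed.

Lemma mutual_info_chain (A B C : finType) (f : T -> A) (g : T -> B) (h : T -> C) :
  mutual_info Q [% h, f] g = mutual_info Q h g + cond_mutual_info Q f g h.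
Proof.
rewrite !mutual_infoE// cond_mutual_infoE//.
rewrite -(pair_bigA _ (fun c a => entropy (fun b => law Q [% h, f, g] (c, a, b)))) /=.
have -> : \sum_c entropy (fun b => law Q [% g, h] (b, c)) =
    \sum_c entropy (fun b => law Q [% h, g] (c, b)).
  by apply: eq_bigr => c _; apply: eq_entropy => b; exact: law_swap.
have -> : \sum_c \sum_a entropy (fun b => law Q [% f, g, h] (a, b, c)) =
    \sum_c \sum_a entropy (fun b => law Q [% h, f, g] (c, a, b)).
  apply: eq_bigr => c _; apply: eq_bigr => a _; apply: eq_entropy => b.
  by rewrite law_swap -law_assoc.
ring.
Qed.

(** Joining U0 to U1 costs no rate given U0; this justifies working with the pairs (U0, U_i). *)
Lemma cond_mutual_info_self (A B C : finType) (f : T -> A) (g : T -> B) (h : T -> C) :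
  cond_mutual_info Q [% h, f] g h = cond_mutual_info Q f g h.
Proof.
rewrite !cond_mutual_infoE//; congr (_ - _); apply: eq_bigr => c _.
rewrite -(pair_bigA _ (fun c' a =>
  entropy (fun b => law Q [% [% h, f], g, h] (c', a, b, c)))) /=.
rewrite (bigD1 c)//= [X in _ + X]big1 ?addr0.
  apply: eq_bigr => a _; apply: eq_entropy => b; rewrite !lawE.
  apply: eq_bigr => s _; rewrite !xpair_eqE.
  by case: (h s == c); rewrite ?andbF ?andbT.
move=> d /negbTE dc; rewrite big1// => a _; rewrite -[RHS](@entropy0 _ B).
apply: eq_entropy => b; rewrite lawE big1// => s _; rewrite !xpair_eqE.
by have [->|] := eqVneq (h s) d; rewrite ?dc ?andbF ?mulr0.
Qed.

Lemma law_map3 (A A' B B' X : finType) (f : T -> A) (g : T -> B) (k : T -> X)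
    (f' : A -> A') (g' : B -> B') u y x :
  law Q [% (fun s => f' (f s)), (fun s => g' (g s)), k] (u, y, x) =
  \sum_a \sum_b law Q [% f, g, k] (a, b, x) * ((f' a == u)%:R * (g' b == y)%:R).
Proof.
under eq_bigr => a _ do under eq_bigr => b _ do rewrite lawE mulr_suml.
under eq_bigr => a _ do rewrite exchange_big/=.
rewrite exchange_big/= lawE; apply: eq_bigr => s _.
rewrite (bigD1 (f s))//= [X in _ = _ + X]big1 ?addr0; last first.
  move=> a /negbTE af; rewrite big1// => b _.
  by rewrite !xpair_eqE eq_sym af mulr0 mul0r.
rewrite (bigD1 (g s))//= big1 ?addr0; last first.
  move=> b /negbTE bg.
  by rewrite !xpair_eqE [g s == b]eq_sym bg andbF mulr0 mul0r.
rewrite !xpair_eqE !eqxx/= -mulrA; congr (_ * _).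
by rewrite -!natrM !mulnb andbC andbA.
Qed.

(** Conditional independence passes to functions of the two ends. It is multiplied out, so that no
    division remains where [law Q k x] is 0. *)
Lemma markov_map (A A' B B' X : finType) (f : T -> A) (g : T -> B) (k : T -> X)
    (f' : A -> A') (g' : B -> B') u y x : markov_chain Q f k g ->
  law Q [% (fun s => f' (f s)), (fun s => g' (g s)), k] (u, y, x) * law Q k x =
  law Q [% (fun s => f' (f s)), k] (u, x) * law Q [% (fun s => g' (g s)), k] (y, x).
Proof.
move=> M.
have M' a b : law Q [% f, g, k] (a, b, x) * law Q k x =
    law Q [% f, k] (a, x) * law Q [% g, k] (b, x).
  have := M a x b; rewrite /cond.
  have [k0|k0] := eqVneq (law Q k x) 0.
    move=> _; rewrite k0 mulr0.
    suff -> : law Q [% f, k] (a, x) = 0 by rewrite mul0r.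
    apply/eqP; rewrite eq_le law_ge0// andbT -k0 -(sum_law_l Q f k).
    by apply: (@le_sum1 _ _ (fun a => law Q [% f, k] (a, x))) => c; exact: law_ge0.
  by move=> /(congr1 (fun z => z * law Q k x * law Q k x)); rewrite divfK// => ->; field.
have F' : law Q [% (fun s => f' (f s)), k] (u, x) =
    \sum_a law Q [% f, k] (a, x) * (f' a == u)%:R.
  rewrite -(sum_law_mid _ (fun s => f' (f s)) (fun _ => tt) k) sum_unit.
  rewrite (law_map3 _ (fun _ => tt) _ f' id); apply: eq_bigr => a _.
  by rewrite sum_unit eqxx mulr1 -(sum_law_mid Q f (fun _ => tt) k) sum_unit.
have G' : law Q [% (fun s => g' (g s)), k] (y, x) =
    \sum_b law Q [% g, k] (b, x) * (g' b == y)%:R.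
  rewrite -(sum_law_fst _ (fun _ => tt) (fun s => g' (g s)) k) sum_unit.
  rewrite (law_map3 (fun _ => tt) _ _ id g') sum_unit; apply: eq_bigr => b _.
  by rewrite eqxx mul1r -(sum_law_fst Q (fun _ => tt) g k) sum_unit.
rewrite law_map3 F' G' mulr_suml mulr_suml; apply: eq_bigr => a _.
rewrite mulr_suml mulr_sumr; apply: eq_bigr => b _.
by rewrite mulrAC M'; ring.
Qed.

Section ToRegion.
Context (A0 A1 A2 X Y Y1 Y2 : finType) (U0 : T -> A0) (U1 : T -> A1)
  (U2 : T -> A2) (rX : T -> X) (rY : T -> Y) (g1 : Y -> Y1) (g2 : Y -> Y2)
  (PX : X -> R) (V1 : X -> Y1 -> R) (V2 : X -> Y2 -> R).
Let rY1 s := g1 (rY s).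
Let rY2 s := g2 (rY s).
Hypothesis PXE : forall x, law Q rX x = PX x.
Hypothesis V1E : forall x y, law Q [% rX, rY1] (x, y) = PX x * V1 x y.
Hypothesis V2E : forall x y, law Q [% rX, rY2] (x, y) = PX x * V2 x y.
Hypothesis V1_ge0 : forall x y, 0 <= V1 x y.
Hypothesis V2_ge0 : forall x y, 0 <= V2 x y.
Hypothesis markov : markov_chain Q [% U0, U1, U2] rX rY.

Lemma law_through_kernel (A Z : finType) (u : A0 * A1 * A2 -> A) (g : Y -> Z)
    (V : X -> Z -> R) a z :
  (forall x y, law Q [% rX, (fun s => g (rY s))] (x, y) = PX x * V x y) ->
  law Q [% (fun s => u ([% U0, U1, U2] s)), (fun s => g (rY s))] (a, z) =
  push V (fun x => law Q [% (fun s => u ([% U0, U1, U2] s)), rX] (a, x)) z.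
Proof.
move=> VE; rewrite -(sum_law_r _ _ rX); apply: eq_bigr => x _.
have := markov_map u g a z x markov; rewrite PXE.
rewrite [X in _ = _ * X -> _]law_swap VE.
have [x0|x0] := eqVneq (PX x) 0; last by move=> E; apply: (mulIf x0); rewrite E; ring.
move=> _.
have le0 (B : finType) (f : T -> B) b : law Q [% f, rX] (b, x) = 0.
  apply/eqP; rewrite eq_le law_ge0// andbT -x0 -PXE -(sum_law_l Q f rX).
  by apply: (@le_sum1 _ _ (fun a => law Q [% f, rX] (a, x))) => c; exact: law_ge0.
by rewrite le0 le0 mul0r.
Qed.

(** I(U;Y) <= I(U0,U;Y): the region measures the exponent with the pair, which superadditivity shows
    to be no smaller. *)
Lemma sum_entropy_push_le (A Z : finType) (U : T -> A) (u : A0 * A1 * A2 -> A)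
    (g : Y -> Z) (V : X -> Z -> R) : (U =1 fun s => u ([% U0, U1, U2] s)) ->
  (forall x y, 0 <= V x y) ->
  (forall x y, law Q [% rX, (fun s => g (rY s))] (x, y) = PX x * V x y) ->
  mutual_info Q U (fun s => g (rY s)) +
   \sum_a0 \sum_a entropy (push V (fun x => law Q [% U, rX, U0] (a, x, a0))) <=
  entropy (push V PX).
Proof.
move=> /funext -> V0 VE; rewrite mutual_infoE//.
have -> : law Q (fun s => g (rY s)) = push V PX.
  apply/funext => y; rewrite -(sum_law_l _ rX).
  by apply: eq_bigr => x _; rewrite VE.
rewrite -addrA gerDl addrC subr_le0 exchange_big; apply: ler_sum => a _.
rewrite (_ : (fun b => _) = fun z =>
  \sum_a0 push V (fun x => law Q [% (fun s => u ([% U0, U1, U2] s)), rX, U0] (a, x, a0)) z).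
  by apply: entropy_superadd => a0 z; apply: push_ge0 => // x; exact: law_ge0.
apply/funext => z; rewrite push_sum (law_through_kernel u a z VE).
by apply: eq_bigr => x _; rewrite sum_law_r.
Qed.

Lemma markov_Region :
  Region PX V1 V2 1 (mutual_info Q U0 rX) (cond_mutual_info Q U1 rX U0)
    (cond_mutual_info Q U2 rX U0) (mutual_info Q U1 rY1) (mutual_info Q U2 rY2).
Proof.
exists A0, A1, A2, (fun a0 x => law Q [% U0, rX] (a0, x)),
  (fun a0 a1 x => law Q [% U1, rX, U0] (a1, x, a0)),
  (fun a0 a2 x => law Q [% U2, rX, U0] (a2, x, a0)).
have w0E : \sum_a0 entropy (fun x => law Q [% U0, rX] (a0, x)) =
    \sum_a0 entropy (fun x => law Q [% rX, U0] (x, a0)).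
  by apply: eq_bigr => a _; apply: eq_entropy => x; exact: law_swap.
have PXE' : law Q rX = PX by apply/funext.
split; split; rewrite ?mul1r.
- by move=> *; exact: law_ge0.
- by move=> *; exact: law_ge0.
- by move=> a0 x; rewrite sum_law_fst law_swap.
- by move=> a0 x; rewrite sum_law_fst law_swap.
- by move=> x; rewrite sum_law_l PXE mul1r.
- by rewrite mutual_infoE// PXE' subrK.
- by rewrite cond_mutual_infoE// subrK w0E.
- by rewrite cond_mutual_infoE// subrK w0E.
- exact: (@sum_entropy_push_le _ _ U1 (fun p => p.1.2) g1).
- exact: (@sum_entropy_push_le _ _ U2 (fun p => p.2) g2).
Qed.

End ToRegion.

End RandomVariables.

(** * From a splitting back to random variables *)

Section FromRegion.
Context {R : realType} (S X Y1 Y2 : finType) (P : S -> R) (rX : S -> X)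
  (rY1 : S -> Y1) (rY2 : S -> Y2).
Hypothesis P_pmf : is_pmf P.

Let PX := law P rX.

Section ConditionalKernel.
Context (B : finType) (K : B -> X -> R).
Hypothesis K_ge0 : forall b x, 0 <= K b x.
Hypothesis sumK : forall x, PX x != 0 -> \sum_b K b x = 1.

(** The descriptions are drawn from [K] given the source letter alone, so the Markov chain holds by
    construction. *)
Let Q (p : B * S) : R := K p.1 (rX p.2) * P p.2.
Local Notation mass U u x := (\sum_b K b x * (U b == u)%:R).

Lemma law_attach (A Y : finType) (U : B -> A) (Z : S -> Y) u z x :
  law Q [% (fun p => U p.1), (fun p => Z p.2), (fun p => rX p.2)] (u, z, x) =
  mass U u x * law P [% Z, rX] (z, x).
Proof.
rewrite !lawE -(pair_bigA _ (fun b s => K b (rX s) * P s *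
  ((U b, Z s, rX s) == (u, z, x))%:R))/= mulr_suml.
apply: eq_bigr => b _; rewrite mulr_sumr; apply: eq_bigr => s _.
rewrite !xpair_eqE; have [->|_] := eqVneq (rX s) x; last by rewrite !andbF !mulr0.
by rewrite !andbT; case: (U b == u); case: (Z s == z); rewrite /=; ring.
Qed.

Let law0 (A : finType) (f : S -> A) a x : PX x = 0 -> law P [% f, rX] (a, x) = 0.
Proof.
move=> x0; apply/eqP; rewrite eq_le law_ge0// andbT -x0 /PX -(sum_law_l P f rX).
by apply: (@le_sum1 _ _ (fun a => law P [% f, rX] (a, x))) => c; exact: law_ge0.
Qed.

Lemma law_attach_source (Y : finType) (Z : S -> Y) z :
  law Q (fun p => Z p.2) z = law P Z z.
Proof.
rewrite -(sum_law_r Q _ (fun p => rX p.2)) -(sum_law_r P Z rX).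
apply: eq_bigr => x _.
rewrite -(sum_law_fst Q (fun p => p.1)).
under eq_bigr do rewrite (law_attach id).
rewrite -mulr_suml exchange_big/=.
have [/law0 ->|x0] := eqVneq (PX x) 0; first by rewrite mulr0.
rewrite -[RHS]mul1r; congr (_ * _); rewrite -[RHS](sumK x0).
apply: eq_bigr => b _.
by rewrite (bigD1 b)//= eqxx mulr1 big1 ?addr0// => c /negbTE cb; rewrite eq_sym cb mulr0.
Qed.

Lemma law_attachX (A : finType) (U : B -> A) u x :
  law Q [% (fun p => U p.1), (fun p => rX p.2)] (u, x) = mass U u x * PX x.
Proof.
rewrite -(sum_law_mid Q _ (fun p => p.2)).
by under eq_bigr do rewrite (law_attach U id); rewrite -mulr_sumr sum_law_l.
Qed.

Lemma attach_pmf : is_pmf Q.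
Proof.
split=> [[b s]|]; first by rewrite mulr_ge0//; case: P_pmf.
rewrite -(sum_law1 Q (fun p => p.2)).
under eq_bigr do rewrite (law_attach_source id).
by rewrite sum_law1; case: P_pmf.
Qed.

Lemma attach_markov (A Y : finType) (U : B -> A) (Z : S -> Y) :
  markov_chain Q (fun p => U p.1) (fun p => rX p.2) (fun p => Z p.2).
Proof.
move=> u x z; rewrite /cond law_attach law_attachX law_attach_source -/PX.
rewrite (law_attach_source [% Z, rX]).
have [x0|x0] := eqVneq (PX x) 0; first by rewrite x0 invr0 !mulr0.
by rewrite mulfK// mulrA.
Qed.

Lemma law_attach_kernel (A Y : finType) (U : B -> A) (Z : S -> Y) u z :
  law Q [% (fun p => U p.1), (fun p => Z p.2)] (u, z) =
  push (kernel P rX Z) (fun x => mass U u x * PX x) z.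
Proof.
rewrite -(sum_law_r Q _ (fun p => rX p.2)); apply: eq_bigr => x _.
by rewrite law_attach -mulrA law_kernel// law_swap.
Qed.

End ConditionalKernel.


Let V1 := kernel P rX rY1.
Let V2 := kernel P rX rY2.

(** The splitting fixes only the laws of (U0, U1, X) and (U0, U2, X). Any coupling of the two that
    agrees with them yields the same five informations. *)
Lemma Region_markov r0 r1 r2 t1 t2 : Region PX V1 V2 1 r0 r1 r2 t1 t2 ->
  exists (A0 A1 A2 : finType) (Q : A0 * A1 * A2 * S -> R),
  let U0 := fun s : A0 * A1 * A2 * S => s.1.1.1 in
  let U1 := fun s : A0 * A1 * A2 * S => s.1.1.2 in
  let U2 := fun s : A0 * A1 * A2 * S => s.1.2 in
  [/\ is_pmf Q, law Q snd =1 P &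
      forall (Y : finType) (Z : S -> Y),
        markov_chain Q [% U0, U1, U2] (fun s => rX s.2) (fun s => Z s.2)] /\
  [/\ mutual_info Q U0 (fun s => rX s.2) <= r0,
      cond_mutual_info Q U1 (fun s => rX s.2) U0 <= r1,
      cond_mutual_info Q U2 (fun s => rX s.2) U0 <= r2,
      t1 <= mutual_info Q U1 (fun s => rY1 s.2) &
      t2 <= mutual_info Q U2 (fun s => rY2 s.2)].
Proof.
move=> [A0 [A1 [A2 [w0 [w1 [w2 [[w1p w2p s1 s2 s0] [E0 E1 E2 E3 E4]]]]]]]].
have w0p a0 x : 0 <= w0 a0 x by rewrite -s1 sumr_ge0.
have PX0 x : 0 <= PX x by exact: law_ge0.
pose B : finType := (A0 * A1 * A2)%type.
(* The coupling chosen makes U1 and U2 conditionally independent given (U0, X). Where [PX x] is 0,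
   [K] is 0 by default and not stochastic, which carries no mass. *)
pose K (b : B) x := w1 b.1.1 b.1.2 x * w2 b.1.1 b.2 x / w0 b.1.1 x / PX x.
have Kp b x : 0 <= K b x by rewrite divr_ge0// divr_ge0// mulr_ge0.
have sum3 (F : A0 -> A1 -> A2 -> R) :
    \sum_(b : B) F b.1.1 b.1.2 b.2 = \sum_a0 \sum_a1 \sum_a2 F a0 a1 a2.
  rewrite -(pair_bigA _ (fun p a2 => F p.1 p.2 a2))/=.
  by rewrite -(pair_bigA _ (fun a0 a1 => \sum_a2 F a0 a1 a2)).
have wz1 a0 a1 x : w0 a0 x = 0 -> w1 a0 a1 x = 0.
  move=> h; apply/eqP; rewrite eq_le w1p andbT -h -s1.
  exact: (@le_sum1 _ _ (fun a => w1 a0 a x)).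
have wz2 a0 a2 x : w0 a0 x = 0 -> w2 a0 a2 x = 0.
  move=> h; apply/eqP; rewrite eq_le w2p andbT -h -s2.
  exact: (@le_sum1 _ _ (fun a => w2 a0 a x)).
have wz0 a0 x : PX x = 0 -> w0 a0 x = 0.
  move=> h; apply/eqP; rewrite eq_le w0p andbT -h -[PX x]mul1r -s0.
  exact: (@le_sum1 _ _ (fun a => w0 a x)).
have m1 a0 a1 x : \sum_a2 w1 a0 a1 x * w2 a0 a2 x / w0 a0 x = w1 a0 a1 x.
  rewrite -mulr_suml -mulr_sumr s2.
  by have [h|h] := eqVneq (w0 a0 x) 0; [rewrite wz1// !mul0r|rewrite mulfK].
have m2 a0 a2 x : \sum_a1 w1 a0 a1 x * w2 a0 a2 x / w0 a0 x = w2 a0 a2 x.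
  rewrite -mulr_suml -mulr_suml s1.
  by have [h|h] := eqVneq (w0 a0 x) 0;
    [rewrite wz2// mulr0 mul0r|rewrite mulrAC divff ?mul1r].
have sumK x : PX x != 0 -> \sum_b K b x = 1.
  move=> x0; rewrite (sum3 (fun a0 a1 a2 =>
    w1 a0 a1 x * w2 a0 a2 x / w0 a0 x / PX x)).
  transitivity ((\sum_a0 w0 a0 x) / PX x); last by rewrite s0 mul1r divff.
  rewrite mulr_suml; apply: eq_bigr => a0 _.
  rewrite -[X in _ = X / _]s1 mulr_suml.
  by apply: eq_bigr => a1 _; rewrite -mulr_suml m1.
pose Q0 (p : B * S) := K p.1 (rX p.2) * P p.2.
have Q0_pmf : is_pmf Q0 by exact: attach_pmf.
have cancelPX a0 x : w0 a0 x / PX x * PX x = w0 a0 x.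
  by have [h|h] := eqVneq (PX x) 0; [rewrite h mulr0 wz0|rewrite divfK].
have mass0 a0 x : (\sum_b K b x * (b.1.1 == a0)%:R) * PX x = w0 a0 x.
  rewrite -[RHS]cancelPX; congr (_ * _).
  rewrite (sum3 (fun b0 b1 b2 =>
    w1 b0 b1 x * w2 b0 b2 x / w0 b0 x / PX x * (b0 == a0)%:R)).
  rewrite (bigD1 a0)//= [X in _ + X]big1 ?addr0; last first.
    by move=> b /negbTE h; rewrite big1// => ? _; rewrite big1// => ? _; rewrite h mulr0.
  rewrite -[X in _ = X / _]s1 mulr_suml; apply: eq_bigr => b1 _.
  by under eq_bigr do rewrite eqxx mulr1; rewrite -mulr_suml m1.
have mass1 a0 a1 x : (\sum_b K b x * (b.1 == (a0, a1))%:R) * PX x = w1 a0 a1 x.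
  transitivity (w1 a0 a1 x / PX x * PX x); last first.
    by have [h|h] := eqVneq (PX x) 0; [rewrite h mulr0 wz1// wz0|rewrite divfK].
  congr (_ * _); rewrite -[LHS](pair_bigA _ (fun p b2 =>
    w1 p.1 p.2 x * w2 p.1 b2 x / w0 p.1 x / PX x * (p == (a0, a1))%:R))/=.
  rewrite (bigD1 (a0, a1))//= [X in _ + X]big1 ?addr0; last first.
    by move=> b /negbTE h; rewrite big1// => ? _; rewrite h mulr0.
  by under eq_bigr do rewrite eqxx mulr1; rewrite -mulr_suml m1.
have mass2 a0 a2 x : (\sum_b K b x * ((b.1.1, b.2) == (a0, a2))%:R) * PX x = w2 a0 a2 x.
  transitivity (w2 a0 a2 x / PX x * PX x); last first.
    by have [h|h] := eqVneq (PX x) 0; [rewrite h mulr0 wz2// wz0|rewrite divfK].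
  congr (_ * _); rewrite (sum3 (fun b0 b1 b2 =>
    w1 b0 b1 x * w2 b0 b2 x / w0 b0 x / PX x * ((b0, b2) == (a0, a2))%:R)).
  rewrite (bigD1 a0)//= [X in _ + X]big1 ?addr0; last first.
    move=> b /negbTE h; rewrite big1// => ? _; rewrite big1// => ? _.
    by rewrite xpair_eqE h mulr0.
  rewrite -[X in _ = X / _](m2 a0 a2 x) mulr_suml; apply: eq_bigr => b1 _.
  rewrite (bigD1 a2)//= big1 ?addr0; last first.
    by move=> b /negbTE h; rewrite xpair_eqE h andbF mulr0.
  by rewrite eqxx mulr1.
(* The private descriptions are delivered as the pairs (U0, U1) and (U0, U2), so that I(U_i;Y_i)
   equals the exponent measured in the region. *)
pose F (p : B * S) := (p.1.1.1, p.1.1, (p.1.1.1, p.1.2), p.2).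
exists A0, (A0 * A1)%type, (A0 * A2)%type, (law Q0 F) => U0 U1 U2; split.
  split; first exact: law_pmf.
  - by move=> s; rewrite law_comp -[RHS](law_id P); exact: (law_attach_source sumK id).
  - move=> Y Z u x z; rewrite !cond_law.
    exact: (attach_markov sumK (fun b : B => (b.1.1, b.1, (b.1.1, b.2))) Z).
have lawX : law Q0 (fun p => rX p.2) = PX.
  by apply/funext => x; rewrite (law_attach_source sumK rX).
have mi0 : mutual_info (law Q0 F) U0 (fun s => rX s.2) =
    entropy PX - \sum_a0 entropy (w0 a0).
  rewrite mutual_info_law mutual_infoE// lawX; congr (_ - _).
  apply: eq_bigr => a0 _; apply: eq_entropy => x.
  by rewrite (law_attachX _ (fun b : B => b.1.1)) mass0.
have lawX0 a0 : (fun x => law Q0 [% (fun p => rX p.2), (fun p => p.1.1.1)] (x, a0)) = w0 a0.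
  by apply/funext => x; rewrite law_swap (law_attachX _ (fun b : B => b.1.1)) mass0.
have mi1 : cond_mutual_info (law Q0 F) U1 (fun s => rX s.2) U0 =
    \sum_a0 entropy (w0 a0) - \sum_a0 \sum_a1 entropy (w1 a0 a1).
  rewrite cond_mutual_info_law -[LHS]/(cond_mutual_info Q0
    (fun p : B * S => p.1.1) (fun p => rX p.2) (fun p => p.1.1.1)).
  rewrite (_ : (fun p : B * S => p.1.1) =
    [% (fun p : B * S => p.1.1.1), (fun p => p.1.1.2)]); last first.
    by apply/funext => -[[[? ?] ?] ?].
  rewrite cond_mutual_info_self// cond_mutual_infoE//; congr (_ - _).
    by apply: eq_bigr => a0 _; rewrite lawX0.
  apply: eq_bigr => a0 _; apply: eq_bigr => a1 _; apply: eq_entropy => x.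
  rewrite -mass1 -(law_attachX _ (fun b : B => b.1)) !lawE.
  apply: eq_bigr => -[[[b0 b1] b2] s] _; rewrite !xpair_eqE/=.
  by rewrite andbC andbA.
have mi2 : cond_mutual_info (law Q0 F) U2 (fun s => rX s.2) U0 =
    \sum_a0 entropy (w0 a0) - \sum_a0 \sum_a2 entropy (w2 a0 a2).
  rewrite cond_mutual_info_law (cond_mutual_info_self Q0_pmf (fun p => p.1.2)
    (fun p => rX p.2) (fun p => p.1.1.1)).
  rewrite cond_mutual_infoE//; congr (_ - _).
    by apply: eq_bigr => a0 _; rewrite lawX0.
  apply: eq_bigr => a0 _; apply: eq_bigr => a2 _; apply: eq_entropy => x.
  rewrite -mass2 -(law_attachX _ (fun b : B => (b.1.1, b.2))) !lawE.
  by apply: eq_bigr => p _; rewrite !xpair_eqE andbC andbA.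
have mi3 : mutual_info (law Q0 F) U1 (fun s => rY1 s.2) =
    entropy (push V1 PX) - \sum_a0 \sum_a1 entropy (push V1 (w1 a0 a1)).
  rewrite mutual_info_law mutual_infoE//; congr (_ - _).
    by apply: eq_entropy => y; rewrite (law_attach_source sumK rY1) push_kernel.
  rewrite (pair_bigA _ (fun a0 a1 => entropy (push V1 (w1 a0 a1)))).
  apply: eq_bigr => -[a0 a1] _; apply: eq_entropy => y.
  rewrite (law_attach_kernel _ (fun b : B => b.1)).
  by apply: eq_bigr => x _; rewrite mass1.
have mi4 : mutual_info (law Q0 F) U2 (fun s => rY2 s.2) =
    entropy (push V2 PX) - \sum_a0 \sum_a2 entropy (push V2 (w2 a0 a2)).
  rewrite mutual_info_law mutual_infoE//; congr (_ - _).
    by apply: eq_entropy => y; rewrite (law_attach_source sumK rY2) push_kernel.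
  rewrite (pair_bigA _ (fun a0 a2 => entropy (push V2 (w2 a0 a2)))).
  apply: eq_bigr => -[a0 a2] _; apply: eq_entropy => y.
  rewrite (law_attach_kernel _ (fun b : B => (b.1.1, b.2))).
  by apply: eq_bigr => x _; rewrite mass2.
by rewrite mi0 mi1 mi2 mi3 mi4; split; lra.
Qed.

End FromRegion.

Lemma kernel_law (R : realType) (S S' A B : finType) (P : S -> R) (F : S -> S')
    (f : S' -> A) (g : S' -> B) :
  kernel (law P F) f g = kernel P (fun s => f (F s)) (fun s => g (F s)).
Proof. by apply/funext => x; apply/funext => y; rewrite /kernel !law_comp. Qed.

(** * The two single-letter regions in terms of the homogeneous region *)

Section SingleLetter.
Context (R : realType) (X Y1 Y2 Z1 Z2 : finType).
Variable (P : X * Y1 * Y2 * Z1 * Z2 -> R).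
Hypothesis P_pmf : is_pmf P.

Notation pX := (@srcX X Y1 Y2 Z1 Z2).
Notation pY1 := (@srcY1 X Y1 Y2 Z1 Z2).
Notation pY2 := (@srcY2 X Y1 Y2 Z1 Z2).
Notation pZ1 := (@srcZ1 X Y1 Y2 Z1 Z2).
Notation pZ2 := (@srcZ2 X Y1 Y2 Z1 Z2).
Let PX := law P pX.
Let V1 := kernel P pX pY1.
Let V2 := kernel P pX pY2.
Let P3 := law P [% pX, pY1, pY2].

Let P3_pmf : is_pmf P3. Proof. exact: law_pmf. Qed.
Let V1_ge0 : forall x y, 0 <= V1 x y. Proof. exact: kernel_ge0. Qed.
Let V2_ge0 : forall x y, 0 <= V2 x y. Proof. exact: kernel_ge0. Qed.

Lemma region_GWP R0 R1 R2 theta : region_GW P3 R0 R1 R2 theta <->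
  [/\ 0 <= theta.1, 0 <= theta.2 & Region PX V1 V2 1 R0 R1 R2 theta.1 theta.2].
Proof.
split=> [[t1 t2 [A0 [A1 [A2 [Q /= [[Q_pmf QP M] [E0 E1 E2 E3 E4]]]]]]]|].
  split => //; apply: Region_mono E0 E1 E2 E3 E4 _.
  have QG (B : finType) (f : X * Y1 * Y2 -> B) :
      law Q (fun s => f s.2) = law P (fun s => f (pX s, pY1 s, pY2 s)).
    apply/funext => b; rewrite -(law_comp P [% pX, pY1, pY2]).
    rewrite -[law P [% pX, pY1, pY2]]/P3 -(funext QP) law_comp.
    by apply: eq_bigl => -[a [[x y1] y2]].
  apply: (@markov_Region _ _ _ Q_pmf _ _ _ _ (Y1 * Y2)%type _ _
    (fun s => s.1.1.1) (fun s => s.1.1.2) (fun s => s.1.2) (fun s => s.2.1.1)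
    [% (fun s => s.2.1.2), (fun s => s.2.2)] fst snd) => //.
  - by move=> x; rewrite (QG _ (fun p => p.1.1)).
  - by move=> x y; rewrite (QG _ (fun p => (p.1.1, p.1.2))) law_kernel.
  - by move=> x y; rewrite (QG _ (fun p => (p.1.1, p.2))) law_kernel.
move=> [t1 t2 H]; split => //.
have [|A0 [A1 [A2 [Q [[Q_pmf QP M] [E0 E1 E2 E3 E4]]]]]] :=
  @Region_markov R _ X Y1 Y2 P3 (fun s => s.1.1) (fun s => s.1.2) (fun s => s.2)
    P3_pmf R0 R1 R2 theta.1 theta.2.
  by rewrite !kernel_law [law P3 _](funext (law_comp P [% pX, pY1, pY2] _)).
exists A0, A1, A2, Q; split; split => //; last exact: (M _ (fun s => (s.1.2, s.2))).
Qed.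

Variables (z1 : Z1) (z2 : Z2).
Hypothesis P_z1 : law P pZ1 z1 = 1.
Hypothesis P_z2 : law P pZ2 z2 = 1.

(** With Z1 and Z2 almost surely constant both members of the maximum are I(U0;X), and the chain
    rule turns the rate constraints into the polyhedron of [Region_time_sharing] with a = I(U0;X)
    and b_i = I(U_i;X|U0). Conversely, the Gray-Wyner constraints add up to these. *)
Lemma inner_region_SIP R0 R1 R2 theta : 0 <= R0 -> 0 <= R1 -> 0 <= R2 ->
  inner_region_SI P R0 R1 R2 theta <->
  [/\ 0 <= theta.1, 0 <= theta.2 & Region PX V1 V2 1 R0 R1 R2 theta.1 theta.2].
Proof.
move=> R0p R1p R2p.
split=> [[t1 t2 [A0 [A1 [A2 [Q /= [[Q_pmf QP M] [E1 E2 E12 T1 T2]]]]]]]|].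
  split => //.
  have QG (B : finType) (f : X * Y1 * Y2 * Z1 * Z2 -> B) :
      law Q (fun s => f s.2) = law P f.
    apply/funext => b; rewrite -(funext QP) law_comp.
    by apply: eq_bigl => -[a [[[[x y1] y2] z1'] z2']].
  have zc1 s : Q s != 0 -> srcZ1 s.2 = z1.
    by apply: (law_const Q_pmf (f := fun s => srcZ1 s.2)); rewrite (QG _ pZ1).
  have zc2 s : Q s != 0 -> srcZ2 s.2 = z2.
    by apply: (law_const Q_pmf (f := fun s => srcZ2 s.2)); rewrite (QG _ pZ2).
  move: E1 E2 E12 T1 T2.
  rewrite !(cond_mutual_info_pair_const Q_pmf _ _ _ zc1).
  rewrite !(cond_mutual_info_pair_const Q_pmf _ _ _ zc2).
  rewrite !(cond_mutual_info_const Q_pmf _ _ zc1).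
  rewrite !(cond_mutual_info_const Q_pmf _ _ zc2) maxxx.
  rewrite !mutual_info_chain// => E1 E2 E12 T1 T2.
  apply: (@Region_mono _ _ _ _ _ _ _ _ R0 R1 R2 _ _ _ _ _ _ _ (lexx _) (lexx _) (lexx _) T1 T2).
  apply: (Region_time_sharing (law_ge0 P_pmf _) V1_ge0 V2_ge0 _ _ _ _ _ _ E1 E2 E12) => //;
    rewrite ?mutual_info_ge0 ?cond_mutual_info_ge0//.
  apply: (@markov_Region _ _ _ Q_pmf _ _ _ _ (Y1 * Y2 * Z1 * Z2)%type _ _
    (fun s => s.1.1.1) (fun s => s.1.1.2) (fun s => s.1.2) (fun s => pX s.2)
    (fun s => [% pY1, pY2, pZ1, pZ2] s.2)
    (fun y => y.1.1.1) (fun y => y.1.1.2)) => //.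
  - by move=> x; rewrite (QG _ pX).
  - by move=> x y; rewrite (QG _ [% pX, pY1]) law_kernel.
  - by move=> x y; rewrite (QG _ [% pX, pY2]) law_kernel.
move=> [t1 t2 H]; split => //.
have [A0 [A1 [A2 [Q [[Q_pmf QP M] [E0 E1 E2 E3 E4]]]]]] := Region_markov P_pmf H.
have QG (B : finType) (f : X * Y1 * Y2 * Z1 * Z2 -> B) b :
    law Q (fun s => f s.2) b = law P f b.
  by rewrite -(funext QP) law_comp.
have zc1 s : Q s != 0 -> srcZ1 s.2 = z1.
  by apply: (law_const Q_pmf (f := fun s => srcZ1 s.2)); rewrite (QG _ pZ1).
have zc2 s : Q s != 0 -> srcZ2 s.2 = z2.
  by apply: (law_const Q_pmf (f := fun s => srcZ2 s.2)); rewrite (QG _ pZ2).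
exists A0, A1, A2, Q => /=; split; split => //.
- exact: (M _ [% pY1, pY2, pZ1, pZ2]).
- rewrite (cond_mutual_info_const Q_pmf _ _ zc1) mutual_info_chain//; lra.
- rewrite (cond_mutual_info_const Q_pmf _ _ zc2) mutual_info_chain//; lra.
- rewrite (cond_mutual_info_pair_const Q_pmf _ _ _ zc1).
  rewrite (cond_mutual_info_pair_const Q_pmf _ _ _ zc2).
  rewrite (cond_mutual_info_const Q_pmf _ _ zc1).
  rewrite (cond_mutual_info_const Q_pmf _ _ zc2) maxxx; lra.
- by rewrite (cond_mutual_info_const Q_pmf _ _ zc1).
- by rewrite (cond_mutual_info_const Q_pmf _ _ zc2).
Qed.

End SingleLetter.

(** * Converse *)

Section Blocks.
Context {R : realType}.

Lemma prod_natr_bool (I : finType) (b : I -> bool) :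
  \prod_i (b i)%:R = [forall i, b i]%:R :> R.
Proof.
case: forallP => [h|h]; first by rewrite big1// => i _; rewrite h.
have /existsP[i /negbTE bi] : [exists i, ~~ b i].
  by apply/existsP; apply: contrapT => h'; apply: h => i; apply: contrapT => bi;
    apply: h'; exists i; apply/negP.
by rewrite (bigD1 i)//= bi mul0r.
Qed.

Lemma eq_ffun_prod (I A : finType) (v w : {ffun I -> A}) :
  (v == w)%:R = \prod_i (v i == w i)%:R :> R.
Proof.
rewrite prod_natr_bool; congr (nat_of_bool _)%:R.
by apply/eqP/forallP => [-> //|h]; apply/ffunP => i; exact/eqP.
Qed.

Definition iid_kernel (X Y : finType) (V : X -> Y -> R) (n : nat)
    (x : {ffun 'I_n -> X}) (y : {ffun 'I_n -> Y}) : R := \prod_i V (x i) (y i).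

Lemma sum_iid (S : finType) (Q : S -> R) n :
  \sum_(w : {ffun 'I_n -> S}) iid Q w = (\sum_s Q s) ^+ n.
Proof.
rewrite -(bigA_distr_bigA (fun (_ : 'I_n) s => Q s)).
by rewrite prodr_const card_ord.
Qed.

Lemma iid_pmf (S : finType) (Q : S -> R) n : is_pmf Q -> is_pmf (@iid R S Q n).
Proof.
move=> [Q0 Q1]; split; first by move=> w; exact: prodr_ge0.
by rewrite sum_iid Q1 expr1n.
Qed.

Lemma sum_iid_kernel (X Y : finType) (V : X -> Y -> R) n (x : {ffun 'I_n -> X}) :
  (forall x, \sum_y V x y = 1) -> \sum_y iid_kernel V x y = 1.
Proof.
move=> V1; rewrite -(bigA_distr_bigA (fun i y => V (x i) y)).
by rewrite big1// => i _.
Qed.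

Lemma iid_kernel_ge0 (X Y : finType) (V : X -> Y -> R) n
    (x : {ffun 'I_n -> X}) y :
  (forall x y, 0 <= V x y) -> 0 <= iid_kernel V x y.
Proof. by move=> V0; exact: prodr_ge0. Qed.

Lemma law_block2 (S A B : finType) (Q : S -> R) (f : S -> A) (g : S -> B) n
    (a : {ffun 'I_n -> A}) (b : {ffun 'I_n -> B}) :
  law (@iid R S Q n) [% block f, block g] (a, b) = \prod_i law Q [% f, g] (a i, b i).
Proof.
under [RHS]eq_bigr do rewrite lawE.
rewrite bigA_distr_bigA lawE; apply: eq_bigr => w _.
rewrite big_split; congr (_ * _); rewrite xpair_eqE -mulnb natrM.
rewrite !eq_ffun_prod -big_split; apply: eq_bigr => i _.
by rewrite !ffunE xpair_eqE -mulnb natrM.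
Qed.

Definition ffun_cons (S : finType) n (p : S * {ffun 'I_n -> S}) :
    {ffun 'I_n.+1 -> S} :=
  [ffun i => if unlift ord0 i is Some j then p.2 j else p.1].

Lemma ffun_cons_bij (S : finType) n : bijective (@ffun_cons S n).
Proof.
exists (fun w : {ffun 'I_n.+1 -> S} => (w ord0, [ffun j => w (lift ord0 j)])).
  move=> [s w]; congr (_, _); rewrite ?ffunE ?unlift_none//.
  by apply/ffunP => j; rewrite !ffunE liftK.
by move=> w; apply/ffunP => i; rewrite !ffunE/=; case: unliftP => [j|] ->; rewrite ?ffunE.
Qed.

Lemma iid_cons (S : finType) (Q : S -> R) n p :
  iid Q (@ffun_cons S n p) = Q p.1 * iid Q p.2.
Proof.
rewrite /iid big_ord_recl ffunE unlift_none; congr (_ * _).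
by apply: eq_bigr => i _; rewrite ffunE liftK.
Qed.

Lemma iid_kernel_cons (X Y : finType) (V : X -> Y -> R) n p q :
  iid_kernel V (@ffun_cons X n p) (@ffun_cons Y n q) =
  V p.1 q.1 * iid_kernel V p.2 q.2.
Proof.
rewrite /iid_kernel big_ord_recl !ffunE unlift_none; congr (_ * _).
by apply: eq_bigr => i _; rewrite !ffunE liftK.
Qed.

End Blocks.

(** * Single-letterisation *)

Section Tensorization.
Context {R : realType}.

Lemma Region_reindex (X X' Y1 Y1' Y2 Y2' : finType) (PX : X -> R)
    (V1 : X -> Y1 -> R) (V2 : X -> Y2 -> R) (s : X' -> X) (s1 : Y1' -> Y1)
    (s2 : Y2' -> Y2) c r0 r1 r2 t1 t2 :
  bijective s -> bijective s1 -> bijective s2 ->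
  Region PX V1 V2 c r0 r1 r2 t1 t2 ->
  Region (PX \o s) (fun x y => V1 (s x) (s1 y)) (fun x y => V2 (s x) (s2 y))
    c r0 r1 r2 t1 t2.
Proof.
move=> bs bs1 bs2 [A0 [A1 [A2 [w0 [w1 [w2 [[w1p w2p e1 e2 e0] [E0 E1 E2 E3 E4]]]]]]]].
have pushE (Y Y' : finType) (V : X -> Y -> R) (s' : Y' -> Y) (m : X -> R) :
    push (fun x y => V (s x) (s' y)) (m \o s) = push V m \o s'.
  by apply/funext => y; rewrite /push /= [RHS](reindex s)//; exact: onW_bij.
exists A0, A1, A2, (fun a => w0 a \o s), (fun a b => w1 a b \o s),
  (fun a b => w2 a b \o s); split; split.
- by move=> *; exact: w1p.
- by move=> *; exact: w2p.
- move=> a x; exact: e1.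
- move=> a x; exact: e2.
- move=> x; exact: e0.
- rewrite (entropy_reindex _ bs).
  by under [X in _ <= _ + X]eq_bigr do rewrite (entropy_reindex _ bs).
- under [X in X <= _]eq_bigr do rewrite (entropy_reindex _ bs).
  by under [X in _ <= _ + X]eq_bigr do under eq_bigr do rewrite (entropy_reindex _ bs).
- under [X in X <= _]eq_bigr do rewrite (entropy_reindex _ bs).
  by under [X in _ <= _ + X]eq_bigr do under eq_bigr do rewrite (entropy_reindex _ bs).
- rewrite pushE (entropy_reindex _ bs1).
  by under eq_bigr do under eq_bigr do rewrite pushE (entropy_reindex _ bs1).
- rewrite pushE (entropy_reindex _ bs2).
  by under eq_bigr do under eq_bigr do rewrite pushE (entropy_reindex _ bs2).
Qed.

Lemma entropy_product (T T' : finType) (m : T -> R) (m' : T' -> R) :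
  is_pmf m -> is_pmf m' ->
  entropy (fun p => m p.1 * m' p.2) = entropy m + entropy m'.
Proof.
move=> [m0 m1] [m'0 m'1]; rewrite (entropy_chain (fun t t' => m t * m' t')).
congr (_ + _); first by apply: eq_entropy => t; rewrite -mulr_sumr m'1 mulr1.
by under eq_bigr do rewrite entropyZ//; rewrite -mulr_suml m1 mul1r.
Qed.

Lemma push_pmf (X Y : finType) (V : X -> Y -> R) (P : X -> R) :
  is_pmf P -> (forall x, is_pmf (V x)) -> is_pmf (push V P).
Proof.
move=> [P0 P1] V1; split.
  by move=> y; apply: push_ge0 => // x z; have [] := V1 x.
rewrite exchange_big/= -[RHS]P1; apply: eq_bigr => x _.
by have [_ h] := V1 x; rewrite -mulr_sumr h mulr1.
Qed.

(* conditioning on the first source letter rather than on the first output *)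
Lemma entropy_push_split (X X' Y Y' : finType) (V : X -> Y -> R)
    (V' : X' -> Y' -> R) (m : X * X' -> R) :
  (forall x, is_pmf (V x)) -> (forall x, is_pmf (V' x)) ->
  (forall p, 0 <= m p) ->
  entropy (push V (fun x => \sum_x' m (x, x'))) +
    \sum_x entropy (push V' (fun x' => m (x, x'))) <=
  entropy (push (fun p q => V p.1 q.1 * V' p.2 q.2) m).
Proof.
move=> V1 V'1 m0; pose M x := push V' (fun x' => m (x, x')).
have M0 x y : 0 <= M x y by apply: push_ge0 => // x' ?; case: (V'1 x').
have V0 x y : 0 <= V x y by case: (V1 x).
have E : push (fun p q => V p.1 q.1 * V' p.2 q.2) m =
    fun q => \sum_x V x q.1 * M x q.2.
  apply/funext => q; rewrite /push sum_pair/=.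
  apply: eq_bigr => x _; rewrite mulr_sumr; apply: eq_bigr => x' _; ring.
rewrite E (entropy_chain (fun y y' => \sum_x V x y * M x y')) lerD//.
  rewrite le_eqVlt; apply/orP; left; apply/eqP/eq_entropy => y.
  rewrite exchange_big/=; apply: eq_bigr => x _; rewrite -mulr_sumr mulrC.
  congr (_ * _); rewrite exchange_big/=; apply: eq_bigr => x' _.
  by have [_ h] := V'1 x'; rewrite -mulr_sumr h mulr1.
(* Given the first output y, the law of the second is a mixture over x of the laws [M x]; concavity
   gives H(Y' | Y) >= H(Y' | X). *)
apply: (@le_trans _ _ (\sum_y \sum_x V x y * entropy (M x))).
  rewrite exchange_big/= le_eqVlt; apply/orP; left; apply/eqP.
  by apply: eq_bigr => x _; have [_ h] := V1 x; rewrite -mulr_suml h mul1r.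
apply: ler_sum => y _; under eq_bigr do rewrite -entropyZ//.
by apply: entropy_superadd => x y'; exact: mulr_ge0.
Qed.

(** The first factor keeps the descriptions; for the second, the first letter joins U0, whence the
    alphabet [A0 * X]. By the chain rule and independence of the two letters the rates add exactly,
    while the exponents add up to an inequality, [CY]. The witnesses are the exact informations of
    the two factors. *)
Lemma Region_split (X X' Y1 Y1' Y2 Y2' : finType) (P : X -> R) (P' : X' -> R)
    (V1 : X -> Y1 -> R) (V1' : X' -> Y1' -> R) (V2 : X -> Y2 -> R)
    (V2' : X' -> Y2' -> R) c r0 r1 r2 t1 t2 :
  is_pmf P -> is_pmf P' ->
  (forall x, is_pmf (V1 x)) -> (forall x, is_pmf (V1' x)) ->
  (forall x, is_pmf (V2 x)) -> (forall x, is_pmf (V2' x)) -> 0 <= c ->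
  Region (fun p => P p.1 * P' p.2) (fun p q => V1 p.1 q.1 * V1' p.2 q.2)
    (fun p q => V2 p.1 q.1 * V2' p.2 q.2) c r0 r1 r2 t1 t2 ->
  exists a0 a1 a2 b1 b2 a0' a1' a2' b1' b2', [/\
    Region P V1 V2 c a0 a1 a2 b1 b2,
    Region P' V1' V2' c a0' a1' a2' b1' b2',
    [/\ a0 + a0' <= r0, a1 + a1' <= r1 & a2 + a2' <= r2] &
    t1 <= b1 + b1' /\ t2 <= b2 + b2'].
Proof.
move=> Pp P'p V1p V1'p V2p V2'p c0.
move=> [A0 [A1 [A2 [w0 [w1 [w2 [[w1p w2p s1 s2 s0] [E0 E1 E2 E3 E4]]]]]]]].
have w0p a0 x : 0 <= w0 a0 x by rewrite -s1; exact: sumr_ge0.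
have [[P0 P1] [P'0 P'1]] := (Pp, P'p).
pose u0 a x := \sum_x' w0 a (x, x').
pose u1 a b x := \sum_x' w1 a b (x, x').
pose u2 a b x := \sum_x' w2 a b (x, x').
pose v0 (p : A0 * X) x' := w0 p.1 (p.2, x').
pose v1 (p : A0 * X) b x' := w1 p.1 b (p.2, x').
pose v2 (p : A0 * X) b x' := w2 p.1 b (p.2, x').
have chain (m : X * X' -> R) : entropy m =
    entropy (fun x => \sum_x' m (x, x')) + \sum_x entropy (fun x' => m (x, x')).
  by rewrite -entropy_chain; apply: eq_entropy => -[].
have C0 : \sum_a entropy (w0 a) = \sum_a entropy (u0 a) + \sum_p entropy (v0 p).
  rewrite -(pair_bigA _ (fun a x => entropy (fun x' => w0 a (x, x')))) -big_split.
  by apply: eq_bigr => a _; exact: chain.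
have C (A : finType) (w : A0 -> A -> X * X' -> R) :
    \sum_a \sum_b entropy (w a b) =
    \sum_a \sum_b entropy (fun x => \sum_x' w a b (x, x')) +
    \sum_(p : A0 * X) \sum_b entropy (fun x' => w p.1 b (p.2, x')).
  rewrite -(pair_bigA _ (fun a x => \sum_b entropy (fun x' => w a b (x, x')))).
  rewrite -big_split; apply: eq_bigr => a _; rewrite exchange_big -big_split.
  by apply: eq_bigr => b _; exact: chain.
have CY (A Y Y' : finType) (V : X -> Y -> R) (V' : X' -> Y' -> R)
    (w : A0 -> A -> X * X' -> R) :
    (forall x, is_pmf (V x)) -> (forall x, is_pmf (V' x)) ->
    (forall a b p, 0 <= w a b p) ->
    \sum_a \sum_b entropy (push V (fun x => \sum_x' w a b (x, x'))) +
    \sum_(p : A0 * X) \sum_b entropy (push V' (fun x' => w p.1 b (p.2, x'))) <=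
    \sum_a \sum_b entropy (push (fun p q => V p.1 q.1 * V' p.2 q.2) (w a b)).
  move=> Vp V'p wp.
  rewrite -(pair_bigA _ (fun a x => \sum_b entropy (push V' (fun x' => w a b (x, x'))))).
  rewrite -big_split; apply: ler_sum => a _; rewrite exchange_big -big_split.
  by apply: ler_sum => b _; exact: entropy_push_split.
have pushP (Y Y' : finType) (V : X -> Y -> R) (V' : X' -> Y' -> R) :
    (forall x, is_pmf (V x)) -> (forall x, is_pmf (V' x)) ->
    entropy (push (fun p q => V p.1 q.1 * V' p.2 q.2) (fun p => P p.1 * P' p.2)) =
    entropy (push V P) + entropy (push V' P').
  move=> Vp V'p; rewrite -entropy_product; [|exact: push_pmf|exact: push_pmf].
  apply: eq_entropy => q; rewrite /push mulr_suml.
  rewrite -(pair_bigA _ (fun x x' => P x * P' x' * (V x q.1 * V' x' q.2)))/=.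
  apply: eq_bigr => x _; rewrite mulr_sumr; apply: eq_bigr => x' _; ring.
exists (c * entropy P - \sum_a entropy (u0 a)),
  (\sum_a entropy (u0 a) - \sum_a \sum_b entropy (u1 a b)),
  (\sum_a entropy (u0 a) - \sum_a \sum_b entropy (u2 a b)),
  (c * entropy (push V1 P) - \sum_a \sum_b entropy (push V1 (u1 a b))),
  (c * entropy (push V2 P) - \sum_a \sum_b entropy (push V2 (u2 a b))),
  (c * entropy P' - \sum_a entropy (v0 a)),
  (\sum_a entropy (v0 a) - \sum_a \sum_b entropy (v1 a b)),
  (\sum_a entropy (v0 a) - \sum_a \sum_b entropy (v2 a b)),
  (c * entropy (push V1' P') - \sum_a \sum_b entropy (push V1' (v1 a b))),
  (c * entropy (push V2' P') - \sum_a \sum_b entropy (push V2' (v2 a b))).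
move: E0 E1 E2 E3 E4.
rewrite entropy_product// !pushP// C0 (C _ w1) (C _ w2) => E0 E1 E2 E3 E4.
have F3 := CY _ _ _ V1 V1' w1 V1p V1'p w1p.
have F4 := CY _ _ _ V2 V2' w2 V2p V2'p w2p.
rewrite -[X in _ <= _ + X]/(\sum_a \sum_b entropy (u1 a b) +
  \sum_p \sum_b entropy (v1 p b)) in E1.
rewrite -[X in _ <= _ + X]/(\sum_a \sum_b entropy (u2 a b) +
  \sum_p \sum_b entropy (v2 p b)) in E2.
rewrite -[X in X <= _]/(\sum_a \sum_b entropy (push V1 (u1 a b)) +
  \sum_p \sum_b entropy (push V1' (v1 p b))) in F3.
rewrite -[X in X <= _]/(\sum_a \sum_b entropy (push V2 (u2 a b)) +
  \sum_p \sum_b entropy (push V2' (v2 p b))) in F4.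
split; [| |by split; lra|by split; lra].
  exists A0, A1, A2, u0, u1, u2; split; split; rewrite ?subrK//.
  - by move=> *; exact: sumr_ge0.
  - by move=> *; exact: sumr_ge0.
  - by move=> a x; rewrite exchange_big; apply: eq_bigr => x' _; rewrite s1.
  - by move=> a x; rewrite exchange_big; apply: eq_bigr => x' _; rewrite s2.
  - move=> x; rewrite exchange_big; under eq_bigr do rewrite s0/=.
    by rewrite -mulr_sumr -mulr_sumr P'1 mulr1.
exists (A0 * X)%type, A1, A2, v0, v1, v2; split; split; rewrite ?subrK//.
- by move=> *; exact: w1p.
- by move=> *; exact: w2p.
- by move=> a x; exact: s1.
- by move=> a x; exact: s2.
- move=> x'; rewrite -(pair_bigA _ (fun a x => w0 a (x, x')))/= exchange_big/=.
  by under eq_bigr do rewrite s0/=; rewrite -mulr_sumr -mulr_suml P1 mul1r.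
Qed.

Lemma entropy_point (T : finType) (m : T -> R) : #|T| = 1%N -> entropy m = 0.
Proof.
move=> /eqP/fintype1P[t tE]; have E (F : T -> R) : \sum_t F t = F t.
  by rewrite (bigD1 t)//= big1 ?addr0// => s; rewrite (tE s) eqxx.
by rewrite /entropy !E subrr.
Qed.

(** The single-letter points split off one by one are added up, so the scale grows to [n%:R * c].
    The induction starts at blocks of length 0, a one-point space where every entropy is 0. *)
Lemma Region_single_letter (X Y1 Y2 : finType) (P : X -> R) (V1 : X -> Y1 -> R)
    (V2 : X -> Y2 -> R) n c r0 r1 r2 t1 t2 :
  is_pmf P -> (forall x, is_pmf (V1 x)) -> (forall x, is_pmf (V2 x)) -> 0 <= c ->
  Region (@iid R X P n) (@iid_kernel R X Y1 V1 n) (@iid_kernel R X Y2 V2 n)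
    c r0 r1 r2 t1 t2 ->
  Region P V1 V2 (n%:R * c) r0 r1 r2 t1 t2.
Proof.
move=> Pp V1p V2p c0.
have V1_ge0 x y : 0 <= V1 x y by case: (V1p x).
have V2_ge0 x y : 0 <= V2 x y by case: (V2p x).
have kp (Y : finType) (V : X -> Y -> R) k (x : {ffun 'I_k -> X}) :
    (forall x, is_pmf (V x)) -> is_pmf (iid_kernel V x).
  move=> Vp; split; last by apply: sum_iid_kernel => x'; case: (Vp x').
  by move=> y; apply: iid_kernel_ge0 => x' y'; case: (Vp x').
elim: n r0 r1 r2 t1 t2 => [|n IH] r0 r1 r2 t1 t2 H.
  have card0 (T : finType) : #|{: {ffun 'I_0 -> T}}| = 1%N.
    by rewrite card_ffun card_ord expn0.
  case: H => [A0 [A1 [A2 [w0 [w1 [w2 [_ [E0 E1 E2 E3 E4]]]]]]]].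
  have Z (T : finType) (m : {ffun 'I_0 -> T} -> R) : entropy m = 0.
    exact: entropy_point.
  have S1 (A T : finType) (m : A -> {ffun 'I_0 -> T} -> R) :
    \sum_a entropy (m a) = 0 by rewrite big1.
  have S2 (A B T : finType) (m : A -> B -> {ffun 'I_0 -> T} -> R) :
    \sum_a \sum_b entropy (m a b) = 0 by rewrite big1// => a _; rewrite big1.
  move: E0 E1 E2 E3 E4; rewrite !S1 !S2 !Z !mulr0 !addr0 => E0 E1 E2 E3 E4.
  rewrite mul0r; apply: Region_mono E0 E1 E2 E3 E4 _.
  have := Region_scale V1_ge0 V2_ge0 (lexx 0) (Region_trivial V1 V2 Pp.1).
  by rewrite !mul0r.
have := Region_reindex (ffun_cons_bij X n) (ffun_cons_bij Y1 n) (ffun_cons_bij Y2 n) H.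
rewrite (_ : @iid R X P n.+1 \o _ = fun p => P p.1 * iid P p.2); last first.
  by apply/funext => p; rewrite /= iid_cons.
rewrite (_ : (fun x y => iid_kernel V1 _ _) =
  fun p q => V1 p.1 q.1 * iid_kernel V1 p.2 q.2); last first.
  by apply/funext => p; apply/funext => q; rewrite iid_kernel_cons.
rewrite (_ : (fun x y => iid_kernel V2 _ _) =
  fun p q => V2 p.1 q.1 * iid_kernel V2 p.2 q.2); last first.
  by apply/funext => p; apply/funext => q; rewrite iid_kernel_cons.
move=> /Region_split[] // => [|x|x|]; [exact: iid_pmf|exact: kp|exact: kp|].
move=> a0 [a1 [a2 [b1 [b2 [a0' [a1' [a2' [b1' [b2']]]]]]]]].
move=> [H1 /IH H2 [h0 h1 h2] [h3 h4]].
rewrite -natr1 mulrDl mul1r addrC.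
exact: Region_mono h0 h1 h2 h3 h4 (Region_add H1 H2).
Qed.

End Tensorization.

(** * From error probabilities and message counts to informations *)

Section TestingBound.
Context {R : realType}.

(* Donsker-Varadhan with the test function k 1_A *)
Lemma mutual_info_test (I Y : finType) (J : I -> Y -> R) (A : I -> Y -> bool) (k : R) :
  (forall i y, 0 <= J i y) -> \sum_i \sum_y J i y = 1 ->
  \sum_i \sum_y (\sum_y' J i y') * (\sum_i' J i' y) * (A i y)%:R <= 2 `^ (- k) ->
  (\sum_i \sum_y J i y * (A i y)%:R) * k - 1 + \sum_i entropy (J i) <=
  entropy (fun y => \sum_i J i y).
Proof.
move=> J0 J1 Hk; rewrite addrC -lerBrDl entropy_gapE.
have lnp := @ln2_gt0 R.
set p := fun i => \sum_y J i y; set q := fun y => \sum_i J i y.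
have p0 i : 0 <= p i by exact: sumr_ge0.
have q0 y : 0 <= q y by exact: sumr_ge0.
(* The output law tilted by 2 to the power k on the test set. Against [p] its mass before halving is
   at most 1 off the set and, by [Hk], at most 1 on it; dividing by 2 makes the total at most 1 and
   costs the 1 in the statement. *)
pose b i y := q y * (2 `^ (k * (A i y)%:R) / 2).
have b0 i y : 0 <= b i y by rewrite mulr_ge0// divr_ge0// powR_ge0.
have q1 : \sum_y q y = 1 by rewrite exchange_big.
have half : 2 `^ (-1) = 2^-1 :> R by rewrite powR_inv1.
have logb i y : 0 < q y -> log2 (b i y) = log2 (q y) + k * (A i y)%:R - 1.
  move=> qy; rewrite log2M// ?divr_gt0 ?powR_gt0//.
  by rewrite -half -powR2D log2_powR addrA.
have term i y : (J i y - p i * b i y / 1) / ln 2 <=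
    J i y * (log2 (J i y) + log2 1 - log2 (p i) - log2 (q y)) -
    J i y * (A i y)%:R * k + J i y.
  have H : 0 < J i y -> [/\ 0 < p i, 0 < b i y & 0 < 1 :> R].
    move=> Jp; split => //; first exact: sum_gt0 Jp.
    apply: mulr_gt0; first exact: (@sum_gt0 _ _ (J^~ y) i).
    by rewrite divr_gt0// powR_gt0.
  apply: le_trans (log_sum_term (J0 i y) (p0 i) (b0 i y) ler01 H) _.
  rewrite le_eqVlt; apply/orP; left; apply/eqP.
  have [->|JN0] := eqVneq (J i y) 0; first by rewrite !mul0r; ring.
  have Jp : 0 < J i y by rewrite lt_neqAle eq_sym JN0 J0.
  rewrite logb; last exact: (@sum_gt0 _ _ (J^~ y) i).
  by rewrite log2_1; ring.
have pb : \sum_i \sum_y p i * b i y <= 1.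
  have pt i y : p i * b i y <=
      2^-1 * (p i * q y) + 2^-1 * 2 `^ k * (p i * q y * (A i y)%:R).
    rewrite /b; case: (A i y); rewrite ?mulr1 ?mulr0 ?powRr0 ?addr0.
      have := mulr_ge0 (p0 i) (q0 y).
      have -> : p i * (q y * (2 `^ k / 2)) = 2^-1 * 2 `^ k * (p i * q y) by ring.
      by move=> h; rewrite lerDr mulr_ge0.
    by rewrite le_eqVlt; apply/orP; left; apply/eqP; field.
  apply: le_trans (ler_sum _ (fun i _ => ler_sum _ (fun y _ => pt i y))) _.
  under eq_bigr do rewrite big_split/= -!mulr_sumr.
  rewrite big_split/= -!mulr_sumr.
  have -> : \sum_i p i * \sum_y q y = 1 by rewrite q1 -mulr_suml mulr1.
  have h := Hk; rewrite -(ler_pM2l (powR_gt0 k (ltr0Sn R 1))) -powR2D subrr powRr0 in h.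
  apply: (@le_trans _ _ (2^-1 * 1 + 2^-1 * 1)); last by lra.
  rewrite lerD2l -mulrA ler_pM2l ?invr_gt0 ?ltr0n//.
have S := ler_sum _ (fun i (_ : true) => ler_sum _ (fun y (_ : true) => term i y)).
have {S} := S (index_enum I) (index_enum Y).
have -> : \sum_i \sum_y (J i y - p i * b i y / 1) / ln 2 =
    (1 - \sum_i \sum_y p i * b i y) / ln 2.
  rewrite -[X in _ = (X - _) / _]J1 -sumrB mulr_suml; apply: eq_bigr => i _.
  by rewrite -sumrB mulr_suml; apply: eq_bigr => y _; rewrite divr1.
rewrite J1.
have -> : \sum_i \sum_y (J i y * (log2 (J i y) + log2 1 - log2 (p i) - log2 (q y)) -
    J i y * (A i y)%:R * k + J i y) =
    \sum_i \sum_y J i y * (log2 (J i y) + log2 1 - log2 (p i) - log2 (q y)) -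
    (\sum_i \sum_y J i y * (A i y)%:R) * k + 1.
  rewrite -[X in _ = _ + X]J1 mulr_suml -sumrB -big_split; apply: eq_bigr => i _.
  by rewrite mulr_suml -sumrB -big_split.
have : 0 <= (1 - \sum_i \sum_y p i * b i y) / ln 2.
  by rewrite divr_ge0// ?subr_ge0// ltW.
move=> h1 h2; have h := le_trans h1 h2.
rewrite -subr_ge0; apply: le_trans h _.
by rewrite le_eqVlt; apply/orP; left; apply/eqP; ring.
Qed.

(** Counting 0 as well, there is at most one message more than 2 to the n r. As that power is at
    least 1, this is at most a factor 2, hence one bit. *)
Lemma card_msg (r : R) n : 0 <= r -> log2 #|msg r n|%:R <= n%:R * r + 1.
Proof.
move=> r0; rewrite card_ord -[leRHS]log2_powR.
have p1 : 1 <= 2 `^ (n%:R * r) :> R.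
  by rewrite -[X in X <= _](powRr0 2) ler_powR ?mulr_ge0 ?ler1n.
apply: ler_log2; first by rewrite ltr0n.
rewrite powR2D powRr1// mulr_natr mulr2n -natr1 lerD//.
by have := @truncn_le _ (2 `^ (n%:R * r)); rewrite powR_ge0.
Qed.

End TestingBound.

(** * Decision probabilities of a code *)

Section CodeLaws.
Context {R : realType} (X Y1 Y2 Z1 Z2 : finType).
Notation source := (X * Y1 * Y2 * Z1 * Z2)%type.
Notation pX := (@srcX X Y1 Y2 Z1 Z2).
Notation pY1 := (@srcY1 X Y1 Y2 Z1 Z2).
Notation pY2 := (@srcY2 X Y1 Y2 Z1 Z2).
Notation pZ1 := (@srcZ1 X Y1 Y2 Z1 Z2).
Notation pZ2 := (@srcZ2 X Y1 Y2 Z1 Z2).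

Lemma iid_neq0 (S : finType) (Q : S -> R) n (w : {ffun 'I_n -> S}) i :
  iid Q w != 0 -> Q (w i) != 0.
Proof. by apply: contraNneq => h; rewrite /iid (bigD1 i)//= h mul0r. Qed.

(** The constancy of Z on the support of [Q] freezes the side information in the decision, and what
    is left sees only the source and output words. Leaving [Q] arbitrary serves both hypotheses and
    both receivers. *)
Lemma sum_iid_block (Y Z M : finType) (Q : source -> R) (pY : source -> Y)
    (pZ : source -> Z) (z : Z) (PX : X -> R) (V : X -> Y -> R) n
    (e : {ffun 'I_n -> X} -> M -> R)
    (g : {ffun 'I_n -> Y} -> {ffun 'I_n -> Z} -> M -> R) :
  (forall s, Q s != 0 -> pZ s = z) ->
  (forall x y, law Q [% pX, pY] (x, y) = PX x * V x y) ->
  \sum_(w : {ffun 'I_n -> source}) \sum_m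
    iid Q w * e (block pX w) m * g (block pY w) (block pZ w) m =
  \sum_x \sum_m \sum_y iid PX x * e x m * iid_kernel V x y * g y [ffun=> z] m.
Proof.
move=> Qz QV.
transitivity (\sum_(w : {ffun 'I_n -> source}) iid Q w *
    (\sum_m e (block pX w) m * g (block pY w) [ffun=> z] m)).
  apply: eq_bigr => w _; rewrite mulr_sumr; apply: eq_bigr => m _.
  have [->|wN0] := eqVneq (iid Q w) 0; first by rewrite !mul0r.
  rewrite mulrA; congr (_ * g _ _ _).
  by apply/ffunP => i; rewrite !ffunE Qz//; exact: iid_neq0 wN0.
rewrite -(sum_law _ [% block pX, block pY]
  (fun p => \sum_m e p.1 m * g p.2 [ffun=> z] m)) sum_pair.
apply: eq_bigr => x _; rewrite exchange_big; apply: eq_bigr => y _.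
rewrite law_block2 mulr_sumr; apply: eq_bigr => m _.
by under eq_bigr do rewrite QV; rewrite big_split/= -/(iid PX x) -/(iid_kernel V x y); ring.
Qed.

Lemma decide_prob1E (Q : source -> R) (z : Z1) (PX : X -> R) (V : X -> Y1 -> R)
    R0 R1 R2 n (c : Defs.code X Y1 Y2 Z1 Z2 R0 R1 R2 n) d :
  (forall s, Q s != 0 -> pZ1 s = z) ->
  (forall x y, law Q [% pX, pY1] (x, y) = PX x * V x y) ->
  decide_prob1 Q c d = \sum_x \sum_m \sum_y
    iid PX x * enc c x m * iid_kernel V x y *
    (dec1 c y [ffun=> z] m.1.1 m.1.2 == d)%:R.
Proof.
move=> Qz QV; exact: (sum_iid_block (enc c)
  (fun y zz m => (dec1 c y zz m.1.1 m.1.2 == d)%:R) Qz QV).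
Qed.

Lemma decide_prob2E (Q : source -> R) (z : Z2) (PX : X -> R) (V : X -> Y2 -> R)
    R0 R1 R2 n (c : Defs.code X Y1 Y2 Z1 Z2 R0 R1 R2 n) d :
  (forall s, Q s != 0 -> pZ2 s = z) ->
  (forall x y, law Q [% pX, pY2] (x, y) = PX x * V x y) ->
  decide_prob2 Q c d = \sum_x \sum_m \sum_y
    iid PX x * enc c x m * iid_kernel V x y *
    (dec2 c y [ffun=> z] m.1.1 m.2 == d)%:R.
Proof.
move=> Qz QV; exact: (sum_iid_block (enc c)
  (fun y zz m => (dec2 c y zz m.1.1 m.2 == d)%:R) Qz QV).
Qed.

End CodeLaws.

(** * The region of a single code *)

Section CodeRegion.
Context {R : realType}.

(** The testing bound for a received message i with joint mass [W i x], compared with the law under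
    which message and output are independent. *)
Lemma push_test (I X Y : finType) (P : X -> R) (V : X -> Y -> R)
    (W : I -> X -> R) (A : I -> Y -> bool) k :
  is_pmf P -> (forall x, is_pmf (V x)) ->
  (forall i x, 0 <= W i x) -> (forall x, \sum_i W i x = P x) ->
  \sum_i \sum_y (\sum_x W i x) * push V P y * (A i y)%:R <= 2 `^ (- k) ->
  (\sum_i \sum_y push V (W i) y * (A i y)%:R) * k - 1 +
    \sum_i entropy (push V (W i)) <= entropy (push V P).
Proof.
move=> Pp Vp W0 WP Hk.
have mass i : \sum_y push V (W i) y = \sum_x W i x.
  rewrite exchange_big; apply: eq_bigr => x _.
  by have [_ h] := Vp x; rewrite -mulr_sumr h mulr1.
have col : (fun y => \sum_i push V (W i) y) = push V P.
  by apply/funext => y; rewrite push_sum; apply: eq_bigr => x _; rewrite WP.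
rewrite -[in leRHS]col; apply: mutual_info_test.
- by move=> i y; apply: push_ge0 => // x z; case: (Vp x).
- under eq_bigr do rewrite mass.
  by rewrite exchange_big -[RHS](proj2 Pp); apply: eq_bigr => x _; rewrite WP.
- apply: le_trans Hk; rewrite le_eqVlt; apply/orP; left; apply/eqP.
  apply: eq_bigr => i _; apply: eq_bigr => y _.
  by rewrite mass -[push V P]col.
Qed.

Lemma push_iid (X Y : finType) (V : X -> Y -> R) (P : X -> R) n y :
  push (@iid_kernel R X Y V n) (@iid R X P n) y = iid (push V P) y.
Proof.
rewrite /push /iid [RHS]bigA_distr_bigA; apply: eq_bigr => x _.
by rewrite -big_split.
Qed.

Context (X Y1 Y2 Z1 Z2 : finType).
Notation source := (X * Y1 * Y2 * Z1 * Z2)%type.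
Notation pX := (@srcX X Y1 Y2 Z1 Z2).
Notation pY1 := (@srcY1 X Y1 Y2 Z1 Z2).
Notation pY2 := (@srcY2 X Y1 Y2 Z1 Z2).
Notation pZ1 := (@srcZ1 X Y1 Y2 Z1 Z2).
Notation pZ2 := (@srcZ2 X Y1 Y2 Z1 Z2).
Variables (P : source -> R) (z1 : Z1) (z2 : Z2).
Hypothesis P_pmf : is_pmf P.
Hypothesis P_z1 : law P pZ1 z1 = 1.
Hypothesis P_z2 : law P pZ2 z2 = 1.
Let PX := law P pX.
Let V1 := kernel P pX pY1.
Let V2 := kernel P pX pY2.

Let zc1 : forall s, P s != 0 -> pZ1 s = z1. Proof. exact: law_const. Qed.
Let zc2 : forall s, P s != 0 -> pZ2 s = z2. Proof. exact: law_const. Qed.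

(** With constant side information the alternative hypothesis is full independence, so each receiver
    tests against independence of Y_i from X. *)
Lemma alt_lawE s : alt_law P s = PX (srcX s) * law P pY1 (srcY1 s) *
  law P pY2 (srcY2 s) * ((srcZ1 s == z1)%:R * (srcZ2 s == z2)%:R).
Proof.
have E0 : law P [% pX, pZ1, pZ2] (srcX s, srcZ1 s, srcZ2 s) =
    if srcZ2 s == z2 then if srcZ1 s == z1 then PX (srcX s) else 0 else 0.
  by rewrite (law_pair_const _ _ _ zc2) (law_pair_const _ _ _ zc1).
have E1 : law P [% pY1, pZ1] (srcY1 s, srcZ1 s) =
    if srcZ1 s == z1 then law P pY1 (srcY1 s) else 0.
  exact: (law_pair_const _ _ _ zc1).
have E2 : law P [% pY2, pZ2] (srcY2 s, srcZ2 s) =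
    if srcZ2 s == z2 then law P pY2 (srcY2 s) else 0.
  exact: (law_pair_const _ _ _ zc2).
rewrite /alt_law /cond E0 E1 E2.
case: eqP => [->|_]; case: eqP => [->|_]; rewrite ?mul0r ?mulr0 ?mul1r ?mulr1//.
by rewrite P_z1 P_z2 !divr1.
Qed.

Lemma alt_law_z1 s : alt_law P s != 0 -> srcZ1 s = z1.
Proof. by rewrite alt_lawE; have [//|_] := eqVneq (srcZ1 s) z1; rewrite mul0r mulr0 eqxx. Qed.

Lemma alt_law_z2 s : alt_law P s != 0 -> srcZ2 s = z2.
Proof.
by rewrite alt_lawE; have [//|_] := eqVneq (srcZ2 s) z2; rewrite !mulr0 eqxx.
Qed.

Let sum_alt_law (F : X -> Y1 -> Y2 -> R) :
  \sum_s alt_law P s * F (srcX s) (srcY1 s) (srcY2 s) =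
  \sum_x \sum_y1 \sum_y2 PX x * law P pY1 y1 * law P pY2 y2 * F x y1 y2.
Proof.
rewrite 4!sum_pair; apply: eq_bigr => x _; apply: eq_bigr => y1 _.
apply: eq_bigr => y2 _.
rewrite (bigD1 z1)//= [X in _ + X]big1 ?addr0; last first.
  move=> a /negbTE az; rewrite big1// => b _.
  by rewrite alt_lawE /= /srcZ1 /= az mul0r mulr0 mul0r.
rewrite (bigD1 z2)//= big1 ?addr0; last first.
  move=> b /negbTE bz.
  by rewrite alt_lawE /= /srcZ2 /= bz !mulr0 mul0r.
by rewrite alt_lawE /srcX /srcY1 /srcY2 /srcZ1 /srcZ2 /= !eqxx !mulr1.
Qed.

Lemma law_alt1 x y : law (alt_law P) [% pX, pY1] (x, y) = PX x * law P pY1 y.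
Proof.
rewrite lawE (sum_alt_law (fun a b _ => ((a, b) == (x, y))%:R)).
rewrite (bigD1 x)//= [X in _ + X]big1 ?addr0; last first.
  move=> a /negbTE ax; rewrite big1// => b _; rewrite big1// => d _.
  by rewrite xpair_eqE ax mulr0.
rewrite (bigD1 y)//= [X in _ + X]big1 ?addr0; last first.
  by move=> b /negbTE bx; rewrite big1// => d _; rewrite xpair_eqE bx andbF mulr0.
under eq_bigr do rewrite eqxx mulr1.
by rewrite -mulr_sumr sum_law1 (proj2 P_pmf) mulr1.
Qed.

Lemma law_alt2 x y : law (alt_law P) [% pX, pY2] (x, y) = PX x * law P pY2 y.
Proof.
rewrite lawE (sum_alt_law (fun a _ b => ((a, b) == (x, y))%:R)).
rewrite (bigD1 x)//= [X in _ + X]big1 ?addr0; last first.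
  move=> a /negbTE ax; rewrite big1// => b _; rewrite big1// => d _.
  by rewrite xpair_eqE ax mulr0.
rewrite exchange_big (bigD1 y)//= [X in _ + X]big1 ?addr0; last first.
  by move=> b /negbTE bx; rewrite big1// => d _; rewrite xpair_eqE bx andbF mulr0.
under eq_bigr do rewrite eqxx mulr1 mulrAC.
by rewrite -mulr_sumr sum_law1 (proj2 P_pmf) mulr1.
Qed.

Lemma law_src1 x y : law P [% pX, pY1] (x, y) = PX x * V1 x y.
Proof. by rewrite law_kernel. Qed.

Lemma law_src2 x y : law P [% pX, pY2] (x, y) = PX x * V2 x y.
Proof. by rewrite law_kernel. Qed.

Let V1p x : is_pmf (V1 x).
Proof. by split; [exact: kernel_ge0|exact: sum_kernel]. Qed.

Let V2p x : is_pmf (V2 x).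
Proof. by split; [exact: kernel_ge0|exact: sum_kernel]. Qed.

Let PXp : is_pmf PX. Proof. exact: law_pmf. Qed.

Let iid_kernel_pmf (Y : finType) (V : X -> Y -> R) n x :
  (forall x, is_pmf (V x)) -> is_pmf (@iid_kernel R X Y V n x).
Proof.
move=> Vp; split; last by apply: sum_iid_kernel => x'; case: (Vp x').
by move=> y; apply: iid_kernel_ge0 => x' y'; case: (Vp x').
Qed.

Section OneCode.
Variables (R0 R1 R2 : R) (n : nat) (c : Defs.code X Y1 Y2 Z1 Z2 R0 R1 R2 n).
Hypotheses (R0p : 0 <= R0) (R1p : 0 <= R1) (R2p : 0 <= R2).

Let Pn : {ffun 'I_n -> X} -> R := @iid R X PX n.
Let e := enc c.
Let e0 x m : 0 <= e x m. Proof. by case: (enc_pmf c x). Qed.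
Let Pn_pmf : is_pmf Pn. Proof. exact: iid_pmf. Qed.
Let Pn0 x : 0 <= Pn x. Proof. by case: Pn_pmf. Qed.

Let w0 (m0 : msg R0 n) x := Pn x * \sum_m1 \sum_m2 e x (m0, m1, m2).
Let w1 (m0 : msg R0 n) (m1 : msg R1 n) x := Pn x * \sum_m2 e x (m0, m1, m2).
Let w2 (m0 : msg R0 n) (m2 : msg R2 n) x := Pn x * \sum_m1 e x (m0, m1, m2).

Let w1_ge0 m0 m1 x : 0 <= w1 m0 m1 x.
Proof. by rewrite mulr_ge0// sumr_ge0. Qed.

Let w2_ge0 m0 m2 x : 0 <= w2 m0 m2 x.
Proof. by rewrite mulr_ge0// sumr_ge0. Qed.

Let sum_w1 m0 x : \sum_m1 w1 m0 m1 x = w0 m0 x.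
Proof. by rewrite -mulr_sumr. Qed.

Let sum_w2 m0 x : \sum_m2 w2 m0 m2 x = w0 m0 x.
Proof. by rewrite -mulr_sumr exchange_big. Qed.

Let sum_w0 x : \sum_m0 w0 m0 x = Pn x.
Proof.
rewrite -mulr_sumr; have := proj2 (enc_pmf c x); rewrite 2!sum_pair => ->.
by rewrite mulr1.
Qed.

Lemma sum_decide (Y : finType) (V : X -> Y -> R) (d : {ffun 'I_n -> Y} ->
    msg R0 n * msg R1 n * msg R2 n -> R) :
  \sum_x \sum_m \sum_y iid PX x * enc c x m * iid_kernel V x y * d y m =
  \sum_m \sum_y push (@iid_kernel R X Y V n) (fun x => Pn x * e x m) y * d y m.
Proof.
rewrite exchange_big; apply: eq_bigr => m _; rewrite exchange_big.
by apply: eq_bigr => y _; rewrite mulr_suml.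
Qed.

Lemma sum_transmission (Y : finType) (V : X -> Y -> R) :
  (forall x, is_pmf (V x)) ->
  \sum_x \sum_m \sum_y iid PX x * enc c x m * iid_kernel V x y = 1.
Proof.
move=> Vp; rewrite -[RHS](proj2 Pn_pmf); apply: eq_bigr => x _.
transitivity (\sum_m Pn x * enc c x m).
  apply: eq_bigr => m _; rewrite -mulr_sumr.
  by rewrite (proj2 (iid_kernel_pmf x Vp)) mulr1.
by rewrite -mulr_sumr (proj2 (enc_pmf c x)) mulr1.
Qed.

Lemma decide_prob1_true : decide_prob1 P c true = 1 - decide_prob1 P c false.
Proof.
rewrite !(decide_prob1E _ _ zc1 law_src1).
rewrite -[X in _ = X - _](sum_transmission V1p) -sumrB.
apply: eq_bigr => x _; rewrite -sumrB; apply: eq_bigr => m _.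
rewrite -sumrB; apply: eq_bigr => y _.
by case: (dec1 _ _ _ _ _); rewrite /= ?mulr1 ?mulr0 ?subr0 ?subrr.
Qed.

Lemma decide_prob2_true : decide_prob2 P c true = 1 - decide_prob2 P c false.
Proof.
rewrite !(decide_prob2E _ _ zc2 law_src2).
rewrite -[X in _ = X - _](sum_transmission V2p) -sumrB.
apply: eq_bigr => x _; rewrite -sumrB; apply: eq_bigr => m _.
rewrite -sumrB; apply: eq_bigr => y _.
by case: (dec2 _ _ _ _ _); rewrite /= ?mulr1 ?mulr0 ?subr0 ?subrr.
Qed.

Let A1 (p : msg R0 n * msg R1 n) y := dec1 c y [ffun=> z1] p.1 p.2 == false.
Let A2 (p : msg R0 n * msg R2 n) y := dec2 c y [ffun=> z2] p.1 p.2 == false.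

Let fixed_kernel (Y : finType) (Q : Y -> R) (m : {ffun 'I_n -> X} -> R) y :
  push (@iid_kernel R X Y (fun=> Q) n) m y = (\sum_x m x) * iid Q y.
Proof. by rewrite /push mulr_suml. Qed.

Let decide1_sum (Y : finType) (V : X -> Y -> R)
    (d : msg R0 n * msg R1 n -> {ffun 'I_n -> Y} -> R) :
  \sum_m \sum_y push (@iid_kernel R X Y V n) (fun x => Pn x * e x m) y * d m.1 y =
  \sum_p \sum_y push (@iid_kernel R X Y V n) (w1 p.1 p.2) y * d p y.
Proof.
rewrite sum_pair; apply: eq_bigr => p _; rewrite exchange_big/=.
apply: eq_bigr => y _; rewrite -mulr_suml push_sum; congr (_ * _).
apply: eq_bigr => x _; congr (_ * _).
by rewrite -mulr_sumr /w1 -surjective_pairing.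
Qed.

Let decide2_sum (Y : finType) (V : X -> Y -> R)
    (d : msg R0 n * msg R2 n -> {ffun 'I_n -> Y} -> R) :
  \sum_m \sum_y push (@iid_kernel R X Y V n) (fun x => Pn x * e x m) y * d (m.1.1, m.2) y =
  \sum_p \sum_y push (@iid_kernel R X Y V n) (w2 p.1 p.2) y * d p y.
Proof.
rewrite 2!sum_pair sum_pair; apply: eq_bigr => m0 _; rewrite exchange_big/=.
apply: eq_bigr => m2 _; rewrite exchange_big/=.
apply: eq_bigr => y _; rewrite -mulr_suml push_sum; congr (_ * _).
by apply: eq_bigr => x _; congr (_ * _); rewrite -mulr_sumr.
Qed.

(** The messages themselves are the descriptions. Rates come from counting messages, with one extra
    bit each; exponents come from the testing bound, since under the alternative the output is
    independent of the messages, and each loses 1. *)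
Lemma code_Region k1 k2 :
  decide_prob1 (alt_law P) c false <= 2 `^ (- k1) ->
  decide_prob2 (alt_law P) c false <= 2 `^ (- k2) ->
  Region Pn (@iid_kernel R X Y1 V1 n) (@iid_kernel R X Y2 V2 n) 1
    (n%:R * R0 + 1) (n%:R * R1 + 1) (n%:R * R2 + 1)
    (decide_prob1 P c false * k1 - 1) (decide_prob2 P c false * k2 - 1).
Proof.
move=> H1 H2.
have mass_w0 : \sum_m0 \sum_x w0 m0 x = 1.
  by rewrite exchange_big -[RHS](proj2 Pn_pmf); apply: eq_bigr => x _; exact: sum_w0.
have w0_ge0 m0 x : 0 <= w0 m0 x by rewrite -sum_w1 sumr_ge0.
have rate (M : finType) (r : R) (w : msg R0 n -> M -> {ffun 'I_n -> X} -> R) :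
    (forall m0 m x, 0 <= w m0 m x) -> (forall m0 x, \sum_m w m0 m x = w0 m0 x) ->
    log2 #|M|%:R <= r ->
    \sum_m0 entropy (w0 m0) <= r + \sum_m0 \sum_m entropy (w m0 m).
  move=> wp ws Mr; apply: le_trans (_ : \sum_m0 (\sum_m entropy (w m0 m) +
      (\sum_x w0 m0 x) * log2 #|M|%:R) <= _).
    apply: ler_sum => m0 _; have := @entropy_add_le _ _ _ (w m0) (wp m0).
    rewrite (_ : (fun x => \sum_m w m0 m x) = w0 m0); last first.
      by apply/funext => x; rewrite ws.
    rewrite (_ : \sum_m \sum_x w m0 m x = \sum_x w0 m0 x)//.
    by rewrite exchange_big; apply: eq_bigr => x _; rewrite ws.
  by rewrite big_split/= -mulr_suml mass_w0 mul1r addrC lerD2r.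
exists (msg R0 n), (msg R1 n), (msg R2 n), w0, w1, w2; split; split => //.
- by move=> x; rewrite sum_w0 mul1r.
- rewrite mul1r; have := @entropy_add_le _ _ _ w0 w0_ge0.
  rewrite mass_w0 mul1r (_ : (fun x => \sum_m w0 m x) = Pn); last first.
    by apply/funext => x; rewrite sum_w0.
  have := card_msg n R0p; lra.
- by apply: rate => //; exact: card_msg.
- by apply: rate => //; exact: card_msg.
- rewrite mul1r -(sum_pair (fun p => entropy (push _ (w1 p.1 p.2)))).
  have := @push_test _ _ _ Pn (@iid_kernel R X Y1 V1 n) (fun p => w1 p.1 p.2) A1 k1
    Pn_pmf (fun x => iid_kernel_pmf x V1p).
  rewrite (decide_prob1E _ _ zc1 law_src1).
  rewrite (sum_decide V1 (fun y m => (dec1 c y [ffun=> z1] m.1.1 m.1.2 == false)%:R)).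
  rewrite (decide1_sum V1 (fun p y => (A1 p y)%:R)); apply => //.
    by move=> x; rewrite sum_pair -sum_w0; apply: eq_bigr => m0 _; rewrite -sum_w1.
  apply: le_trans H1; rewrite le_eqVlt; apply/orP; left; apply/eqP.
  rewrite (decide_prob1E _ _ alt_law_z1 law_alt1).
  rewrite (sum_decide (fun=> law P pY1)
    (fun y m => (dec1 c y [ffun=> z1] m.1.1 m.1.2 == false)%:R)).
  rewrite (decide1_sum (fun=> law P pY1) (fun p y => (A1 p y)%:R)).
  apply: eq_bigr => p _; apply: eq_bigr => y _; rewrite fixed_kernel push_iid.
  by rewrite [push V1 PX](funext (push_kernel pX pY1 P_pmf)).
- rewrite mul1r -(sum_pair (fun p => entropy (push _ (w2 p.1 p.2)))).
  have := @push_test _ _ _ Pn (@iid_kernel R X Y2 V2 n) (fun p => w2 p.1 p.2) A2 k2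
    Pn_pmf (fun x => iid_kernel_pmf x V2p).
  rewrite (decide_prob2E _ _ zc2 law_src2).
  rewrite (sum_decide V2 (fun y m => (dec2 c y [ffun=> z2] m.1.1 m.2 == false)%:R)).
  rewrite (decide2_sum V2 (fun p y => (A2 p y)%:R)); apply => //.
    by move=> x; rewrite sum_pair -sum_w0; apply: eq_bigr => m0 _; rewrite -sum_w2.
  apply: le_trans H2; rewrite le_eqVlt; apply/orP; left; apply/eqP.
  rewrite (decide_prob2E _ _ alt_law_z2 law_alt2).
  rewrite (sum_decide (fun=> law P pY2)
    (fun y m => (dec2 c y [ffun=> z2] m.1.1 m.2 == false)%:R)).
  rewrite (decide2_sum (fun=> law P pY2) (fun p y => (A2 p y)%:R)).
  apply: eq_bigr => p _; apply: eq_bigr => y _; rewrite fixed_kernel push_iid.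
  by rewrite [push V2 PX](funext (push_kernel pX pY2 P_pmf)).
Qed.

Lemma code_single_letter k1 k2 : (0 < n)%N ->
  decide_prob1 (alt_law P) c false <= 2 `^ (- (n%:R * k1)) ->
  decide_prob2 (alt_law P) c false <= 2 `^ (- (n%:R * k2)) ->
  Region PX V1 V2 1 (R0 + n%:R^-1) (R1 + n%:R^-1) (R2 + n%:R^-1)
    (decide_prob1 P c false * k1 - n%:R^-1) (decide_prob2 P c false * k2 - n%:R^-1).
Proof.
move=> n0 H1 H2; have nN0 : n%:R != 0 :> R by rewrite pnatr_eq0 -lt0n.
have n_ge0 : 0 <= n%:R^-1 :> R by rewrite invr_ge0 ler0n.
have V1_ge0 x y : 0 <= V1 x y by case: (V1p x).
have V2_ge0 x y : 0 <= V2 x y by case: (V2p x).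
have H := code_Region H1 H2.
have := Region_scale V1_ge0 V2_ge0 n_ge0
  (Region_single_letter PXp V1p V2p ler01 H).
rewrite mulr1 mulVf//; apply: Region_mono; rewrite le_eqVlt; apply/orP; left;
  apply/eqP; by field.
Qed.

End OneCode.

End CodeRegion.

(** * Exponential decay and the limit superior *)

Section DecayExponent.
Context {R : realType} (b : nat -> R).
Hypothesis b0 : forall n, 0 <= b n.

Local Notation u n := ((n%:R^-1)%:E * log2e (b n)%:E)%E.

Lemma scaled_log_lt n x : (0 < n)%N -> (u n < x%:E)%E -> b n <= 2 `^ (n%:R * x).
Proof.
move=> n0; have [->|bN0] := eqVneq (b n) 0; first by rewrite powR_ge0.
have bp : 0 < b n by rewrite lt_neqAle eq_sym bN0 b0.
rewrite /log2e lne_EFin// -!EFinM lte_fin -/(log2 (b n)) mulrC.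
rewrite ltr_pdivrMr ?ltr0n// mulrC => h.
rewrite -[leLHS](powR2_log2 bp) ler_powR ?ler1n//; exact: ltW.
Qed.

Lemma scaled_log_le n x : (0 < n)%N -> b n <= 2 `^ (n%:R * x) -> (u n <= x%:E)%E.
Proof.
move=> n0; have [->|bN0] := eqVneq (b n) 0.
  move=> _; rewrite /log2e le0_lneNy//.
  rewrite mulNyr gtr0_sg ?invr_gt0 ?ln2_gt0// mul1e.
  by rewrite mulrNy gtr0_sg ?invr_gt0 ?ltr0n// mul1e leNye.
have bp : 0 < b n by rewrite lt_neqAle eq_sym bN0 b0.
move=> /(ler_log2 bp); rewrite log2_powR => h.
rewrite /log2e lne_EFin// -!EFinM lee_fin -/(log2 (b n)) mulrC.
by rewrite ler_pdivrMr ?ltr0n// mulrC.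
Qed.

Lemma decay_exponent_lt (theta t : R) :
  (theta%:E <= decay_exponent b)%E -> t < theta ->
  exists N, forall n, (N <= n)%N -> (0 < n)%N -> b n <= 2 `^ (- (n%:R * t)).
Proof.
rewrite /decay_exponent leeNr => h tt.
have : (limn_esup (fun n => u n) < (- t)%:E)%E.
  by apply: le_lt_trans h _; rewrite -EFinN lte_fin ltrN2.
move=> /ereal_inf_lt[_ [A [N _ NA] <-] hA].
exists N => n Nn n0; rewrite -mulrN; apply: scaled_log_lt => //.
apply: le_lt_trans hA; apply: ereal_sup_ubound.
by exists n => //; exact: NA.
Qed.

Lemma decay_exponent_ge (t : R) N :
  (forall n, (N <= n)%N -> (0 < n)%N -> b n <= 2 `^ (- (n%:R * t))) ->
  (t%:E <= decay_exponent b)%E.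
Proof.
move=> h; rewrite /decay_exponent leeNr.
(* The tail starts at [N.+1] rather than [N], which guarantees n > 0. *)
apply: ereal_inf_le; exists (ereal_sup [set u n | n in [set n | (N.+1 <= n)%N]]%classic).
  exists [set n | (N.+1 <= n)%N]%classic => //.
  by exists N.+1.
apply: ge_ereal_sup => _ [n /= Nn <-].
by apply: scaled_log_le; [case: n Nn|rewrite mulrN; apply: h; [exact: ltnW|case: n Nn]].
Qed.

End DecayExponent.

Section Converse.
Context {R : realType} (X Y1 Y2 Z1 Z2 : finType).
Notation source := (X * Y1 * Y2 * Z1 * Z2)%type.
Notation pX := (@srcX X Y1 Y2 Z1 Z2).
Notation pY1 := (@srcY1 X Y1 Y2 Z1 Z2).
Notation pY2 := (@srcY2 X Y1 Y2 Z1 Z2).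
Notation pZ1 := (@srcZ1 X Y1 Y2 Z1 Z2).
Notation pZ2 := (@srcZ2 X Y1 Y2 Z1 Z2).
Variables (P : source -> R) (z1 : Z1) (z2 : Z2).
Hypothesis P_pmf : is_pmf P.
Hypothesis P_z1 : law P pZ1 z1 = 1.
Hypothesis P_z2 : law P pZ2 z2 = 1.
Variables (R0 R1 R2 : R).
Hypotheses (R0p : 0 <= R0) (R1p : 0 <= R1) (R2p : 0 <= R2).
Let PX := law P pX.
Let V1 := kernel P pX pY1.
Let V2 := kernel P pX pY2.

Lemma alt_law_ge0 s : 0 <= alt_law P s.
Proof. by rewrite /alt_law /cond !mulr_ge0 ?invr_ge0 ?law_ge0. Qed.

Lemma iid_ge0 (S : finType) (Q : S -> R) n (w : {ffun 'I_n -> S}) :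
  (forall s, 0 <= Q s) -> 0 <= iid Q w.
Proof. by move=> Q0; exact: prodr_ge0. Qed.

Lemma decide_prob1_ge0 (Q : source -> R) n
    (c : Defs.code X Y1 Y2 Z1 Z2 R0 R1 R2 n) d :
  (forall s, 0 <= Q s) -> 0 <= decide_prob1 Q c d.
Proof.
move=> Q0; apply: sumr_ge0 => w _; apply: sumr_ge0 => m _.
by rewrite !mulr_ge0 ?iid_ge0//; case: (enc_pmf c (block pX w)).
Qed.

Lemma decide_prob2_ge0 (Q : source -> R) n
    (c : Defs.code X Y1 Y2 Z1 Z2 R0 R1 R2 n) d :
  (forall s, 0 <= Q s) -> 0 <= decide_prob2 Q c d.
Proof.
move=> Q0; apply: sumr_ge0 => w _; apply: sumr_ge0 => m _.
by rewrite !mulr_ge0 ?iid_ge0//; case: (enc_pmf c (block pX w)).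
Qed.

Lemma achievable_Region theta1 theta2 d : 0 <= theta1 -> 0 <= theta2 ->
  (forall eps, 0 < eps < 1 -> achievable P eps theta1 theta2 R0 R1 R2) -> 0 < d ->
  Region PX V1 V2 1 (R0 + d) (R1 + d) (R2 + d) (theta1 - d) (theta2 - d).
Proof.
move=> t1 t2 H d0.
(* The loss d is spent in three thirds: on the decay rate, on 1 / n, and on the type-I error. This
   [D] makes d / D times either exponent at most d / 3, and d / D < 1. *)
pose D := 3 * (theta1 + theta2 + 1) + 2 * d.
have D0 : 0 < D by rewrite /D; lra.
have eps01 : 0 < d / D < 1.
  by rewrite divr_gt0//= ltr_pdivrMr// /D; lra.
have [c [a1 a2 b1 b2]] := H _ eps01.
have [N1 h1] := decay_exponent_lt (fun n => decide_prob1_ge0 (c n) false alt_law_ge0)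
  b1 (ltac:(lra) : theta1 - d / 3 < theta1).
have [N2 h2] := decay_exponent_lt (fun n => decide_prob2_ge0 (c n) false alt_law_ge0)
  b2 (ltac:(lra) : theta2 - d / 3 < theta2).
pose n := maxn (maxn N1 N2) (Num.truncn (3 / d)).+1.
have n0 : (0 < n)%N by rewrite !leq_max ltnS leq0n orbT.
have nd : n%:R^-1 <= d / 3.
  rewrite -[d / 3]invrK lef_pV2 ?posrE ?ltr0n ?invr_gt0 ?divr_gt0// invf_div.
  apply: le_trans (ltW (truncnS_gt _)) _.
  by rewrite ler_nat leq_maxr.
have nN1 : (N1 <= n)%N by rewrite !leq_max leqnn.
have nN2 : (N2 <= n)%N by rewrite !leq_max leqnn orbT.
have := code_single_letter P_pmf P_z1 P_z2 R0p R1p R2p n0 (h1 n nN1 n0) (h2 n nN2 n0).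
have := a1 n n0; rewrite (decide_prob1_true P_pmf P_z1).
have := a2 n n0; rewrite (decide_prob2_true P_pmf P_z2).
set s1 := decide_prob1 P (c n) false; set s2 := decide_prob2 P (c n) false.
move=> e2 e1.
have bound (theta s : R) : 0 <= theta -> theta <= theta1 + theta2 -> 1 - s <= d / D ->
    0 <= s <= 1 -> theta - d <= s * (theta - d / 3) - n%:R^-1.
  move=> th0 th es s01.
  have eD : d / D * (3 * theta) <= d.
    rewrite mulrAC ler_pdivrMr// ler_pM2l// /D; lra.
  have : (1 - s) * theta <= d / D * theta by rewrite ler_wpM2r.
  have : (1 - s) * (d / 3) >= 0 by rewrite mulr_ge0//; lra.
  have -> : s * (theta - d / 3) = theta - (1 - s) * theta - d / 3 + (1 - s) * (d / 3) by ring.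
  move: eD; rewrite mulrCA; lra.
have s1b : 0 <= s1 <= 1.
  rewrite decide_prob1_ge0/=; last by case: P_pmf.
  rewrite -subr_ge0 -(decide_prob1_true P_pmf P_z1) decide_prob1_ge0//.
  by case: P_pmf.
have s2b : 0 <= s2 <= 1.
  rewrite decide_prob2_ge0/=; last by case: P_pmf.
  rewrite -subr_ge0 -(decide_prob2_true P_pmf P_z2) decide_prob2_ge0//.
  by case: P_pmf.
apply: Region_mono; [lra|lra|lra| |].
  by apply: bound => //; lra.
by apply: bound => //; lra.
Qed.

(** [Region_closed] absorbs both the closure in the definition of the exponents region and the
    vanishing losses of the converse. *)
Lemma exponents_region_Region theta :
  exponents_region_SI P R0 R1 R2 theta ->
  [/\ 0 <= theta.1, 0 <= theta.2 & Region PX V1 V2 1 R0 R1 R2 theta.1 theta.2].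
Proof.
move=> cl.
have near d : 0 < d -> exists t : R * R, [/\ 0 <= t.1, 0 <= t.2,
    (forall eps, 0 < eps < 1 -> achievable P eps t.1 t.2 R0 R1 R2) &
    `|theta.1 - t.1| < d /\ `|theta.2 - t.2| < d].
  move=> d0; have [t [[t1 t2 H] [B1 B2]]] := cl _ (nbhsx_ballx theta d d0).
  by exists t; split.
split.
- apply: contrapT => /negP; rewrite -ltNge => h.
  have [t [t1 _ _ [h1 _]]] := near (- theta.1) ltac:(lra).
  move: h1; rewrite ltr_norml; lra.
- apply: contrapT => /negP; rewrite -ltNge => h.
  have [t [_ t2 _ [_ h2]]] := near (- theta.2) ltac:(lra).
  move: h2; rewrite ltr_norml; lra.
apply: Region_closed.
- exact: law_pmf.
- exact: kernel_ge0.
- exact: kernel_ge0.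
move=> d d0; have d2 : 0 < d / 2 by rewrite divr_gt0.
have [t [t1 t2 H [h1 h2]]] := near _ d2.
move: h1 h2; rewrite !ltr_norml => h1 h2.
by apply: Region_mono (achievable_Region t1 t2 H d2); lra.
Qed.

End Converse.

(** * Achievability *)

Section Chernoff.
Context {R : realType}.

(** From exp(-y) >= 1 - y one gets exp(y) <= 1 / (1 - y), and the quadratic dominates this for |y|
    <= 1/2. *)
Lemma expR_le_quadratic (y : R) : `|y| <= 2^-1 -> expR y <= 1 + y + 2 * y ^+ 2.
Proof.
rewrite ler_norml => /andP[y1 y2].
have p1 : 0 < 1 - y by lra.
have := expR_ge1Dx (- y); rewrite expRN => h.
apply: (@le_trans _ _ (1 - y)^-1).
  by rewrite -[leLHS]invrK lef_pV2 ?posrE ?invr_gt0 ?expR_gt0.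
rewrite -[leLHS]mul1r ler_pdivrMr//.
have -> : (1 + y + 2 * y ^+ 2) * (1 - y) = 1 + y ^+ 2 * (1 - 2 * y) by ring.
by rewrite lerDl mulr_ge0 ?sqr_ge0//; lra.
Qed.

(** The product reaches 2 to the n a only if the sum of [f] is nonnegative, and that indicator is at
    most the exponential of t times the sum. As [f] has mean -D < 0, its exponential moment is below
    1 for small t. *)
Lemma chernoff_bound (S : finType) (Q g : S -> R) a : is_pmf Q ->
  (forall s, 0 < Q s -> 0 < g s) -> \sum_s Q s * log2 (g s) < a ->
  exists k, 0 <= k < 1 /\ forall n,
    \sum_(w : {ffun 'I_n -> S}) iid Q w * (2 `^ (n%:R * a) <= \prod_i g (w i))%R%:R <= k ^+ n.
Proof.
move=> [Q0 Q1] g0 Ea; pose f s := (log2 (g s) - a) * ln 2.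
have lnp := @ln2_gt0 R.
pose D := - \sum_s Q s * f s.
have D0 : 0 < D.
  rewrite /D; under eq_bigr do rewrite /f mulrA mulrBr mulrBl.
  rewrite sumrB -!mulr_suml Q1 mul1r -mulrBl oppr_gt0 pmulr_llt0//; lra.
pose K := 1 + D + \sum_s `|f s|.
have fK s : `|f s| <= K.
  by have := @le_sum1 _ _ (fun s => `|f s|) s (fun s => normr_ge0 _); rewrite /K; lra.
have K1 : 1 <= K.
  by have : 0 <= \sum_s `|f s| by [exact: sumr_ge0]; rewrite /K; lra.
have DK : D <= K.
  by have : 0 <= \sum_s `|f s| by [exact: sumr_ge0]; rewrite /K; lra.
have Kp : 0 < K by lra.
(* This minimises 1 - t D + 2 t^2 K^2, leaving 1 - t D / 2; since K dominates D and every |f s|, the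
   arguments of the exponentials stay within 1/2. *)
pose t := D / (4 * K ^+ 2).
have tp : 0 < t by rewrite divr_gt0// mulr_gt0// exprn_gt0.
have tK : t * K <= 2^-1.
  rewrite /t mulrAC ler_pdivrMr ?mulr_gt0 ?exprn_gt0//.
  have -> : 2^-1 * (4 * K ^+ 2) = 2 * K * K by field.
  by rewrite ler_pM2r//; lra.
have tKK : t * K ^+ 2 = D / 4.
  by rewrite /t; field; rewrite gt_eqF.
exists (\sum_s Q s * expR (t * f s)); split.
  rewrite sumr_ge0/= => [|s _]; last by rewrite mulr_ge0// expR_ge0.
  apply: (@le_lt_trans _ _ (\sum_s Q s * (1 + t * f s + 2 * (t ^+ 2 * K ^+ 2)))).
    apply: ler_sum => s _; rewrite ler_wpM2l//.
    have ts : `|t * f s| <= t * K by rewrite normrM gtr0_norm// ler_pM2l.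
    apply: le_trans (expR_le_quadratic (le_trans ts tK)) _.
    rewrite lerD2l ler_pM2l// -exprMn -[X in X <= _]real_normK ?num_real//.
    by apply: lerXn2r => //; rewrite nnegrE ?normr_ge0// mulr_ge0 ?(ltW tp) ?(ltW Kp).
  under eq_bigr do rewrite mulrDr mulrDr mulr1 mulrCA.
  rewrite big_split big_split/= Q1 -mulr_sumr -mulr_suml Q1 mul1r.
  have -> : t ^+ 2 * K ^+ 2 = t * (D / 4) by rewrite -tKK; ring.
  have -> : \sum_s Q s * f s = - D by rewrite opprK.
  have : 0 < t * D by exact: mulr_gt0.
  have -> : t * (D / 4) = t * D / 4 by ring.
  have -> : t * - D = - (t * D) by ring.
  lra.
move=> n; have -> : (\sum_s Q s * expR (t * f s)) ^+ n =
    \sum_(w : {ffun 'I_n -> S}) \prod_i (Q (w i) * expR (t * f (w i))).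
  rewrite -(bigA_distr_bigA (fun (_ : 'I_n) s => Q s * expR (t * f s))).
  by rewrite prodr_const card_ord.
apply: ler_sum => w _; rewrite big_split/= -/(iid Q w).
have iid0 : 0 <= iid Q w by exact: prodr_ge0.
rewrite le_eqVlt in iid0; case/predU1P: iid0 => [<-|iid0]; first by rewrite !mul0r.
rewrite ler_pM2l//; case: (leP (2 `^ _)) => [h|_]; last first.
  by apply: prodr_ge0 => i _; exact: expR_ge0.
have Qw i : 0 < Q (w i).
  rewrite lt_neqAle Q0 andbT eq_sym; apply: contraTneq iid0 => Q_0.
  by rewrite /iid (bigD1 i)//= Q_0 mul0r ltxx.
have gw i : 0 < g (w i) by exact: g0.
rewrite -expR_sum -[leLHS]expR0 ler_expR -mulr_sumr mulr_ge0 ?(ltW tp)//.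
rewrite -mulr_suml mulr_ge0 ?(ltW lnp)// sumrB sumr_const card_ord -mulr_natl.
rewrite subr_ge0 -[leLHS]log2_powR.
have logprod (r : seq 'I_n) : log2 (\prod_(i <- r) g (w i)) = \sum_(i <- r) log2 (g (w i)).
  elim: r => [|i r IH]; first by rewrite !big_nil log2_1.
  by rewrite !big_cons log2M ?IH// prodr_gt0.
by rewrite -logprod ler_log2// powR_gt0.
Qed.

End Chernoff.

(* [1 / (1 + p k)] is convex in p, hence below its chord *)
Lemma miss_le {R : realType} (p L : R) M : 0 <= p <= 1 -> 0 < L -> p / L <= 1 ->
  (1 - p / L) ^+ M.+1 <= (1 - p) + L / M.+1%:R.
Proof.
move=> /andP[p0 p1] L0 pL; set A := p / L in pL *.
have A0 : 0 <= A by rewrite divr_ge0// ltW.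
have Mp : 0 < M.+1%:R :> R by rewrite ltr0n.
have bern n : 1 + n%:R * A <= (1 + A) ^+ n.
  elim: n => [|n IH]; first by rewrite mul0r addr0 expr0.
  rewrite exprS -natr1; apply: (@le_trans _ _ ((1 + A) * (1 + n%:R * A))).
    have : 0 <= n%:R * A * A by do 2?apply: mulr_ge0 => //; rewrite ler0n.
    have -> : (1 + A) * (1 + n%:R * A) = 1 + (n%:R + 1) * A + n%:R * A * A by ring.
    lra.
  by rewrite ler_wpM2l//; lra.
have d0 : 0 < 1 + M.+1%:R * A by apply: ltr_wpDr => //; apply: mulr_ge0 => //; exact: ltW.
(* As (1 - A)(1 + A) <= 1, Bernoulli's inequality bounds the power by 1 / (1 + (M + 1) A). *)
have H : (1 - A) ^+ M.+1 * (1 + M.+1%:R * A) <= 1.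
  apply: (@le_trans _ _ ((1 - A) ^+ M.+1 * (1 + A) ^+ M.+1)).
    by rewrite ler_wpM2l// exprn_ge0// subr_ge0.
  rewrite -exprMn; apply: exprn_ile1; first by apply: mulr_ge0; lra.
  have -> : (1 - A) * (1 + A) = 1 - A * A by ring.
  by rewrite gerBl; exact: mulr_ge0.
rewrite -ler_pdivlMr// mul1r in H; apply: le_trans H _.
rewrite -[leLHS]mul1r ler_pdivrMr//.
pose k := M.+1%:R / L.
have k0 : 0 < k by rewrite divr_gt0.
have -> : M.+1%:R * A = k * p by rewrite /k /A; field; rewrite gt_eqF.
have -> : L / M.+1%:R = k^-1 by rewrite invf_div.
have -> : (1 - p + k^-1) * (1 + k * p) = 1 + k * p * (1 - p) + k^-1.
  by field; rewrite gt_eqF.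
have h1 : 0 <= k * p * (1 - p) by rewrite mulr_ge0 ?subr_ge0// mulr_ge0// ltW.
have h2 : 0 < k^-1 by rewrite invr_gt0.
lra.
Qed.

(** * Covering with one codebook *)

Section Covering.
Context {R : realType} (X U : finType) (u0 : U) (pi : X -> R) (q : U -> R)
  (r : X -> U -> R) (c : U -> X -> R) (B L : R).
Hypothesis pi0 : forall x, 0 <= pi x.
Hypothesis q0 : forall u, 0 <= q u.
Hypothesis sum_q : \sum_u q u <= 1.
Hypothesis r0 : forall x u, 0 <= r x u.
Hypothesis c0 : forall u x, 0 <= c u x.
Hypothesis cB : forall u x, c u x <= B.
Hypothesis B0 : 0 <= B.
Hypothesis L0 : 0 < L.
Hypothesis sum_r : forall x, \sum_u r x u <= 1.

(** Rejection sampling: a codeword u drawn from [q] is accepted for x with probability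
    [r x u / (L * q u)] when [good], and never otherwise. [A x] is the acceptance probability of one
    draw, and [T x] bounds the mean cost of an accepted codeword, since S <= B p. *)
Local Notation good x u := (r x u <= L * q u)%R%:R.
Local Notation p x := (\sum_u r x u * good x u).
Local Notation S x := (\sum_u r x u * good x u * c u x).
Local Notation T x := (S x + B * (1 - p x)).
Local Notation A x := (p x / L).

Let good_ge0 x u : 0 <= r x u * good x u.
Proof. by rewrite mulr_ge0 ?ler0n. Qed.

Lemma cover_ge0 x : 0 <= p x. Proof. exact: sumr_ge0. Qed.

Lemma cover_le1 x : p x <= 1.
Proof.
apply: le_trans (sum_r x); apply: ler_sum => u _.
by rewrite ler_piMr// lern1 leq_b1.
Qed.

Let good_le x u : r x u * good x u / L <= q u.
Proof.
rewrite ler_pdivrMr//; have [h|_] := boolP (r x u <= L * q u).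
  by rewrite mulr1 mulrC.
by rewrite mulr0 mulr_ge0// ltW.
Qed.

Let A_ge0 x : 0 <= A x. Proof. by rewrite divr_ge0 ?cover_ge0 ?ltW. Qed.

Lemma cover_div_le1 x : A x <= 1.
Proof.
apply: le_trans sum_q; rewrite mulr_suml; apply: ler_sum => u _; exact: good_le.
Qed.

Let S_le x : S x / L <= A x * T x.
Proof.
rewrite mulrAC ler_pM2r ?invr_gt0//.
have SB : S x <= B * p x.
  by rewrite mulr_sumr; apply: ler_sum => u _; rewrite mulrC ler_wpM2r.
have : 0 <= (B * p x - S x) * (1 - p x) by rewrite mulr_ge0 ?subr_ge0 ?cover_le1.
have -> : p x * T x = S x + (B * p x - S x) * (1 - p x) by ring.
lra.
Qed.

(* Choosing the codewords one after the other without increasing the expected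
   cost that random completions would give. *)
Let cover_seq M (v : X -> R) : (forall x, 0 <= v x <= B) ->
  exists s : seq U, size s = M /\
  \sum_x pi x * foldl (fun a u => Num.min a (c u x)) (v x) s <=
  \sum_x pi x * ((1 - A x) ^+ M * v x + (1 - (1 - A x) ^+ M) * T x).
Proof.
elim: M v => [|M IH] v vB.
  exists [::]; split => //=; rewrite le_eqVlt; apply/orP; left; apply/eqP.
  by apply: eq_bigr => x _; rewrite expr0 subrr mul0r addr0 mul1r.
pose F (v : X -> R) := \sum_x pi x * ((1 - A x) ^+ M * v x + (1 - (1 - A x) ^+ M) * T x).
have pow_ge0 x k : 0 <= (1 - A x) ^+ k by rewrite exprn_ge0// subr_ge0 cover_div_le1.
have F_mono (f g : X -> R) : (forall x, f x <= g x) -> F f <= F g.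
  move=> fg; apply: ler_sum => x _; rewrite ler_wpM2l// lerD2r.
  by rewrite ler_wpM2l.
pose vu u x := Num.min (v x) (c u x).
case: (@arg_minP _ _ _ u0 xpredT (fun u => F (vu u)) isT) => u _ umin.
have [s [sM sF]] : exists s : seq U, size s = M /\
    \sum_x pi x * foldl (fun a u => Num.min a (c u x)) (vu u x) s <= F (vu u).
  apply: IH => x; have /andP[vx0 vxB] := vB x.
  by rewrite le_min vx0 c0 ge_min vxB.
exists (u :: s); split => /=; first by rewrite sM.
apply: le_trans sF _.
pose v' x := A x * T x + (1 - A x) * v x.
have -> : \sum_x pi x * ((1 - A x) ^+ M.+1 * v x + (1 - (1 - A x) ^+ M.+1) * T x) = F v'.
  by apply: eq_bigr => x _; rewrite exprSr /v'; ring.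
(* [F] is affine, so it commutes with averaging over a codeword drawn from [q], where the missing
   mass stands for no draw at all. The minimiser [u] does no worse than this average. *)
have Fmix : \sum_u q u * F (vu u) + (1 - \sum_u q u) * F v =
    F (fun x => \sum_u q u * vu u x + (1 - \sum_u q u) * v x).
  rewrite /F mulr_sumr; under eq_bigr do rewrite mulr_sumr.
  rewrite exchange_big -big_split; apply: eq_bigr => x _ /=.
  transitivity (\sum_u (pi x * (1 - A x) ^+ M * (q u * vu u x) +
     q u * (pi x * ((1 - (1 - A x) ^+ M) * T x))) + (1 - \sum_u q u) *
     (pi x * ((1 - A x) ^+ M * v x + (1 - (1 - A x) ^+ M) * T x))).
    by congr (_ + _); apply: eq_bigr => w _; ring.
  by rewrite big_split/= -mulr_sumr -mulr_suml; ring.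
apply: (@le_trans _ _ (\sum_u q u * F (vu u) + (1 - \sum_u q u) * F v)).
  apply: (@le_trans _ _ (\sum_w q w * F (vu u) + (1 - \sum_w q w) * F (vu u))).
    rewrite -mulr_suml -mulrDl addrCA subrr addr0 mul1r//.
  rewrite lerD//; first by apply: ler_sum => w _; rewrite ler_wpM2l// umin.
  rewrite ler_wpM2l ?subr_ge0//; apply: F_mono => x.
  by rewrite /vu ge_min lexx.
rewrite Fmix; apply: F_mono => x.
apply: (@le_trans _ _ (S x / L + (1 - A x) * v x)); last by rewrite lerD2r S_le.
have -> : S x / L + (1 - A x) * v x = \sum_w (r x w * good x w / L * c w x +
    (q w - r x w * good x w / L) * v x) + (1 - \sum_w q w) * v x.
  have E1 : S x / L = \sum_w r x w * good x w / L * c w x.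
    by rewrite mulr_suml; apply: eq_bigr => w _; ring.
  have E2 : A x = \sum_w r x w * good x w / L by rewrite mulr_suml.
  by rewrite big_split/= -mulr_suml sumrB -E1 -E2; ring.
rewrite lerD2r; apply: ler_sum => w _.
have g0 : 0 <= r x w * good x w / L by rewrite divr_ge0// ltW.
(* On the accepted part the minimum is bounded by the new cost, on the rest by the old one. *)
have -> : q w * vu w x = r x w * good x w / L * vu w x +
  (q w - r x w * good x w / L) * vu w x by ring.
by rewrite lerD// ler_wpM2l ?subr_ge0// /vu ge_min lexx ?orbT.
Qed.

(** The running minimum starts at [B]. It ends as the cost of some codeword or still at [B], in
    which case any codeword will do because [c] is at most [B]. *)
Lemma covering M : exists (cb : 'I_M.+1 -> U) (sel : X -> 'I_M.+1),
  \sum_x pi x * c (cb (sel x)) x <=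
  \sum_x pi x * (\sum_u r x u * c u x + B * ((1 - p x) + (1 - p x / L) ^+ M.+1)).
Proof.
have [s [sM sF]] := @cover_seq M.+1 (fun=> B) (fun x => ltac:(by rewrite B0 lexx)).
pose cb (m : 'I_M.+1) := nth u0 s m.
have : forall x, exists m : 'I_M.+1,
    c (cb m) x <= foldl (fun a u => Num.min a (c u x)) B s.
  move=> x; have H : forall (l : seq U) a, foldl (fun a u => Num.min a (c u x)) a l = a \/
      exists2 i, (i < size l)%N & foldl (fun a u => Num.min a (c u x)) a l = c (nth u0 l i) x.
    elim=> [|u l IH] a; first by left.
    have [/= ->|[i il /= ->]] := IH (Num.min a (c u x)); last by right; exists i.+1.
    by rewrite minEle; case: ifP => _; [left|right; exists 0%N].
  have [->|[i il ->]] := H s B; first by exists ord0.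
  by rewrite sM in il; exists (Ordinal il).
move=> /choice[sel selP]; exists cb, sel.
apply: (@le_trans _ _ (\sum_x pi x * foldl (fun a u => Num.min a (c u x)) B s)).
  by apply: ler_sum => x _; rewrite ler_wpM2l.
apply: le_trans sF _; apply: ler_sum => x _; rewrite ler_wpM2l//.
have pw : 0 <= (1 - A x) ^+ M.+1 <= 1.
  by rewrite exprn_ge0 ?exprn_ile1 ?subr_ge0 ?cover_div_le1// gerBl.
have S0 : 0 <= S x by apply: sumr_ge0 => u _; rewrite mulr_ge0.
have T0 : 0 <= T x by rewrite addr_ge0// mulr_ge0// subr_ge0 cover_le1.
have SS : S x <= \sum_u r x u * c u x.
  by apply: ler_sum => u _; rewrite ler_wpM2r// ler_piMr// lern1 leq_b1.
apply: (@le_trans _ _ ((1 - A x) ^+ M.+1 * B + T x)).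
  by rewrite lerD2l ler_piMl//; lra.
have -> : (1 - A x) ^+ M.+1 * B + T x =
  S x + B * ((1 - p x) + (1 - p x / L) ^+ M.+1) by ring.
by rewrite lerD2r.
Qed.

End Covering.

Section Conditionals.
Context {R : realType} (B U X : finType) (w : B -> U -> X -> R).
Hypothesis w_ge0 : forall b u x, 0 <= w b u x.

(** The conditional laws of u given (b, x) and given b. They vanish by default where the
    conditioning mass is 0, hence sums that are only at most 1. *)
Definition cond_x b x u := w b u x / \sum_u' w b u' x.
Definition cond_q b u := (\sum_x w b u x) / \sum_u' \sum_x w b u' x.

(** The probability, for u drawn given (b, x), that the information density is at most log L. *)
Definition hit L b x :=
  \sum_u cond_x b x u * (cond_x b x u <= L * cond_q b u)%R%:R.

(* bound on the probability that none of M + 1 codewords drawn from [cond_q]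
   plays the role of a letter drawn from [cond_x] *)
Definition miss L M b x := (1 - hit L b x) + (1 - hit L b x / L) ^+ M.+1.

Lemma cond_x_ge0 b x u : 0 <= cond_x b x u.
Proof. by rewrite divr_ge0// sumr_ge0. Qed.

Lemma cond_q_ge0 b u : 0 <= cond_q b u.
Proof. by rewrite divr_ge0// !sumr_ge0// => u' _; rewrite sumr_ge0. Qed.

Lemma sum_cond_x b x : \sum_u w b u x != 0 -> \sum_u cond_x b x u = 1.
Proof. by move=> h; rewrite -mulr_suml divff. Qed.

Lemma sum_cond_x_le1 b x : \sum_u cond_x b x u <= 1.
Proof.
have [h|/sum_cond_x ->//] := eqVneq (\sum_u w b u x) 0.
by rewrite big1 ?ler01// => u _; rewrite /cond_x h invr0 mulr0.
Qed.

Lemma sum_cond_q_le1 b : \sum_u cond_q b u <= 1.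
Proof.
rewrite -mulr_suml; have [->|h] := eqVneq (\sum_u \sum_x w b u x) 0.
  by rewrite mul0r ler01.
by rewrite divff.
Qed.

Lemma mul_cond_x b x u : (\sum_u w b u x) * cond_x b x u = w b u x.
Proof.
have [h|h] := eqVneq (\sum_u w b u x) 0; last by rewrite mulrC divfK.
rewrite h mul0r; apply/esym/eqP; rewrite eq_le w_ge0 andbT -[X in _ <= X]h.
exact: (@le_sum1 _ _ (fun u => w b u x)).
Qed.

Lemma hit_ge0 L b x : 0 <= hit L b x.
Proof. by apply: sumr_ge0 => u _; rewrite mulr_ge0 ?cond_x_ge0 ?ler0n. Qed.

Lemma hit_le1 L b x : hit L b x <= 1.
Proof.
apply: (@cover_le1 R X U (cond_q b) (cond_x b) L) => y.
  by move=> u; exact: cond_x_ge0.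
exact: sum_cond_x_le1.
Qed.

Lemma hit_div_le1 L b x : 0 < L -> hit L b x / L <= 1.
Proof.
move=> L0; apply: (@cover_div_le1 R X U (cond_q b) (cond_x b) L) => //.
- exact: cond_q_ge0.
- exact: sum_cond_q_le1.
Qed.

Lemma miss_bounds L M b x : 0 < L -> 0 <= miss L M b x <= 2.
Proof.
move=> L0; have h0 := hit_ge0 L b x; have h1 := hit_le1 L b x.
have h2 := hit_div_le1 b x L0.
have h3 : 0 <= hit L b x / L by rewrite divr_ge0// ltW.
have p0 : 0 <= (1 - hit L b x / L) ^+ M.+1 by rewrite exprn_ge0// subr_ge0.
have p1 : (1 - hit L b x / L) ^+ M.+1 <= 1.
  by rewrite exprn_ile1// ?subr_ge0// gerBl.
rewrite /miss; lra.
Qed.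

End Conditionals.

(** * Superposition codebooks *)

Section Superposition.
Context {R : realType} (X U0 U1 U2 : finType) (pi : X -> R)
  (w0 : U0 -> X -> R) (w1 : U0 -> U1 -> X -> R) (w2 : U0 -> U2 -> X -> R)
  (c1 : U0 -> U1 -> X -> R) (c2 : U0 -> U2 -> X -> R).
Hypothesis w_split : splitting pi 1 w0 w1 w2.
Hypothesis c1_bound : forall a b x, 0 <= c1 a b x <= 1.
Hypothesis c2_bound : forall a b x, 0 <= c2 a b x <= 1.
Variables (M0 M1 M2 : nat) (L0 L1 L2 : R).
Hypotheses (L0p : 0 < L0) (L1p : 0 < L1) (L2p : 0 < L2).
Variables (a0 : U0) (a1 : U1) (a2 : U2).

Let w1_ge0 a b x : 0 <= w1 a b x. Proof. by case: w_split. Qed.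
Let w2_ge0 a b x : 0 <= w2 a b x. Proof. by case: w_split. Qed.
Let sum_w1 a x : \sum_b w1 a b x = w0 a x. Proof. by case: w_split. Qed.
Let sum_w2 a x : \sum_b w2 a b x = w0 a x. Proof. by case: w_split. Qed.
Let w0_ge0 a x : 0 <= w0 a x. Proof. by rewrite -sum_w1 sumr_ge0. Qed.
Let sum_w0 x : \sum_a w0 a x = pi x.
Proof. by case: w_split => _ _ _ _ ->; rewrite mul1r. Qed.
Let pi_ge0 x : 0 <= pi x. Proof. by rewrite -sum_w0 sumr_ge0. Qed.

(** The common layer is seen as a layer over a one-point base, so that [cond_x], [cond_q] and [miss]
    apply to all three layers. *)
Let w00 (_ : unit) := w0.
Let w00_ge0 (t : unit) a x : 0 <= w00 t a x. Proof. by []. Qed.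

(** What choosing the common codeword a commits a private layer to: its mean cost, at most 1, plus
    its covering failure, at most 2. Two private layers give the bound 6 used for the common one. *)
Let layer_cost (U : finType) (w : U0 -> U -> X -> R) (c : U0 -> U -> X -> R)
  L M a x := \sum_b cond_x w a x b * c a b x + miss w L M a x.

Let layer_cost_bound (U : finType) (w c : U0 -> U -> X -> R) L M a x :
  (forall a b x, 0 <= w a b x) -> (forall a b x, 0 <= c a b x <= 1) -> 0 < L ->
  0 <= layer_cost w c L M a x <= 3.
Proof.
move=> wp cb Lp; have /andP[m0 m2] := miss_bounds wp M a x Lp.
have s0 : 0 <= \sum_b cond_x w a x b * c a b x.
  by apply: sumr_ge0 => b _; rewrite mulr_ge0 ?cond_x_ge0//; case/andP: (cb a b x).
have s1 : \sum_b cond_x w a x b * c a b x <= 1.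
  apply: le_trans (sum_cond_x_le1 w a x); apply: ler_sum => b _.
  by rewrite ler_piMr ?cond_x_ge0//; case/andP: (cb a b x).
rewrite /layer_cost; lra.
Qed.

Let sum_layer_cost (U : finType) (w c : U0 -> U -> X -> R) L M :
  (forall a b x, 0 <= w a b x) -> (forall a x, \sum_b w a b x = w0 a x) ->
  \sum_x \sum_a w0 a x * layer_cost w c L M a x =
  \sum_a \sum_b \sum_x w a b x * c a b x + \sum_a \sum_x w0 a x * miss w L M a x.
Proof.
move=> wp ws; rewrite exchange_big -big_split; apply: eq_bigr => a _ /=.
rewrite [X in _ = X + _]exchange_big -big_split; apply: eq_bigr => x _ /=.
rewrite mulrDr; congr (_ + _); rewrite mulr_sumr; apply: eq_bigr => b _.
by rewrite mulrA -ws mul_cond_x.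
Qed.

(** There is one private codebook for each common codeword, built for the source mass of the cell
    mapped to that codeword. *)
Let cell_covering (U : finType) (w c : U0 -> U -> X -> R) L M N (d : U)
    (cb0 : 'I_N -> U0) (sel0 : X -> 'I_N) :
  (forall a b x, 0 <= w a b x) -> (forall a b x, 0 <= c a b x <= 1) -> 0 < L ->
  exists (cb : 'I_N -> 'I_M.+1 -> U) (sel : X -> 'I_M.+1),
  \sum_x pi x * c (cb0 (sel0 x)) (cb (sel0 x) (sel x)) x <=
  \sum_x pi x * layer_cost w c L M (cb0 (sel0 x)) x.
Proof.
move=> wp cb Lp.
have /choice[f fP] (m : 'I_N) : exists p : ('I_M.+1 -> U) * (X -> 'I_M.+1),
    \sum_x (pi x * (sel0 x == m)%:R) * c (cb0 m) (p.1 (p.2 x)) x <=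
    \sum_x (pi x * (sel0 x == m)%:R) * layer_cost w c L M (cb0 m) x.
  have cell_ge0 x : 0 <= pi x * (sel0 x == m)%:R by rewrite mulr_ge0 ?ler0n.
  have [cbm [selm H]] := covering d cell_ge0 (cond_q_ge0 wp (cb0 m))
    (sum_cond_q_le1 w (cb0 m)) (cond_x_ge0 wp (cb0 m))
    (fun u x => proj1 (andP (cb (cb0 m) u x)))
    (fun u x => proj2 (andP (cb (cb0 m) u x))) ler01 Lp
    (sum_cond_x_le1 w (cb0 m)) M.
  exists (cbm, selm); apply: le_trans H _ => /=.
  rewrite le_eqVlt; apply/orP; left; apply/eqP; apply: eq_bigr => x _.
  by rewrite mul1r.
exists (fun m => (f m).1), (fun x => (f (sel0 x)).2 x).
have split_cells (F : 'I_N -> X -> R) : \sum_x pi x * F (sel0 x) x =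
    \sum_m \sum_x (pi x * (sel0 x == m)%:R) * F m x.
  rewrite exchange_big; apply: eq_bigr => x _ /=.
  rewrite (bigD1 (sel0 x))//= eqxx mulr1 big1 ?addr0// => m /negbTE h.
  by rewrite eq_sym h mulr0 mul0r.
rewrite (split_cells (fun m x => c (cb0 m) ((f m).1 ((f m).2 x)) x)).
rewrite (split_cells (fun m x => layer_cost w c L M (cb0 m) x)).
by apply: ler_sum => m _; exact: fP.
Qed.

(** The common codebook is chosen against the cost [C] that the private layers will incur, before
    these exist; the private codebooks are then built cell by cell. Adding the costs of the two
    receivers lets one common codebook serve both. *)
Lemma superposition_covering :
  exists (cb0 : 'I_M0.+1 -> U0) (cb1 : 'I_M0.+1 -> 'I_M1.+1 -> U1)
    (cb2 : 'I_M0.+1 -> 'I_M2.+1 -> U2) (sel0 : X -> 'I_M0.+1)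
    (sel1 : X -> 'I_M1.+1) (sel2 : X -> 'I_M2.+1),
  \sum_x pi x * c1 (cb0 (sel0 x)) (cb1 (sel0 x) (sel1 x)) x +
  \sum_x pi x * c2 (cb0 (sel0 x)) (cb2 (sel0 x) (sel2 x)) x <=
  \sum_a \sum_b \sum_x w1 a b x * c1 a b x +
  \sum_a \sum_b \sum_x w2 a b x * c2 a b x +
  \sum_a \sum_x w0 a x * miss w1 L1 M1 a x +
  \sum_a \sum_x w0 a x * miss w2 L2 M2 a x +
  6 * \sum_x pi x * miss w00 L0 M0 tt x.
Proof.
pose C a x := layer_cost w1 c1 L1 M1 a x + layer_cost w2 c2 L2 M2 a x.
have Cb a x : 0 <= C a x <= 6.
  have := layer_cost_bound M1 a x w1_ge0 c1_bound L1p.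
  have := layer_cost_bound M2 a x w2_ge0 c2_bound L2p.
  by rewrite /C; lra.
have [cb0 [sel0 H0]] := covering a0 pi_ge0 (cond_q_ge0 w00_ge0 tt)
  (sum_cond_q_le1 w00 tt) (cond_x_ge0 w00_ge0 tt)
  (fun a x => proj1 (andP (Cb a x))) (fun a x => proj2 (andP (Cb a x)))
  (ler0n R 6) L0p (sum_cond_x_le1 w00 tt) M0.
have [cb1 [sel1 H1]] := cell_covering M1 a1 cb0 sel0 w1_ge0 c1_bound L1p.
have [cb2 [sel2 H2]] := cell_covering M2 a2 cb0 sel0 w2_ge0 c2_bound L2p.
exists cb0, cb1, cb2, sel0, sel1, sel2.
apply: le_trans (lerD H1 H2) _.
apply: le_trans (_ : \sum_x pi x * C (cb0 (sel0 x)) x <= _).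
  by rewrite -big_split/=; apply: ler_sum => x _; rewrite -mulrDr.
apply: le_trans H0 _.
rewrite le_eqVlt; apply/orP; left; apply/eqP.
transitivity (\sum_x \sum_a w0 a x * C a x + 6 * \sum_x pi x * miss w00 L0 M0 tt x).
  rewrite mulr_sumr -big_split; apply: eq_bigr => x _ /=.
  rewrite mulrDr; congr (_ + _); last by rewrite mulrCA.
  rewrite mulr_sumr; apply: eq_bigr => a _; rewrite mulrA.
  by rewrite -sum_w0 (mul_cond_x w00_ge0).
congr (_ + _).
have -> : \sum_x \sum_a w0 a x * C a x =
    \sum_x \sum_a w0 a x * layer_cost w1 c1 L1 M1 a x +
    \sum_x \sum_a w0 a x * layer_cost w2 c2 L2 M2 a x.
  rewrite -big_split; apply: eq_bigr => x _; rewrite -big_split.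
  by apply: eq_bigr => a _; rewrite /= -mulrDr.
rewrite (sum_layer_cost c1 L1 M1 w1_ge0 sum_w1) (sum_layer_cost c2 L2 M2 w2_ge0 sum_w2).
ring.
Qed.

End Superposition.

Lemma sum_zip {R : realType} (I A B : finType) (F : {ffun I -> A * B} -> R) :
  \sum_w F w =
  \sum_(a : {ffun I -> A}) \sum_(b : {ffun I -> B}) F [ffun i => (a i, b i)].
Proof.
pose zip_ffun (p : {ffun I -> A} * {ffun I -> B}) : {ffun I -> A * B} :=
  [ffun i => (p.1 i, p.2 i)].
rewrite (reindex zip_ffun); first by rewrite sum_pair.
apply: onW_bij; exists (fun w : {ffun I -> A * B} => ([ffun i => (w i).1], [ffun i => (w i).2])).
  by move=> [a b]; congr pair; apply/ffunP => i; rewrite /zip_ffun !ffunE.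
by move=> w; apply/ffunP => i; rewrite /zip_ffun !ffunE /= -surjective_pairing.
Qed.

Lemma geometric_small {R : realType} (k d : R) : 0 <= k < 1 -> 0 < d ->
  exists N, forall n, (N <= n)%N -> k ^+ n <= d.
Proof.
move=> /andP[k0 k1] d0.
have /cvgr0Pnorm_le/(_ _ d0) [N _ H] := @cvg_expr R k ltac:(by rewrite ger0_norm).
by exists N => n Nn; have := H n Nn; rewrite /= ger0_norm// exprn_ge0.
Qed.

(** * Covering failure for i.i.d. words *)

Section ProductMiss.
Context {R : realType} (B U X : finType) (w : B -> U -> X -> R).
Hypothesis w_ge0 : forall b u x, 0 <= w b u x.
Hypothesis w_tot : \sum_b \sum_u \sum_x w b u x = 1.

Definition iid3 n (b : {ffun 'I_n -> B}) (u : {ffun 'I_n -> U}) (x : {ffun 'I_n -> X}) : R :=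
  \prod_i w (b i) (u i) (x i).

Lemma iid3_ge0 n b u x : 0 <= @iid3 n b u x.
Proof. exact: prodr_ge0. Qed.

Lemma sum_iid3_u n b x : \sum_u @iid3 n b u x = \prod_i \sum_u w (b i) u (x i).
Proof. by rewrite bigA_distr_bigA. Qed.

Lemma sum_iid3_x n b u : \sum_x @iid3 n b u x = \prod_i \sum_x w (b i) (u i) x.
Proof. by rewrite bigA_distr_bigA. Qed.

Lemma sum_iid3_ux n b : \sum_u \sum_x @iid3 n b u x = \prod_i \sum_u \sum_x w (b i) u x.
Proof. by rewrite bigA_distr_bigA; apply: eq_bigr => u _; exact: sum_iid3_x. Qed.

Lemma cond_x_iid3 n b x u : cond_x (@iid3 n) b x u = \prod_i cond_x w (b i) (x i) (u i).
Proof. by rewrite /cond_x sum_iid3_u prodf_div. Qed.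

Lemma cond_q_iid3 n b u : cond_q (@iid3 n) b u = \prod_i cond_q w (b i) (u i).
Proof. by rewrite /cond_q sum_iid3_ux sum_iid3_x prodf_div. Qed.

(** I(U;X|B), the mean of the log of [ratio]. *)
Let info := \sum_b entropy (fun x => \sum_u w b u x) - \sum_b \sum_u entropy (w b u).

Let ratio (s : B * U * X) := cond_x w s.1.1 s.2 s.1.2 / cond_q w s.1.1 s.1.2.

Let pos b u x : 0 < w b u x -> [/\ 0 < \sum_x w b u x, 0 < \sum_u w b u x &
  0 < \sum_u \sum_x w b u x].
Proof.
move=> h; split; first exact: sum_gt0 h.
  exact: (@sum_gt0 _ _ (fun u => w b u x) u).
by apply: (@sum_gt0 _ _ _ u) => [v|]; [exact: sumr_ge0|exact: sum_gt0 h].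
Qed.

Let ratio_gt0 s : 0 < w s.1.1 s.1.2 s.2 -> 0 < ratio s.
Proof.
by move=> h; have [h1 h2 h3] := pos h; rewrite /ratio /cond_x /cond_q !divr_gt0.
Qed.

Let mean_ratio : \sum_(s : B * U * X) w s.1.1 s.1.2 s.2 * log2 (ratio s) = info.
Proof.
rewrite 2!sum_pair /info -sumrB; apply: eq_bigr => b _.
rewrite (entropy_gapE (w b)); apply: eq_bigr => u _; apply: eq_bigr => x _ /=.
have := w_ge0 b u x; rewrite le_eqVlt => /predU1P[<-|h]; first by rewrite !mul0r.
have [h1 h2 h3] := pos h; congr (_ * _).
by rewrite /ratio /cond_x /cond_q !log2_div ?divr_gt0//; ring.
Qed.

Let w_pmf : is_pmf (fun s : B * U * X => w s.1.1 s.1.2 s.2).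
Proof. by split => //; rewrite 2!sum_pair. Qed.

Let miss_mass n L : \sum_b \sum_x (\sum_u @iid3 n b u x) * (1 - hit (@iid3 n) L b x) =
  \sum_b \sum_x \sum_u iid3 b u x *
    (1 - (cond_x (@iid3 n) b x u <= L * cond_q (@iid3 n) b u)%R%:R).
Proof.
apply: eq_bigr => b _; apply: eq_bigr => x _.
rewrite mulrBr mulr1 mulr_sumr -sumrB; apply: eq_bigr => u _.
by rewrite mulrBr mulr1 mulrA (mul_cond_x (@iid3_ge0 n)).
Qed.

(** If the information is 0, u is independent of x given b, the density never exceeds 1 and L = 1
    leaves no failure; this settles rate 0. Otherwise L grows at a rate [a] strictly between
    information and r: the density rarely exceeds L, by Chernoff, while L is negligible against the
    number of codewords. *)
Lemma miss_iid3 (r d : R) : 0 <= r -> info = 0 \/ info < r -> 0 < d ->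
  exists N, forall n, (N <= n)%N -> exists2 L, 0 < L &
    \sum_b \sum_x (\sum_u @iid3 n b u x) *
      miss (@iid3 n) L (Num.truncn (2 `^ (n%:R * r))) b x <= d.
Proof.
move=> rp [info0|info_lt] d0.
  have cond_le b u x : cond_x w b x u <= cond_q w b u.
    have [h|h] := eqVneq (w b u x) 0.
      by rewrite /cond_x h mul0r cond_q_ge0.
    have wp : 0 < w b u x by rewrite lt_neqAle eq_sym h w_ge0.
    have [h1 h2 h3] := pos wp.
    have gap_ge0 b' : \sum_u entropy (w b' u) <= entropy (fun x => \sum_u w b' u x).
      exact: entropy_superadd.
    have E : \sum_u entropy (w b u) = entropy (fun x => \sum_u w b u x).
      apply/eqP; rewrite eq_sym -subr_eq0.
      move: info0; rewrite /info -sumrB => /eqP; rewrite psumr_eq0; last first.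
        by move=> b' _; rewrite subr_ge0.
      by move=> /allP/(_ b); rewrite mem_index_enum => /(_ isT).
    have := entropy_superadd_eq (w_ge0 b) E wp => e.
    rewrite /cond_x /cond_q ler_pdivrMr// mulrAC ler_pdivlMr// e mulrC.
    by rewrite mulrC.
  exists 0%N => n _; exists 1 => //; rewrite big1 ?(ltW d0)// => b _.
  rewrite big1// => x _.
  have [->|h] := eqVneq (\sum_u iid3 b u x) 0; first by rewrite mul0r.
  have hit1 : hit (@iid3 n) 1 b x = 1.
    rewrite -[RHS](sum_cond_x h); apply: eq_bigr => u _.
    rewrite mul1r.
    suff -> : cond_x (@iid3 n) b x u <= cond_q (@iid3 n) b u by rewrite mulr1.
    rewrite cond_x_iid3 cond_q_iid3; apply: ler_prod => i _.
    by rewrite cond_x_ge0 ?cond_le.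
  by rewrite /miss hit1 divr1 subrr expr0n/= addr0 mulr0.
pose a := (info + r) / 2.
have Ha : \sum_(s : B * U * X) w s.1.1 s.1.2 s.2 * log2 (ratio s) < a.
  by rewrite mean_ratio /a; lra.
have [k [k01 Hk]] := chernoff_bound w_pmf ratio_gt0 Ha.
have a_lt : info < a /\ a < r by rewrite /a; lra.
have ar : 0 <= 2 `^ (a - r) < 1.
  rewrite powR_ge0/= /powR ifF; last by apply/eqP; lra.
  by rewrite expR_lt1 pmulr_llt0 ?ln2_gt0// subr_lt0; case: a_lt.
have d4 : 0 < d / 4 by rewrite divr_gt0.
have [N1 h1] := geometric_small k01 d4.
have [N2 h2] := geometric_small ar d4.
exists (maxn N1 N2) => n; rewrite geq_max => /andP[n1 n2].
exists (2 `^ (n%:R * a)); first by rewrite powR_gt0.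
set L := 2 `^ (n%:R * a); set M := Num.truncn _.
have L0 : 0 < L by rewrite powR_gt0.
have LM : L / M.+1%:R <= d / 4.
  apply: le_trans (h2 n n2).
  rewrite ler_pdivrMr ?ltr0n//; apply: (@le_trans _ _ ((2 `^ (a - r)) ^+ n * 2 `^ (n%:R * r))).
    rewrite -powR_mulrn ?powR_ge0// -powRrM -powR2D le_eqVlt; apply/orP; left.
    by apply/eqP; congr (_ `^ _); ring.
  rewrite ler_wpM2l ?exprn_ge0 ?powR_ge0//; apply: ltW; exact: truncnS_gt.
have W0 b x : 0 <= \sum_u @iid3 n b u x by apply: sumr_ge0 => u _; exact: iid3_ge0.
have Wtot : \sum_b \sum_x \sum_u @iid3 n b u x = 1.
  under eq_bigr do rewrite exchange_big/= sum_iid3_ux.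
  by rewrite -(bigA_distr_bigA (fun (_ : 'I_n) b => \sum_u \sum_x w b u x)) big1.
(* By [miss_le], the failure counts 1 - hit twice, once directly and once through the power, plus L
   / (M + 1). *)
apply: (@le_trans _ _ (2 * (\sum_b \sum_x (\sum_u @iid3 n b u x) *
    (1 - hit (@iid3 n) L b x)) + L / M.+1%:R)).
  have LE : L / M.+1%:R = \sum_b \sum_x (\sum_u @iid3 n b u x) * (L / M.+1%:R).
    rewrite -[LHS]mul1r -[X in X * _]Wtot mulr_suml.
    by apply: eq_bigr => b _; rewrite mulr_suml.
  rewrite [X in _ <= _ + X]LE mulr_sumr -big_split.
  apply: ler_sum => b _; rewrite /= mulr_sumr -big_split.
  apply: ler_sum => x _ /=.
  have -> : 2 * ((\sum_u @iid3 n b u x) * (1 - hit (@iid3 n) L b x)) +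
      (\sum_u @iid3 n b u x) * (L / M.+1%:R) = (\sum_u @iid3 n b u x) *
      ((1 - hit (@iid3 n) L b x) + ((1 - hit (@iid3 n) L b x) + L / M.+1%:R)) by ring.
  rewrite ler_wpM2l// lerD2l; apply: miss_le => //.
    by rewrite hit_ge0 ?hit_le1//; exact: iid3_ge0.
  by apply: hit_div_le1 => //; exact: iid3_ge0.
suff : \sum_b \sum_x (\sum_u @iid3 n b u x) * (1 - hit (@iid3 n) L b x) <= d / 4.
  move=> hX; apply: le_trans (lerD (ler_wpM2l (ler0n R 2) hX) LM) _.
  have -> : 2 * (d / 4) + d / 4 = d * (3 / 4) by field.
  by rewrite ler_piMr ?(ltW d0)//; lra.
rewrite miss_mass; apply: le_trans (h1 n n1); apply: le_trans (Hk n).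
rewrite 2!sum_zip; apply: ler_sum => b _; rewrite exchange_big.
apply: ler_sum => u _; apply: ler_sum => x _.
have -> : iid (fun s : B * U * X => w s.1.1 s.1.2 s.2)
    [ffun i => ([ffun j => (b j, u j)] i, x i)] = iid3 b u x.
  by apply: eq_bigr => i _; rewrite !ffunE.
have := iid3_ge0 b u x; rewrite le_eqVlt => /predU1P[<-|h]; first by rewrite !mul0r.
rewrite ler_wpM2l ?iid3_ge0//.
have wi i : 0 < w (b i) (u i) (x i).
  rewrite lt_neqAle w_ge0 andbT eq_sym; apply: contraTneq h => wz.
  by rewrite /iid3 (bigD1 i)//= wz mul0r ltxx.
have q0 : 0 < cond_q (@iid3 n) b u.
  rewrite cond_q_iid3; apply: prodr_gt0 => i _.
  by have [g1 g2 g3] := pos (wi i); rewrite divr_gt0.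
have -> : \prod_i ratio ([ffun i => ([ffun j => (b j, u j)] i, x i)] i) =
    cond_x (@iid3 n) b x u / cond_q (@iid3 n) b u.
  by rewrite cond_x_iid3 cond_q_iid3 -prodf_div; apply: eq_bigr => i _; rewrite !ffunE.
have [_|lt] := leP (cond_x (@iid3 n) b x u); first by rewrite subrr ler0n.
by rewrite subr0 ler_pdivlMr// (ltW lt).
Qed.

End ProductMiss.

(* The likelihood-ratio test of J = P_{A B} V against P_{A B} x P_Y. *)
Section LikelihoodTest.
Context {R : realType} (A B X Y : finType) (P : X -> R) (V : X -> Y -> R)
  (w : A -> B -> X -> R) (t : R).
Hypothesis P_pmf : is_pmf P.
Hypothesis V_pmf : forall x, is_pmf (V x).
Hypothesis w_ge0 : forall a b x, 0 <= w a b x.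
Hypothesis sum_w : forall x, \sum_a \sum_b w a b x = P x.

Let J a b y := push V (w a b) y.
Let PY := push V P.
Let V_ge0 x y : 0 <= V x y. Proof. by case: (V_pmf x). Qed.
Let J_ge0 a b y : 0 <= J a b y. Proof. exact: push_ge0. Qed.
Let PY_pmf : is_pmf PY. Proof. exact: push_pmf. Qed.

Definition density a b y := push V (w a b) y / ((\sum_x w a b x) * push V P y).

Definition accept n (a : {ffun 'I_n -> A}) (b : {ffun 'I_n -> B}) (y : {ffun 'I_n -> Y}) :=
  2 `^ (n%:R * t) <= \prod_i density (a i) (b i) (y i).

(** The type-I error once the source word and the codewords are fixed; it is the cost minimised by
    the covering. *)
Definition reject_cost n (a : {ffun 'I_n -> A}) (b : {ffun 'I_n -> B})
    (x : {ffun 'I_n -> X}) : R :=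
  \sum_y iid_kernel V x y * (~~ accept a b y)%:R.

Let sum_J a b : \sum_y J a b y = \sum_x w a b x.
Proof.
rewrite exchange_big; apply: eq_bigr => x _.
by have [_ h] := V_pmf x; rewrite -mulr_sumr h mulr1.
Qed.

Let col_J y : \sum_a \sum_b J a b y = PY y.
Proof.
under eq_bigr do rewrite push_sum.
by rewrite push_sum; apply: eq_bigr => x _; rewrite sum_w.
Qed.

Let J_pos a b y : 0 < J a b y -> 0 < \sum_x w a b x /\ 0 < PY y.
Proof.
move=> h; split; first by rewrite -sum_J; exact: sum_gt0 h.
rewrite -col_J; apply: (@sum_gt0 _ _ _ a) => [a'|]; first exact: sumr_ge0.
exact: (@sum_gt0 _ _ (fun b => J a b y) b).
Qed.

Lemma density_ge0 a b y : 0 <= density a b y.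
Proof.
apply: divr_ge0; first exact: J_ge0.
by apply: mulr_ge0; [exact: sumr_ge0|case: PY_pmf].
Qed.

Lemma reject_cost_bounds n a b x : 0 <= @reject_cost n a b x <= 1.
Proof.
have V0 y : 0 <= @iid_kernel R X Y V n x y by exact: iid_kernel_ge0.
apply/andP; split; first by apply: sumr_ge0 => y _; rewrite mulr_ge0 ?ler0n.
rewrite -(@sum_iid_kernel R X Y V n x); last by move=> x'; case: (V_pmf x').
by apply: ler_sum => y _; rewrite ler_piMr// lern1 leq_b1.
Qed.

Let mean_density : \sum_(s : A * B * Y) J s.1.1 s.1.2 s.2 *
    log2 (density s.1.1 s.1.2 s.2)^-1 =
  \sum_a \sum_b entropy (J a b) - entropy PY.
Proof.
have := @entropy_gapE R (A * B)%type Y (fun p => J p.1 p.2).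
rewrite sum_pair.
have -> : (fun y => \sum_p J p.1 p.2 y) = PY.
  by apply/funext => y; rewrite sum_pair/= col_J.
have -> : \sum_p \sum_y J p.1 p.2 y = 1.
  rewrite exchange_big/= -[RHS](proj2 PY_pmf); apply: eq_bigr => y _.
  by rewrite sum_pair/= col_J.
move=> E; rewrite -[LHS]opprK -opprB; congr (- _); rewrite E.
rewrite -sumrN sum_pair; apply: eq_bigr => -[a b] _; apply: eq_bigr => y _ /=.
have := J_ge0 a b y; rewrite le_eqVlt => /predU1P[<-|h]; first by rewrite !mul0r oppr0.
have [h1 h2] := J_pos h; rewrite -mulrN; congr (_ * _).
rewrite log2V ?divr_gt0 ?mulr_gt0// opprK /density log2_div ?mulr_gt0// log2M//.
rewrite sum_J log2_1 -/(J a b y) -/(PY y) sum_pair/= col_J; ring.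
Qed.

(** Under the joint law the inverse density has mean log equal to minus the information between (A,
    B) and Y, hence below -t, and the Chernoff bound applies to it. *)
Lemma reject_small d : 0 < d ->
  t + \sum_a \sum_b entropy (push V (w a b)) < entropy (push V P) ->
  exists N, forall n, (N <= n)%N ->
    \sum_a \sum_b \sum_x iid3 w a b x * @reject_cost n a b x <= d.
Proof.
move=> d0 ht.
have J_pmf : is_pmf (fun s : A * B * Y => J s.1.1 s.1.2 s.2).
  split => //; rewrite 2!sum_pair exchange_big /= -[RHS](proj2 PY_pmf).
  under eq_bigr do rewrite exchange_big/=.
  rewrite exchange_big/=; apply: eq_bigr => y _.
  by rewrite exchange_big; exact: col_J.
have g0 (s : A * B * Y) : 0 < J s.1.1 s.1.2 s.2 -> 0 < (density s.1.1 s.1.2 s.2)^-1.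
  by move=> h; have [h1 h2] := J_pos h; rewrite invr_gt0 divr_gt0 ?mulr_gt0.
have Hmean : \sum_(s : A * B * Y) J s.1.1 s.1.2 s.2 *
    log2 (density s.1.1 s.1.2 s.2)^-1 < - t.
  by rewrite mean_density; move: ht; rewrite -/J -/PY; lra.
have [k [k01 Hk]] := chernoff_bound J_pmf g0 Hmean.
have [N HN] := geometric_small k01 d0.
exists N => n Nn; apply: le_trans (HN n Nn); apply: le_trans (Hk n).
rewrite 2!sum_zip; apply: ler_sum => a _; apply: ler_sum => b _.
have -> : \sum_x iid3 w a b x * reject_cost a b x =
    \sum_y iid3 J a b y * (~~ accept a b y)%:R.
  under eq_bigr do rewrite mulr_sumr.
  rewrite exchange_big; apply: eq_bigr => y _ /=.
  under eq_bigr do rewrite mulrA; rewrite -mulr_suml; congr (_ * _).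
  rewrite /iid3 bigA_distr_bigA; apply: eq_bigr => x _.
  by rewrite -big_split.
apply: ler_sum => y _.
have -> : iid (fun s : A * B * Y => J s.1.1 s.1.2 s.2)
    [ffun i => ([ffun j => (a j, b j)] i, y i)] = iid3 J a b y.
  by apply: eq_bigr => i _; rewrite !ffunE.
have Jn0 : 0 <= iid3 J a b y by exact: iid3_ge0.
rewrite le_eqVlt in Jn0; case/predU1P: Jn0 => [<-|Jn0]; first by rewrite !mul0r.
rewrite ler_wpM2l ?(ltW Jn0)//.
have -> : \prod_i (density ([ffun i0 => ([ffun j => (a j, b j)] i0, y i0)] i).1.1
    ([ffun i0 => ([ffun j => (a j, b j)] i0, y i0)] i).1.2
    ([ffun i0 => ([ffun j => (a j, b j)] i0, y i0)] i).2)^-1 =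
    (\prod_i density (a i) (b i) (y i))^-1.
  by rewrite -prodfV; apply: eq_bigr => i _; rewrite !ffunE.
have D0 : 0 < \prod_i density (a i) (b i) (y i).
  apply: prodr_gt0 => i _.
  have Ji : 0 < J (a i) (b i) (y i).
    rewrite lt_neqAle J_ge0 andbT eq_sym; apply: contraTneq Jn0 => h.
    by rewrite /iid3 (bigD1 i)//= h mul0r ltxx.
  by have [h1 h2] := J_pos Ji; rewrite divr_gt0 ?mulr_gt0.
rewrite /accept; have [_|lt] := leP (2 `^ (n%:R * t)); first by rewrite ler0n.
rewrite mulrN powRN lef_pV2 ?posrE ?powR_gt0//.
by rewrite (ltW lt).
Qed.

Lemma accept_small n (a : {ffun 'I_n -> A}) b :
  \sum_y iid (push V P) y * (accept a b y)%:R <= 2 `^ (- (n%:R * t)).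
Proof.
have PY0 y : 0 <= PY y by case: PY_pmf.
have D0 a' b' y : 0 <= density a' b' y by exact: density_ge0.
apply: (@le_trans _ _ (\sum_(y : {ffun 'I_n -> Y}) (\prod_i PY (y i) *
    \prod_i density (a i) (b i) (y i)) * 2 `^ (- (n%:R * t)))).
  apply: ler_sum => y _; rewrite -mulrA ler_wpM2l ?prodr_ge0//.
  rewrite powRN /accept; have [h|_] := leP (2 `^ (n%:R * t)); last first.
    by rewrite mulr_ge0 ?invr_ge0 ?powR_ge0// prodr_ge0.
  by rewrite ler_pdivlMr ?powR_gt0// mul1r.
(* For fixed codewords the mean of the product density under the output law factorises, and each
   factor is at most 1. *)
rewrite -mulr_suml ler_piMl ?powR_ge0//.
under eq_bigr do rewrite -big_split/=.
rewrite -(bigA_distr_bigA (fun i y => PY y * density (a i) (b i) y)).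
apply: prodr_ile1 => i _; apply/andP; split.
  by apply: sumr_ge0 => y _; exact: mulr_ge0.
have m0 : 0 <= \sum_x w (a i) (b i) x by exact: sumr_ge0.
apply: (@le_trans _ _ (\sum_y J (a i) (b i) y / \sum_x w (a i) (b i) x)).
  apply: ler_sum => y _; rewrite /density -/(PY y) -/(J _ _ y).
  have [->|h] := eqVneq (PY y) 0; first by rewrite mul0r divr_ge0.
  by rewrite invfM mulrCA [PY y * _]mulrCA divff// mulr1.
rewrite -mulr_suml sum_J.
by have [->|h] := eqVneq (\sum_x w (a i) (b i) x) 0; [rewrite mul0r ler01|rewrite divff].
Qed.

End LikelihoodTest.

(** * Codes for the points of the region *)

Section Achievability.
Context {R : realType} (X Y1 Y2 Z1 Z2 : finType).
Notation source := (X * Y1 * Y2 * Z1 * Z2)%type.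
Notation pX := (@srcX X Y1 Y2 Z1 Z2).
Notation pY1 := (@srcY1 X Y1 Y2 Z1 Z2).
Notation pY2 := (@srcY2 X Y1 Y2 Z1 Z2).
Notation pZ1 := (@srcZ1 X Y1 Y2 Z1 Z2).
Notation pZ2 := (@srcZ2 X Y1 Y2 Z1 Z2).
Variables (P : source -> R) (z1 : Z1) (z2 : Z2).
Hypothesis P_pmf : is_pmf P.
Hypothesis P_z1 : law P pZ1 z1 = 1.
Hypothesis P_z2 : law P pZ2 z2 = 1.
Variables (R0 R1 R2 : R).
Hypotheses (R0p : 0 <= R0) (R1p : 0 <= R1) (R2p : 0 <= R2).
Let PX := law P pX.
Let V1 := kernel P pX pY1.
Let V2 := kernel P pX pY2.

Let V1p x : is_pmf (V1 x).
Proof. by split; [exact: kernel_ge0|exact: sum_kernel]. Qed.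

Let V2p x : is_pmf (V2 x).
Proof. by split; [exact: kernel_ge0|exact: sum_kernel]. Qed.

Let PXp : is_pmf PX. Proof. exact: law_pmf. Qed.

Local Notation code n := (Defs.code X Y1 Y2 Z1 Z2 R0 R1 R2 n).
Local Notation M0 n := (Num.truncn (2 `^ (n%:R * R0))).
Local Notation M1 n := (Num.truncn (2 `^ (n%:R * R1))).
Local Notation M2 n := (Num.truncn (2 `^ (n%:R * R2))).

Let point_enc n (f : {ffun 'I_n -> X} -> msg R0 n * msg R1 n * msg R2 n) x m : R :=
  (m == f x)%:R.

Let sum_point n (f : {ffun 'I_n -> X} -> msg R0 n * msg R1 n * msg R2 n) x
    (F : msg R0 n * msg R1 n * msg R2 n -> R) :
  \sum_m point_enc f x m * F m = F (f x).
Proof.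
rewrite (bigD1 (f x))//= /point_enc eqxx mul1r big1 ?addr0// => m /negbTE ->.
by rewrite mul0r.
Qed.

Let point_enc_pmf n f x : is_pmf (@point_enc n f x).
Proof.
split; first by move=> m; rewrite ler0n.
by have := sum_point f x (fun=> 1); under eq_bigr do rewrite mulr1.
Qed.

(** Every code has exponent at least 0; this covers the case where an exponent is truncated at 0. *)
Lemma decide_prob_alt_le1 n (c : code n) :
  decide_prob1 (alt_law P) c false <= 1 /\ decide_prob2 (alt_law P) c false <= 1.
Proof.
have bound (Y : finType) (Q : Y -> R) (T : {ffun 'I_n -> Y} ->
    msg R0 n * msg R1 n * msg R2 n -> bool) : is_pmf Q ->
    \sum_x \sum_m \sum_y iid PX x * enc c x m *
      @iid_kernel R X Y (fun=> Q) n x y * (T y m)%:R <= 1.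
  move=> Qp; rewrite -[leRHS](sum_transmission P_pmf c (fun=> Qp)).
  apply: ler_sum => x _; apply: ler_sum => m _; apply: ler_sum => y _.
  apply: ler_piMr; last by rewrite lern1 leq_b1.
  apply: mulr_ge0; first apply: mulr_ge0.
  - by apply: prodr_ge0 => i _; exact: law_ge0.
  - by case: (enc_pmf c x).
  - by apply: prodr_ge0 => i _; case: Qp.
split.
  rewrite (decide_prob1E _ _ (alt_law_z1 P_pmf P_z1 P_z2) (law_alt1 P_pmf P_z1 P_z2)).
  exact: bound (law_pmf P_pmf _).
rewrite (decide_prob2E _ _ (alt_law_z2 P_pmf P_z1 P_z2) (law_alt2 P_pmf P_z1 P_z2)).
exact: bound (law_pmf P_pmf _).
Qed.

(** An information bounded by 0 is exactly 0, being nonnegative; this produces the alternative that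
    [miss_iid3] asks for. *)
Let info_cases (B U T : finType) (w : B -> U -> T -> R) (v : B -> T -> R) (r r' : R) :
  (forall b u x, 0 <= w b u x) -> (forall b x, \sum_u w b u x = v b x) ->
  \sum_b entropy (v b) <= r + \sum_b \sum_u entropy (w b u) -> r = 0 \/ r < r' ->
  \sum_b entropy (fun x => \sum_u w b u x) - \sum_b \sum_u entropy (w b u) = 0 \/
  \sum_b entropy (fun x => \sum_u w b u x) - \sum_b \sum_u entropy (w b u) < r'.
Proof.
move=> wp wv.
have -> : \sum_b entropy (fun x => \sum_u w b u x) = \sum_b entropy (v b).
  by apply: eq_bigr => b _; apply: eq_entropy => x.
have : \sum_b \sum_u entropy (w b u) <= \sum_b entropy (v b).
  apply: ler_sum => b _; rewrite (_ : v b = fun x => \sum_u w b u x).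
    exact: entropy_superadd.
  by apply/funext => x; rewrite wv.
move=> h1 h2 [h3|h3]; [left|right; lra].
by apply/eqP; rewrite eq_le; apply/andP; split; lra.
Qed.

Let sum_point_code (Y : finType) (V : X -> Y -> R) n f
    (g : {ffun 'I_n -> Y} -> msg R0 n * msg R1 n * msg R2 n -> R) :
  \sum_x \sum_m \sum_y
    iid PX x * point_enc f x m * iid_kernel V x y * g y m =
  \sum_x iid PX x * \sum_y iid_kernel V x y * g y (f x).
Proof.
apply: eq_bigr => x _.
rewrite -[RHS](sum_point f x (fun m => iid PX x *
  \sum_y iid_kernel V x y * g y m)).
apply: eq_bigr => m _; rewrite mulrCA mulr_sumr mulr_sumr.
by apply: eq_bigr => y _; ring.
Qed.

Lemma decide_prob1_point n (c : code n) f
    (F : {ffun 'I_n -> X} -> {ffun 'I_n -> Y1} -> bool) :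
  enc c = point_enc f ->
  (forall x y, dec1 c y [ffun=> z1] (f x).1.1 (f x).1.2 = F x y) ->
  forall (Q : source -> R) (V : X -> Y1 -> R) d,
  (forall s, Q s != 0 -> srcZ1 s = z1) ->
  (forall x y, law Q [% pX, pY1] (x, y) = PX x * V x y) ->
  decide_prob1 Q c d =
  \sum_x iid PX x * \sum_y iid_kernel V x y * (F x y == d)%:R.
Proof.
move=> cf cF Q V d Qz QV; rewrite (decide_prob1E _ _ Qz QV) cf.
rewrite (sum_point_code V f
  (fun y m => (dec1 c y [ffun=> z1] m.1.1 m.1.2 == d)%:R)).
by apply: eq_bigr => x _; under eq_bigr do rewrite cF.
Qed.

Lemma decide_prob2_point n (c : code n) f
    (F : {ffun 'I_n -> X} -> {ffun 'I_n -> Y2} -> bool) :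
  enc c = point_enc f ->
  (forall x y, dec2 c y [ffun=> z2] (f x).1.1 (f x).2 = F x y) ->
  forall (Q : source -> R) (V : X -> Y2 -> R) d,
  (forall s, Q s != 0 -> srcZ2 s = z2) ->
  (forall x y, law Q [% pX, pY2] (x, y) = PX x * V x y) ->
  decide_prob2 Q c d =
  \sum_x iid PX x * \sum_y iid_kernel V x y * (F x y == d)%:R.
Proof.
move=> cf cF Q V d Qz QV; rewrite (decide_prob2E _ _ Qz QV) cf.
rewrite (sum_point_code V f
  (fun y m => (dec2 c y [ffun=> z2] m.1.1 m.2 == d)%:R)).
by apply: eq_bigr => x _; under eq_bigr do rewrite cF.
Qed.

(** Type-I errors are bounded for every positive n; lengths too short for the covering use the code
    that always accepts. *)
Lemma trivial_code n : exists c : code n,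
  decide_prob1 P c true = 0 /\ decide_prob2 P c true = 0.
Proof.
pose c := @Defs.Code R X Y1 Y2 Z1 Z2 R0 R1 R2 n
  (point_enc (fun=> (ord0, ord0, ord0))) (point_enc_pmf _)
  (fun _ _ _ _ => false) (fun _ _ _ _ => false).
exists c; split; rewrite /decide_prob1 /decide_prob2.
  by rewrite big1// => w _; rewrite big1// => m _; rewrite mulr0.
by rewrite big1// => w _; rewrite big1// => m _; rewrite mulr0.
Qed.

(** With rejection as cost, the covering controls the sum of the two type-I errors, while the
    type-II bound holds for each pair of codewords separately and survives any selection. *)
Lemma Region_codes r0 r1 r2 s1 s2 t1 t2 eps :
  Region PX V1 V2 1 r0 r1 r2 s1 s2 ->
  r0 = 0 \/ r0 < R0 -> r1 = 0 \/ r1 < R1 -> r2 = 0 \/ r2 < R2 ->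
  t1 < s1 -> t2 < s2 -> 0 < eps ->
  exists N, forall n, (N <= n)%N -> exists c : code n,
    [/\ decide_prob1 P c true <= eps, decide_prob2 P c true <= eps,
        decide_prob1 (alt_law P) c false <= 2 `^ (- (n%:R * t1)) &
        decide_prob2 (alt_law P) c false <= 2 `^ (- (n%:R * t2))].
Proof.
move=> [A0 [A1 [A2 [w0 [w1 [w2 [S [E0 E1 E2 E3 E4]]]]]]]] h0 h1 h2 ht1 ht2 eps0.
have [[a0] [a1] [a2]] := splitting_inh PXp S.
have [w1p w2p sw1 sw2 sw0] := S.
have w0p a x : 0 <= w0 a x by rewrite -sw1 sumr_ge0.
pose w00 (_ : unit) := w0.
have tot1 : \sum_a \sum_b \sum_x w1 a b x = 1.
  rewrite -[RHS](proj2 PXp); under eq_bigr do rewrite exchange_big/=.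
  rewrite exchange_big; apply: eq_bigr => x _; rewrite -[RHS]mul1r -sw0.
  by apply: eq_bigr => a _; rewrite sw1.
have tot2 : \sum_a \sum_b \sum_x w2 a b x = 1.
  rewrite -[RHS](proj2 PXp); under eq_bigr do rewrite exchange_big/=.
  rewrite exchange_big; apply: eq_bigr => x _; rewrite -[RHS]mul1r -sw0.
  by apply: eq_bigr => a _; rewrite sw2.
have tot0 : \sum_(u : unit) \sum_a \sum_x w00 u a x = 1.
  rewrite sum_unit -[RHS](proj2 PXp) exchange_big; apply: eq_bigr => x _.
  by rewrite -[RHS]mul1r -sw0.
have sum1 x : \sum_a \sum_b w1 a b x = PX x.
  by rewrite -[RHS]mul1r -sw0; apply: eq_bigr => a _; rewrite sw1.
have sum2 x : \sum_a \sum_b w2 a b x = PX x.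
  by rewrite -[RHS]mul1r -sw0; apply: eq_bigr => a _; rewrite sw2.
(* Ten shares: one for each rejection cost, one for each private covering failure, six for the
   common failure with its factor 6. *)
have e0 : 0 < eps / 10 by rewrite divr_gt0.
rewrite !mul1r in E0 E3 E4.
have [||N0 m0] := @miss_iid3 R unit A0 X w00 _ tot0 R0 (eps / 10) R0p _ e0.
- by move=> u a x; exact: w0p.
- apply: (info_cases (v := fun=> PX) (r := r0)) => //.
  + by move=> u x; rewrite -[RHS]mul1r -sw0.
  + by rewrite !sum_unit.
have [N1 m1] := miss_iid3 w1p tot1 R1p (info_cases w1p sw1 E1 h1) e0.
have [N2 m2] := miss_iid3 w2p tot2 R2p (info_cases w2p sw2 E2 h2) e0.
have [|N3 l1] := reject_small (t := t1) PXp V1p w1p sum1 e0.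
  by move: E3 ht1; lra.
have [|N4 l2] := reject_small (t := t2) PXp V2p w2p sum2 e0.
  by move: E4 ht2; lra.
exists (maxn N0 (maxn (maxn N1 N2) (maxn N3 N4))) => n.
rewrite !geq_max => /andP[n0 /andP[/andP[n1 n2] /andP[n3 n4]]].
have [L0 L0p H0] := m0 n n0.
have [L1 L1p H1] := m1 n n1.
have [L2 L2p H2] := m2 n n2.
have K1 := l1 n n3; have K2 := l2 n n4.
pose v0 (a : {ffun 'I_n -> A0}) (x : {ffun 'I_n -> X}) := \prod_i w0 (a i) (x i).
have S' : splitting (@iid R X PX n) 1 v0 (@iid3 R A0 A1 X w1 n) (@iid3 R A0 A2 X w2 n).
  split.
  - by move=> *; exact: iid3_ge0.
  - by move=> *; exact: iid3_ge0.
  - by move=> a x; rewrite sum_iid3_u; apply: eq_bigr => i _; rewrite sw1.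
  - by move=> a x; rewrite sum_iid3_u; apply: eq_bigr => i _; rewrite sw2.
  - move=> x; rewrite mul1r -(bigA_distr_bigA (fun i a => w0 a (x i))).
    by apply: eq_bigr => i _; rewrite sw0 mul1r.
pose c1 a b x := @reject_cost R A0 A1 X Y1 PX V1 w1 t1 n a b x.
pose c2 a b x := @reject_cost R A0 A2 X Y2 PX V2 w2 t2 n a b x.
have c1b a b x : 0 <= c1 a b x <= 1 by exact: reject_cost_bounds.
have c2b a b x : 0 <= c2 a b x <= 1 by exact: reject_cost_bounds.
have [cb0 [cb1 [cb2 [sel0 [sel1 [sel2 HC]]]]]] := superposition_covering S'
  c1b c2b (M0 n) (M1 n) (M2 n) L0p L1p L2p [ffun=> a0] [ffun=> a1] [ffun=> a2].
have S3 := let: And5 _ _ h _ _ := S' in h.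
have S4 := let: And5 _ _ _ h _ := S' in h.
have {}H1 : \sum_a \sum_x v0 a x * miss (@iid3 R A0 A1 X w1 n) L1 (M1 n) a x <= eps / 10.
  by apply: le_trans H1; under [leRHS]eq_bigr do under eq_bigr do rewrite S3.
have {}H2 : \sum_a \sum_x v0 a x * miss (@iid3 R A0 A2 X w2 n) L2 (M2 n) a x <= eps / 10.
  by apply: le_trans H2; under [leRHS]eq_bigr do under eq_bigr do rewrite S4.
(* Here the base of the block law is the set of words over [unit]; the sum over them is bounded
   below by the term of the constant word. *)
have {}H0 : \sum_x iid PX x * miss (fun _ : unit => v0) L0 (M0 n) tt x <= eps / 10.
  apply: le_trans H0.
  apply: le_trans (le_sum1 [ffun=> tt] _); last first.
    move=> u; apply: sumr_ge0 => x _; rewrite mulr_ge0 ?sumr_ge0//.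
      by move=> a _; apply: iid3_ge0 => ? ? ?; exact: w0p.
    have w00n b a x' : 0 <= @iid3 R unit A0 X w00 n b a x'.
      by apply: iid3_ge0 => ? ? ?; exact: w0p.
    by case/andP: (miss_bounds w00n (M0 n) u x L0p).
  apply: ler_sum => x _.
  have -> : iid PX x = \sum_a v0 a x.
    by case: S' => _ _ _ _ ->; rewrite mul1r.
  by [].
pose c := @Defs.Code R X Y1 Y2 Z1 Z2 R0 R1 R2 n
  (point_enc (fun x => (sel0 x, sel1 x, sel2 x))) (point_enc_pmf _)
  (fun y _ m0 m1 => ~~ accept PX V1 w1 t1 (cb0 m0) (cb1 m0 m1) y)
  (fun y _ m0 m2 => ~~ accept PX V2 w2 t2 (cb0 m0) (cb2 m0 m2) y).
have P1 := @decide_prob1_point n c (fun x => (sel0 x, sel1 x, sel2 x)) (fun x y =>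
  ~~ accept PX V1 w1 t1 (cb0 (sel0 x)) (cb1 (sel0 x) (sel1 x)) y) erefl
  (fun x y => erefl).
have P2 := @decide_prob2_point n c (fun x => (sel0 x, sel1 x, sel2 x)) (fun x y =>
  ~~ accept PX V2 w2 t2 (cb0 (sel0 x)) (cb2 (sel0 x) (sel2 x)) y) erefl
  (fun x y => erefl).
have F1 : decide_prob1 P c true =
    \sum_x iid PX x * c1 (cb0 (sel0 x)) (cb1 (sel0 x) (sel1 x)) x.
  rewrite (P1 P V1 true); last 2 first.
  - exact: (law_const P_pmf P_z1).
  - by move=> x y; rewrite law_kernel.
  apply: eq_bigr => x _; congr (_ * _); apply: eq_bigr => y _.
  by rewrite eqb_id.
have F2 : decide_prob2 P c true =
    \sum_x iid PX x * c2 (cb0 (sel0 x)) (cb2 (sel0 x) (sel2 x)) x.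
  rewrite (P2 P V2 true); last 2 first.
  - exact: (law_const P_pmf P_z2).
  - by move=> x y; rewrite law_kernel.
  apply: eq_bigr => x _; congr (_ * _); apply: eq_bigr => y _.
  by rewrite eqb_id.
have F1p : 0 <= decide_prob1 P c true by apply: decide_prob1_ge0; case: P_pmf.
have F2p : 0 <= decide_prob2 P c true by apply: decide_prob2_ge0; case: P_pmf.
have total : decide_prob1 P c true + decide_prob2 P c true <= eps.
  rewrite F1 F2; apply: le_trans HC _.
  have -> : eps = eps / 10 + eps / 10 + eps / 10 + eps / 10 + 6 * (eps / 10) by field.
  by rewrite !lerD// ler_wpM2l.
have sumPX : \sum_(x : {ffun 'I_n -> X}) iid PX x = 1 by exact: (proj2 (iid_pmf n PXp)).
exists c; split.
- by apply: le_trans total; rewrite lerDl.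
- by apply: le_trans total; rewrite lerDr.
- rewrite (P1 (alt_law P) (fun=> law P pY1) false); last 2 first.
  + exact: (alt_law_z1 P_pmf P_z1 P_z2).
  + exact: (law_alt1 P_pmf P_z1 P_z2).
  apply: (@le_trans _ _ (\sum_x iid PX x * 2 `^ (- (n%:R * t1)))); last first.
    by rewrite -mulr_suml [X in X * _]sumPX mul1r.
  apply: ler_sum => x _; rewrite ler_wpM2l ?iid_ge0//; first by case: PXp.
  have := accept_small t1 PXp V1p w1p (cb0 (sel0 x)) (cb1 (sel0 x) (sel1 x)).
  rewrite [push V1 PX](funext (push_kernel pX pY1 P_pmf)); apply: le_trans.
  by apply: ler_sum => y _; rewrite eqbF_neg negbK.
- rewrite (P2 (alt_law P) (fun=> law P pY2) false); last 2 first.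
  + exact: (alt_law_z2 P_pmf P_z1 P_z2).
  + exact: (law_alt2 P_pmf P_z1 P_z2).
  apply: (@le_trans _ _ (\sum_x iid PX x * 2 `^ (- (n%:R * t2)))); last first.
    by rewrite -mulr_suml [X in X * _]sumPX mul1r.
  apply: ler_sum => x _; rewrite ler_wpM2l ?iid_ge0//; first by case: PXp.
  have := accept_small t2 PXp V2p w2p (cb0 (sel0 x)) (cb2 (sel0 x) (sel2 x)).
  rewrite [push V2 PX](funext (push_kernel pX pY2 P_pmf)); apply: le_trans.
  by apply: ler_sum => y _; rewrite eqbF_neg negbK.
Qed.

(** Sharing time with the trivial point scales rates and exponents by l, so every positive rate
    strictly exceeds what is used, and a zero rate stays at 0. *)
Lemma Region_achievable l d theta1 theta2 eps : 0 < l < 1 -> 0 < d -> 0 < eps ->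
  Region PX V1 V2 1 R0 R1 R2 theta1 theta2 ->
  achievable P eps (Num.max 0 (l * theta1 - d)) (Num.max 0 (l * theta2 - d)) R0 R1 R2.
Proof.
move=> /andP[l0 l1] d0 eps0 H.
have V1_ge0 x y : 0 <= V1 x y by case: (V1p x).
have V2_ge0 x y : 0 <= V2 x y by case: (V2p x).
have l01 : 0 <= l <= 1 by rewrite !ltW.
have {}H := Region_convex V1_ge0 V2_ge0 l01 H (Region_trivial V1 V2 (proj1 PXp)).
rewrite !mulr0 !addr0 in H.
have slack r : 0 <= r -> l * r = 0 \/ l * r < r.
  rewrite le_eqVlt => /predU1P[<-|rp]; first by left; rewrite mulr0.
  by right; rewrite gtr_pMl.
have [N HN] := Region_codes H (slack _ R0p) (slack _ R1p) (slack _ R2p)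
  (ltac:(lra) : l * theta1 - d < l * theta1) (ltac:(lra) : l * theta2 - d < l * theta2)
  eps0.
have : forall n, exists c : code n,
    [/\ decide_prob1 P c true <= eps, decide_prob2 P c true <= eps & (N <= n)%N ->
      decide_prob1 (alt_law P) c false <= 2 `^ (- (n%:R * (l * theta1 - d))) /\
      decide_prob2 (alt_law P) c false <= 2 `^ (- (n%:R * (l * theta2 - d)))].
  move=> n; have [/HN[c [? ? ? ?]]|nN] := leqP N n; first by exists c.
  have [c [c1 c2]] := trivial_code n; exists c; split.
  - by rewrite c1 ltW.
  - by rewrite c2 ltW.
  - by [].
move=> Hc; pose c n := projT1 (cid (Hc n)).
have cP n := projT2 (cid (Hc n)).
exists c; split.
- by move=> n _; have [] := cP n.
- by move=> n _; have [] := cP n.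
- apply: (@decay_exponent_ge _ _ _ _ N) => n.
    by apply: decide_prob1_ge0; exact: alt_law_ge0.
  move=> Nn _; have [_ _ /(_ Nn)[h _]] := cP n.
  rewrite maxEle; case: ifP => // _.
  by rewrite mulr0 oppr0 powRr0; case: (decide_prob_alt_le1 (c n)).
- apply: (@decay_exponent_ge _ _ _ _ N) => n.
    by apply: decide_prob2_ge0; exact: alt_law_ge0.
  move=> Nn _; have [_ _ /(_ Nn)[_ h]] := cP n.
  rewrite maxEle; case: ifP => // _.
  by rewrite mulr0 oppr0 powRr0; case: (decide_prob_alt_le1 (c n)).
Qed.

Lemma Region_exponents_region theta : 0 <= theta.1 -> 0 <= theta.2 ->
  Region PX V1 V2 1 R0 R1 R2 theta.1 theta.2 ->
  exponents_region_SI P R0 R1 R2 theta.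
Proof.
move=> th1 th2 H B /nbhs_ballP[d /= d0 dB].
(* With this [D], scaling by 1 - d / D moves each exponent by at most d / 2; the further d / 4 keeps
   the total below d. *)
pose D := 2 * (theta.1 + theta.2 + 1) + 2 * d.
have D0 : 0 < D by rewrite /D; lra.
pose l := 1 - d / D.
have dD : 0 < d / D < 1 by rewrite divr_gt0//= ltr_pdivrMr// /D; lra.
have l01 : 0 < l < 1 by rewrite /l; lra.
have close t : 0 <= t -> t <= theta.1 + theta.2 ->
    `|t - Num.max 0 (l * t - d / 4)| < d.
  move=> t0 tt; have h : d / D * t <= d / 2.
    have -> : d / D * t = d * (t / D) by ring.
    by rewrite ler_pM2l// ler_pdivrMr// /D; move: tt d0; lra.
  have h0 : 0 <= d / D * t by rewrite mulr_ge0//; case/andP: dD => /ltW.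
  have -> : l * t - d / 4 = t - d / D * t - d / 4 by rewrite /l; ring.
  by rewrite ltr_norml; case: (leP 0 (t - d / D * t - d / 4)) => ?; move: d0 h h0 t0; lra.
exists (Num.max 0 (l * theta.1 - d / 4), Num.max 0 (l * theta.2 - d / 4)); split.
  split; rewrite /= ?le_max ?lexx// => eps /andP[eps0 _].
  by apply: Region_achievable => //; rewrite divr_gt0.
apply: dB; split => /=.
  by apply: close => //; rewrite lerDl.
by apply: close => //; rewrite lerDr.
Qed.

End Achievability.

Theorem theorem2 (R : realType) (X Y1 Y2 Z1 Z2 : finType)
    (P : X * Y1 * Y2 * Z1 * Z2 -> R) (P_pmf : is_pmf P)
    (Z1_const : exists z1, law P (@srcZ1 X Y1 Y2 Z1 Z2) z1 = 1)
    (Z2_const : exists z2, law P (@srcZ2 X Y1 Y2 Z1 Z2) z2 = 1)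
    (R0 R1 R2 : R) (R0_ge0 : 0 <= R0) (R1_ge0 : 0 <= R1) (R2_ge0 : 0 <= R2) :
  exponents_region_SI P R0 R1 R2 = inner_region_SI P R0 R1 R2 /\
  inner_region_SI P R0 R1 R2 =
    region_GW (law P [% @srcX X Y1 Y2 Z1 Z2, @srcY1 X Y1 Y2 Z1 Z2,
                        @srcY2 X Y1 Y2 Z1 Z2]) R0 R1 R2.
Proof.
have [z1 P_z1] := Z1_const; have [z2 P_z2] := Z2_const.
have innerP theta := inner_region_SIP P_pmf P_z1 P_z2 theta R0_ge0 R1_ge0 R2_ge0.
split; apply/seteqP; split=> theta.
- move=> /(exponents_region_Region P_pmf P_z1 P_z2 R0_ge0 R1_ge0 R2_ge0) H.
  exact/innerP.
- move=> /innerP[t1 t2 H].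
  exact: (Region_exponents_region P_pmf P_z1 P_z2 R0_ge0 R1_ge0 R2_ge0 t1 t2 H).
- by move=> /innerP H; apply/(region_GWP P_pmf).
- by move=> /(region_GWP P_pmf) H; apply/innerP.
Qed.
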